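(* For any $n\ge2$ and any bounded measurable function $f=f(R^n)$ of $R^n=(R_s(\sigma^\ell,\sigma^{\ell'}))_{s\in\mathcal S,\ \ell,\ell'\le n}$, we have $\lim_{N\to\infty}\mathbb E_x\,\Delta(f,n,w,p)=0$ for all $p\ge1$ and $w\in\mathcal W$, where $\Delta(f,n,w,p)$ is defined in the context.
   Context: Setting: $\mathcal S$ a finite set; $\{1,\dots,N\}=\bigcup_{s}I_s$ disjoint, $N_s=|I_s|$, $N_s/N\to\lambda_s\in(0,1)$ (write $\lambda_s$ also for $N_s/N$); $H_N(\sigma)=N^{-1/2}\sum_{i,j=1}^Ng_{ij}\sigma_i\sigma_j$ on $\Sigma_N=\{-1,1\}^N$ with $(g_{ij})$ independent centered Gaussian, $\mathbb E g_{ij}^2=\Delta^2_{st}$ for $i\in I_s,j\in I_t$, $\Delta^2$ symmetric. $R_s(\sigma^1,\sigma^2)=N_s^{-1}\sum_{i\in I_s}\sigma^1_i\sigma^2_i$. Let $\mathcal W$ be a countable dense subset of $[0,1]^{|\mathcal S|}$ and $j:\mathcal W\to\mathbb N$ one-to-one. For $w=(w_s)\in\mathcal W$, set $s_i(w)=\sqrt{w_s}$ for $i\in I_s$, and $h_{N,w,p}(\sigma)=N^{-p/2}\sum_{i_1,\dots,i_p=1}^N g^{w,p}_{i_1\dots i_p}\sigma_{i_1}s_{i_1}(w)\cdots\sigma_{i_p}s_{i_p}(w)$ with $g^{w,p}_{i_1\dots i_p}$ i.i.d. standard Gaussian (independent over all $p\ge1$, $w$, indices, and of $(g_{ij})$).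 Let $x=(x_{w,p})_{p\ge1,w\in\mathcal W}$ be i.i.d. uniform on $[1,2]$, $h_N(\sigma)=\sum_{w\in\mathcal W}\sum_{p\ge1}2^{-j(w)-p}x_{w,p}h_{N,w,p}(\sigma)$, and $H^{\rm pert}_N(\sigma)=H_N(\sigma)+s_Nh_N(\sigma)$ with $s_N=N^\gamma$ for a fixed $1/4<\gamma<1/2$. Let $G_N(\sigma)=\exp H^{\rm pert}_N(\sigma)/\sum_{\sigma'}\exp H^{\rm pert}_N(\sigma')$, $\langle\cdot\rangle$ the average with respect to $G_N^{\otimes\infty}$ over replicas $(\sigma^\ell)_{\ell\ge1}$, $\mathbb E$ the expectation conditional on $x$, and $\mathbb E_x$ the expectation in $x$. Let $R_w(\sigma^1,\sigma^2)=\sum_s\lambda_sw_sR_s(\sigma^1,\sigma^2)$ and $$\Delta(f,n,w,p)=\Bigl|\mathbb E\langle fR_w(\sigma^1,\sigma^{n+1})^p\rangle-\frac1n\mathbb E\langle f\rangle\,\mathbb E\langle R_w(\sigma^1,\sigma^2)^p\rangle-\frac1n\sum_{\ell=2}^n\mathbb E\langle fR_w(\sigma^1,\sigma^\ell)^p\rangle\Bigr|.$$ *)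

(* Defs.v *)
From HB Require Import structures.
From mathcomp Require Import all_boot all_order all_algebra.
From mathcomp Require Import finmap.
From mathcomp Require Import all_classical all_reals all_analysis.

Set Implicit Arguments.
Unset Strict Implicit.
Unset Printing Implicit Defensive.

Import Order.TTheory GRing.Theory Num.Theory.
Import numFieldNormedType.Exports.

Local Open Scope classical_set_scope.
Local Open Scope ring_scope.

Definition mutually_independent {d} {T : measurableType d} {R : realType}
    (P : probability T R) {I : choiceType} (D : set I) (X : I -> T -> R) : Prop :=
  forall (F : {fset I}), [set` F] `<=` D ->
  forall B : I -> set R, (forall i, measurable (B i)) ->
  P (\bigcap_(i in [set` F]) (X i @^-1` B i)) =
    (\prod_(i <- F) P (X i @^-1` B i))%E.

Definition centered_gaussian {d} {T : measurableType d} {R : realType}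
    (P : probability T R) (X : T -> R) (v : R) : Prop :=
  measurable_fun setT X /\
  (v = 0 -> P (X @^-1` [set 0]) = 1%E) /\
  (v != 0 -> forall B, measurable B ->
     P (X @^-1` B) = normal_prob 0 (Num.sqrt v) B).

Lemma lt12 {R : realType} : (1 : R) < 2.
Proof. by rewrite ltr1n. Qed.

Definition uniform12 {d} {T : measurableType d} {R : realType}
    (P : probability T R) (X : T -> R) : Prop :=
  measurable_fun setT X /\
  forall B, measurable B -> P (X @^-1` B) = uniform_prob (@lt12 R) B.

Section model.
Context {R : realType} {S : finType}.

Definition spin (b : bool) : R := if b then 1 else -1.

(** N_s = |I_s|, where spec : 'I_N -> S assigns each site its species *)
Definition Nsp N (spec : 'I_N -> S) (s : S) : nat := #|[set i | spec i == s]|.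

Definition overlap_s N (spec : 'I_N -> S) (s : S)
    (s1 s2 : {ffun 'I_N -> bool}) : R :=
  (Nsp spec s)%:R^-1 * \sum_(i | spec i == s) spin (s1 i) * spin (s2 i).

Definition overlap_w N (spec : 'I_N -> S) (w : S -> R)
    (s1 s2 : {ffun 'I_N -> bool}) : R :=
  \sum_(s : S) ((Nsp spec s)%:R / N%:R) * w s * overlap_s spec s s1 s2.

Definition H_SK N (g : 'I_N -> 'I_N -> R) (sg : {ffun 'I_N -> bool}) : R :=
  (Num.sqrt N%:R)^-1 *
    \sum_(i < N) \sum_(j < N) g i j * spin (sg i) * spin (sg j).

(** h_{N,w,p}(sigma), for a realization gp of the g^{w,p}_{i_1..i_p}
    (indexed by the sequence [:: i_1; ...; i_p]) *)
Definition h_wp N (spec : 'I_N -> S) (w : S -> R) (p : nat)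
    (gp : seq 'I_N -> R) (sg : {ffun 'I_N -> bool}) : R :=
  ((Num.sqrt N%:R)^-1) ^+ p *
    \sum_(t : p.-tuple 'I_N)
       gp (val t) * \prod_(k < p)
         (spin (sg (tnth t k)) * Num.sqrt (w (spec (tnth t k)))).

(** h_N(sigma) = sum_{w in W} sum_{p >= 1} 2^{-j(w)-p} x_{w,p} h_{N,w,p}(sigma).
    The pair (W, j) is encoded by J = j(W) (a set of naturals) and
    wof = j^{-1} : J -> W; the variables are indexed by m = j(w). *)
Definition h_N N (spec : 'I_N -> S) (J : set nat) (wof : nat -> S -> R)
    (x : nat -> nat -> R) (gP : nat -> seq 'I_N -> R)
    (sg : {ffun 'I_N -> bool}) : R :=
  limn (fun K : nat => \sum_(m < K) \sum_(1 <= p < K)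
     (if `[< J m >] then
        (2 : R) ^- (m + p) * x m p * h_wp spec (wof m) p (gP m) sg
      else 0)).

Definition H_pert N (spec : 'I_N -> S) (J : set nat) (wof : nat -> S -> R)
    (gamma : R) (x : nat -> nat -> R) (g : 'I_N -> 'I_N -> R)
    (gP : nat -> seq 'I_N -> R) (sg : {ffun 'I_N -> bool}) : R :=
  H_SK g sg + (N%:R `^ gamma) * h_N spec J wof x gP sg.

Definition gibbs N (H : {ffun 'I_N -> bool} -> R) (sg : {ffun 'I_N -> bool}) : R :=
  expR (H sg) / \sum_(sg' : {ffun 'I_N -> bool}) expR (H sg').

Definition gibbs_avg N (H : {ffun 'I_N -> bool} -> R) (k : nat)
    (F : {ffun 'I_k -> {ffun 'I_N -> bool}} -> R) : R :=
  \sum_(ss : {ffun 'I_k -> {ffun 'I_N -> bool}})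
     (\prod_(l < k) gibbs H (ss l)) * F ss.

Definition overlap_array N (spec : 'I_N -> S) (n : nat)
    (ss : 'I_n -> {ffun 'I_N -> bool}) :
    #|{: S * 'I_n * 'I_n}|.-tuple R :=
  [tuple overlap_s spec (enum_val i).1.1 (ss (enum_val i).1.2) (ss (enum_val i).2)
    | i < #|{: S * 'I_n * 'I_n}|].

End model.

(** Delta(f, n, w, p) at size N, for a fixed realization x of the
    perturbation parameters; E is the expectation over the Gaussian
    disorder (gSK, gP) on the probability space (Omega, P), i.e. the
    expectation conditional on x.  Replicas sigma^1, ..., sigma^{n+1}
    are indexed by 0, ..., n. *)
Definition Delta {R : realType} {S : finType} {d} {Omega : measurableType d}
    (P : probability Omega R)
    (spec : forall N, 'I_N -> S) (J : set nat) (wof : nat -> S -> R) (gamma : R)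
    (gSK : forall N, 'I_N -> 'I_N -> Omega -> R)
    (gP : forall N, nat -> seq 'I_N -> Omega -> R)
    (N : nat) (n : nat) (f : #|{: S * 'I_n * 'I_n}|.-tuple R -> R)
    (w : S -> R) (p : nat) (x : nat -> nat -> R) : R :=
  let H (om : Omega) := H_pert (spec N) J wof gamma x
                          (fun i j => gSK N i j om) (fun m t => gP N m t om) in
  let E (F : {ffun 'I_n.+1 -> {ffun 'I_N -> bool}} -> R) :=
    Rintegral P setT (fun om => gibbs_avg (H om) F) in
  let fR (ss : {ffun 'I_n.+1 -> {ffun 'I_N -> bool}}) :=
    f (overlap_array (spec N) (fun i : 'I_n => ss (widen_ord (leqnSn n) i))) in
  let Rw (ss : {ffun 'I_n.+1 -> {ffun 'I_N -> bool}}) (l : 'I_n.+1) :=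
    overlap_w (spec N) w (ss ord0) (ss l) ^+ p in
  `| E (fun ss => fR ss * Rw ss ord_max)
     - n%:R^-1 * E fR * E (fun ss => Rw ss (inord 1))
     - n%:R^-1 * \sum_(1 <= l < n) E (fun ss => fR ss * Rw ss (inord l)) |.

(* Main.v *)
(* Fix a realization of the other x's and let theta(z) be the mean free energy as
   a function of z = x_{w,p}; here z multiplies c g, where c = N^gamma 2^-(j(w)+p)
   and g = h_{N,w,p}. Gaussian integration by parts turns the covariance of f and
   g into the combination inside Delta, whence n c z Delta <= sup |f| E<|g - E<g>|>.
   Convexity of the free energy gives
     h c E<|g - E<g>|> <= 2 + 4 V + theta(z + h) + theta(z - h) - 2 theta(z),
   where V bounds the mean deviation of the free energy from its expectation;
   the Efron-Stein inequality gives V = O(sqrt N). Averaging over z uniform on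
   [1, 2] bounds the second difference by 12 h^2 c^2, because theta' = O(c^2).
   Hence E_x Delta <= (sup |f| / n) ((2 + 4 V) / (h c^2) + 12 h), and c^2 is of
   order N^(2 gamma) with 2 gamma > 1/2: first N -> oo, then h -> 0.
   All this is done for the truncated series of h_N. The truncations converge
   almost surely, as 2^-(j(w)+p) E|h_{N,w,p}| is summable, and the bound, which
   does not depend on the truncation, passes to the limit by dominated
   convergence. *)

Require Import Defs.
From HB Require Import structures.
From mathcomp Require Import all_boot all_order all_algebra.
From mathcomp Require Import finmap.
From mathcomp Require Import ring lra.
From mathcomp Require Import all_classical all_reals all_analysis.
From mathcomp Require Import measurable_realfun.
Import Order.TTheory GRing.Theory Num.Theory.
Import numFieldNormedType.Exports.
Set Implicit Arguments.
Unset Strict Implicit.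
Local Open Scope classical_set_scope.
Local Open Scope ring_scope.


(** * Resampling one coordinate *)

(** Everything rests on one operation: replacing a single coordinate of an independent family by a
    fresh copy leaves the joint law unchanged. Iterated, this gives the Efron-Stein inequality; with
    Fubini, it reduces Gaussian integration by parts to one real variable; applied to the
    parameters, it exposes x_{w,p} as an integration over [1, 2]. The obstacle is the size of the
    fluctuations. The free energy, taken without the factor 1/N, deviates by at most order sqrt N,
    and this has to be beaten by c^2, of order N^(2 gamma): whence gamma > 1/4. Conversely, gamma <
    1/2 keeps the share of the perturbation in the variance of order N. Nothing is differentiated
    under an expectation. Jensen's inequality makes c E<g> a subgradient of theta, and integration
    by parts bounds it by 2 z c^2. As z stays below 3, increments of theta over a step h are at most
    6 h c^2; the integrated second difference leaves two end intervals of length h, whence 12 h^2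
    c^2. *)

Definition cyl {R : realType} {I : choiceType} (F : {fset I}) (B : I -> set R)
  : set (I -> R) := [set t | forall i, i \in F -> B i (t i)].

Definition cylinders {R : realType} {I : choiceType} (D : set I)
  : set (set (I -> R)) :=
  [set A | exists F B, [/\ [set` F] `<=` D,
     forall i, measurable (B i) & A = cyl F B]].

(* Only the coordinates in [D] are measurable: those outside [D] carry random
   variables about which nothing is assumed. *)
Definition coord_space {R : realType} {I : choiceType} (D : set I) :=
  g_sigma_algebraType (@cylinders R I D).

Definition upd {R : realType} {I : choiceType} (t : I -> R) (k : I) (z : R)
  : I -> R := fun i => if i == k then z else t i.

Section coord_space_measurability.
Context {R : realType} {I : choiceType} (D : set I).

Lemma updE (t : I -> R) k z : upd t k z k = z.
Proof. by rewrite /upd eqxx. Qed.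

Lemma upd_neq (t : I -> R) k z i : i != k -> upd t k z i = t i.
Proof. by rewrite /upd => /negbTE ->. Qed.

Lemma upd_upd (t : I -> R) k z z' : upd (upd t k z) k z' = upd t k z'.
Proof. by apply/funext => i; rewrite /upd; case: eqP. Qed.

Lemma updC (t : I -> R) k l z z' : k != l ->
  upd (upd t k z) l z' = upd (upd t l z') k z.
Proof.
move=> kl; apply/funext => i; rewrite /upd.
by case: (eqVneq i l) => // ->; rewrite eq_sym (negbTE kl).
Qed.

(** Stability under intersection is what allows two laws to be compared on cylinders alone. *)
Lemma setI_cylinders : setI_closed (@cylinders R I D).
Proof.
move=> _ _ [F1 [B1 [F1D mB1 ->]]] [F2 [B2 [F2D mB2 ->]]].
exists (F1 `|` F2)%fset.
exists (fun i => (if i \in F1 then B1 i else setT) `&`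
                 (if i \in F2 then B2 i else setT)); split.
- by move=> i /=; rewrite inE => /orP[/F1D|/F2D].
- by move=> i; apply: measurableI; case: ifP.
- apply/seteqP; split => t.
    move=> [t1 t2] i _; split; case: ifP => // iF; [exact: t1|exact: t2].
  move=> t12; split => i iF; have := t12 i; rewrite inE iF ?orbT => /(_ isT)[];
    by rewrite ?orbT.
Qed.

Lemma measurable_coord i : D i -> measurable_fun setT (fun t : @coord_space R I D => t i).
Proof.
move=> Di _ B mB; rewrite setTI; apply: sub_sigma_algebra.
exists [fset i]%fset, (fun=> B); split => //.
- by move=> j /=; rewrite inE => /eqP ->.
- apply/seteqP; split => t /=; first by move=> tB j; rewrite inE => /eqP ->.
  by apply; rewrite inE.
Qed.

Lemma measurable_to_coord_space d (T : measurableType d) (f : T -> @coord_space R I D) :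
  (forall i, D i -> measurable_fun setT (fun x => f x i)) ->
  measurable_fun setT f.
Proof.
move=> mf; apply: (@measurability _ _ T (@coord_space R I D) setT f (@cylinders R I D)) => //.
move=> _ [_ [F [B [FD mB ->]]] <-]; rewrite setTI.
rewrite (_ : _ @^-1` _ = \bigcap_(i in [set` F]) ((f ^~ i) @^-1` B i)).
  apply: fin_bigcap_measurable => // i iF.
  by rewrite -[X in measurable X]setTI; apply: mf => //; exact: FD.
by apply/seteqP; split => x /= h i iF; exact: h.
Qed.

Lemma measurable_upd k :
  measurable_fun setT
    (fun p : @coord_space R I D * R => upd p.1 k p.2 : @coord_space R I D).
Proof.
apply: measurable_to_coord_space => i Di; rewrite /upd; case: eqP => _.
  exact: measurable_snd.
exact: (measurableT_comp (measurable_coord Di) measurable_fst).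
Qed.

Lemma measurable_upd2 d (T : measurableType d) k (f : T -> @coord_space R I D) (g : T -> R) :
  measurable_fun setT f -> measurable_fun setT g ->
  measurable_fun setT (fun x => upd (f x) k (g x) : @coord_space R I D).
Proof.
move=> mf mg; exact: (measurableT_comp (measurable_upd k) (measurable_fun_pair mf mg)).
Qed.

End coord_space_measurability.

Section resampling.
Context {R : realType} {I : choiceType} (D : set I).
Context {d} {Om : measurableType d} (P : probability Om R).
Variable G : I -> Om -> R.
Hypothesis mG : forall i, D i -> measurable_fun setT (G i).
Hypothesis indG : mutually_independent P D G.

Definition sample (om : Om) : @coord_space R I D := fun i => G i om.

Lemma measurable_sample : measurable_fun setT sample.
Proof. exact: measurable_to_coord_space. Qed.

Variable k : I.
Hypothesis Dk : D k.

Definition resampled (p : Om * Om) : @coord_space R I D :=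
  upd (sample p.1) k (G k p.2).

Lemma measurable_resampled : measurable_fun setT resampled.
Proof.
apply: measurable_upd2; first exact: (measurableT_comp measurable_sample).
exact: (measurableT_comp (mG Dk)).
Qed.

Lemma law_cyl (F : {fset I}) (B : I -> set R) : [set` F] `<=` D ->
  (forall i, measurable (B i)) ->
  P (sample @^-1` cyl F B) = (\prod_(i <- F) P (G i @^-1` B i))%E.
Proof.
move=> FD mB; by rewrite -(indG FD mB); congr (P _); apply/seteqP; split => x /= h i iF; exact: h.
Qed.

HB.instance Definition _ := isMeasurableFun.Build _ _ _ _ _ measurable_sample.
HB.instance Definition _ := isMeasurableFun.Build _ _ _ _ _ measurable_resampled.

(** Both laws give a cylinder the product of its marginal probabilities: by independence on the
    left, and on the right because coordinate [k] is read in the second factor and all others in the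
    first. Cylinders form a generating pi-system. *)
Lemma resampled_law (A : set (@coord_space R I D)) : measurable A ->
  pushforward P sample A = pushforward (P \x P)%E resampled A.
Proof.
move=> mA; apply: (@measure_unique _ R (@coord_space R I D) (@cylinders R I D) (fun=> setT) _ _ _ _
  (pushforward P sample) (pushforward (P \x P)%E resampled)) => //.
- exact: setI_cylinders.
- move=> _; exists fset0, (fun=> setT); split => //.
  by apply/seteqP; split => // t _ i.
- by apply/seteqP; split => // t _; exists 0%N.
- move=> _ [F [B [FD mB ->]]] /=; rewrite /pushforward law_cyl//.
  (* The preimage is a rectangle; its second side is the whole space when [k] is not constrained by
     the cylinder. *)
  have -> : resampled @^-1` cyl F B =
    (sample @^-1` cyl (F `\ k)%fset B) `*`
    (G k @^-1` (if k \in F then B k else setT)).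
    apply/seteqP; split => -[a b] /=.
      move=> h; split => /= [i|]; first rewrite !inE => /andP[ik iF].
        by have := h i iF; rewrite /resampled upd_neq.
      by case: ifPn => // kF; have := h k kF; rewrite /resampled updE.
    move=> [/= h1 h2] i iF; rewrite /resampled/=.
    have [ik|ik] := eqVneq i k; first by move: h2; rewrite -ik iF updE.
    by rewrite upd_neq//; apply: h1; rewrite !inE ik.
  have lawF : P (sample @^-1` cyl (F `\ k)%fset B) =
      (\prod_(i <- (F `\ k)%fset) P (G i @^-1` B i))%E.
    by apply: law_cyl => // i /=; rewrite !inE => /andP[_ /FD].
  rewrite product_measure1E//.
  + transitivity (P (sample @^-1` cyl (F `\ k)%fset B) *
       P (G k @^-1` (if k \in F then B k else setT)))%E => //.
    rewrite lawF; case: ifPn => kF; first by rewrite (big_fsetD1 k)//= muleC.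
    by rewrite preimage_setT probability_setT mule1 mem_fsetD1.
  + rewrite -[X in measurable X]setTI; apply: measurable_sample => //.
    apply: sub_sigma_algebra; exists (F `\ k)%fset, B; split => //.
    by move=> i /=; rewrite !inE => /andP[_ /FD].
  + rewrite -[X in measurable X]setTI; apply: mG => //.
    by case: ifP.
- by move=> _; rewrite /= /pushforward preimage_setT probability_setT ltry.
Qed.

(** Tonelli's form of resampling. It is available before integrability is known, and the
    integrability of [F] in [efron_stein] is derived from it. *)
Lemma resample_ge0 (F : @coord_space R I D -> \bar R) : measurable_fun setT F ->
  (forall t, 0 <= F t)%E ->
  (\int[P]_om F (sample om) =
   \int[P]_om \int[P]_om' F (upd (sample om) k (G k om')))%E.
Proof.
move=> mF F0.
have -> : (\int[P]_om F (sample om) = \int[pushforward P sample]_t F t)%E.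
  by rewrite ge0_integral_pushforward.
rewrite (eq_measure_integral (pushforward (P \x P)%E resampled)); last first.
  by move=> A mA _; apply: resampled_law.
rewrite ge0_integral_pushforward//.
rewrite preimage_setT (@fubini_tonelli1 _ _ _ _ _ _ _ (F \o resampled))//.
  exact: (measurableT_comp mF measurable_resampled).
by move=> x; exact: F0.
Qed.

Lemma resample_integrable (F : @coord_space R I D -> R) : measurable_fun setT F ->
  P.-integrable setT (EFin \o (F \o sample)) ->
  (P \x P)%E.-integrable setT (EFin \o (F \o resampled)).
Proof.
move=> mF /integrableP[_ iF]; apply/integrable12ltyP.
  apply/measurable_EFinP; exact: (measurableT_comp mF measurable_resampled).
apply: le_lt_trans iF; rewrite (@resample_ge0 (fun t => `|F t|%:E))//.
by apply/measurable_EFinP; exact: measurableT_comp.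
Qed.

Lemma resample_integral (F : @coord_space R I D -> \bar R) : measurable_fun setT F ->
  P.-integrable setT (F \o sample) -> (P \x P)%E.-integrable setT (F \o resampled) ->
  (\int[P]_om F (sample om) = \int[P \x P]_z F (resampled z))%E.
Proof.
move=> mF iF1 iF2.
transitivity (\int[pushforward P sample]_t F t)%E.
  by rewrite (integral_pushforward measurable_sample).
rewrite (eq_measure_integral (pushforward (P \x P)%E resampled)); last first.
  by move=> A mA _; apply: resampled_law.
by rewrite (integral_pushforward measurable_resampled).
Qed.

End resampling.

(** * The Efron-Stein inequality *)

Section integrability.
Context {R : realType} {d} {T : measurableType d}.

Lemma EFin_Rintegral (mu : {measure set T -> \bar R}) (f : T -> R) :
  mu.-integrable setT (EFin \o f) ->
  (\int[mu]_x f x)%:E = (\int[mu]_x (f x)%:E)%E.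
Proof. by move=> fi; rewrite fineK// integrable_fin_num. Qed.

Lemma Rintegral_le_EFin (mu : {measure set T -> \bar R}) (f : T -> R) c :
  mu.-integrable setT (EFin \o f) ->
  (\int[mu]_x f x <= c) = (\int[mu]_x (f x)%:E <= c%:E)%E.
Proof. by move=> fi; rewrite -lee_fin EFin_Rintegral. Qed.

Lemma integrableD_EFin (mu : {measure set T -> \bar R}) (f g : T -> R) :
  mu.-integrable setT (EFin \o f) -> mu.-integrable setT (EFin \o g) ->
  mu.-integrable setT (EFin \o (fun x => f x + g x)).
Proof.
move=> fi gi; apply: eq_integrable (integrableD measurableT fi gi) => // x _.
Qed.

Lemma integrableB_EFin (mu : {measure set T -> \bar R}) (f g : T -> R) :
  mu.-integrable setT (EFin \o f) -> mu.-integrable setT (EFin \o g) ->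
  mu.-integrable setT (EFin \o (fun x => f x - g x)).
Proof.
move=> fi gi; apply: eq_integrable (integrableB measurableT fi gi) => // x _.
Qed.

Lemma integrableZ_EFin (mu : {measure set T -> \bar R}) (c : R) (f : T -> R) :
  mu.-integrable setT (EFin \o f) ->
  mu.-integrable setT (EFin \o (fun x => c * f x)).
Proof.
move=> fi; apply: eq_integrable (integrableZl measurableT c fi) => // x _.
Qed.

Lemma integrable_sum_EFin (mu : {measure set T -> \bar R}) (J : Type) (s : seq J)
    (Q : pred J) (f : J -> T -> R) :
  (forall j, Q j -> mu.-integrable setT (EFin \o f j)) ->
  mu.-integrable setT (EFin \o (fun x => \sum_(j <- s | Q j) f j x)).
Proof.
move=> fi; elim: s => [|j s IH].
  apply: eq_integrable (integrable0 mu setT) => // x _.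
  by rewrite /= big_nil.
have [Qj|Qj] := boolP (Q j); last first.
  by apply: eq_integrable IH => // x _; rewrite /= big_cons (negbTE Qj).
apply: eq_integrable (integrableD_EFin (fi j Qj) IH) => // x _.
by rewrite /= big_cons Qj.
Qed.

Lemma Rintegral_sum (mu : {measure set T -> \bar R}) (J : Type) (s : seq J)
    (Q : pred J) (f : J -> T -> R) :
  (forall j, Q j -> mu.-integrable setT (EFin \o f j)) ->
  \int[mu]_x \sum_(j <- s | Q j) f j x = \sum_(j <- s | Q j) \int[mu]_x f j x.
Proof.
move=> fi; elim: s => [|j s IH].
  rewrite big_nil; under eq_Rintegral do rewrite big_nil.
  by rewrite /Rintegral integral0.
rewrite big_cons; under eq_Rintegral do rewrite big_cons.
case: ifPn => // Qj; rewrite RintegralD ?IH//; first exact: fi.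
exact: integrable_sum_EFin.
Qed.

Variable P : probability T R.

Lemma Rintegral_prob_cst (c : R) : \int[P]_x c = c.
Proof. by rewrite Rintegral_cst//= probability_setT mulr1. Qed.

Lemma integrable_prob_cst (c : R) : P.-integrable setT (EFin \o cst c).
Proof. exact: finite_measure_integrable_cst. Qed.

Lemma integrable_bound (f g : T -> R) : measurable_fun setT f ->
  P.-integrable setT (EFin \o g) -> (forall x, `|f x| <= g x) ->
  P.-integrable setT (EFin \o f).
Proof.
move=> mf ig fg; apply: le_integrable ig => //; first exact/measurable_EFinP.
by move=> x _ /=; rewrite lee_fin (le_trans (fg x))// ler_norm.
Qed.

Lemma integrable_bounded (f : T -> R) M : measurable_fun setT f ->
  (forall x, `|f x| <= M) -> P.-integrable setT (EFin \o f).
Proof. by move=> mf fM; apply: (integrable_bound mf (integrable_prob_cst M)). Qed.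

Lemma integrable_sqr_ltoo (f : T -> R) (c : R) : measurable_fun setT f ->
  (\int[P]_x (f x ^+ 2)%:E <= c%:E)%E ->
  P.-integrable setT (EFin \o (fun x => f x ^+ 2)).
Proof.
move=> mf fc; apply/integrableP; split.
  exact/measurable_EFinP/measurable_funX.
under eq_integral do rewrite /= ger0_norm ?sqr_ge0//.
exact: le_lt_trans fc (ltry _).
Qed.

Lemma integrable_of_sqr (f : T -> R) : measurable_fun setT f ->
  P.-integrable setT (EFin \o (fun x => f x ^+ 2)) ->
  P.-integrable setT (EFin \o f).
Proof.
move=> mf f2; apply: (@integrable_bound _ (fun x => 1 + f x ^+ 2)) => //.
  exact: (integrableD_EFin (integrable_prob_cst 1)).
move=> x; rewrite ler_norml; apply/andP; split; nra.
Qed.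

(** Integrate [|f| <= f^2 / (2 r) + r / 2], which is the expansion of [(|f| - r)^2 >= 0]. *)
Lemma Rintegral_normr_le (f : T -> R) (r : R) : 0 < r -> measurable_fun setT f ->
  (\int[P]_x (f x ^+ 2)%:E <= (r ^+ 2)%:E)%E -> \int[P]_x `|f x| <= r.
Proof.
move=> r0 mf fr; have i2 := integrable_sqr_ltoo mf fr.
have i1 := integrable_of_sqr mf i2.
have i3 : P.-integrable setT (EFin \o (fun x => (2 * r)^-1 * f x ^+ 2)).
  exact: integrableZ_EFin.
have i4 := integrable_prob_cst (r / 2).
apply: (@le_trans _ _ (\int[P]_x ((2 * r)^-1 * f x ^+ 2 + cst (r / 2) x))).
  apply: le_Rintegral => //.
  - exact: (integrable_norm i1).
  - exact: (integrableD_EFin i3 i4).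
  - move=> x _ /=; set u := `|f x|; have -> : f x ^+ 2 = u ^+ 2 by rewrite real_normK ?num_real.
    have -> : (2 * r)^-1 * u ^+ 2 + r / 2 = u + (u - r) ^+ 2 / (2 * r).
      by field; rewrite gt_eqF.
    by rewrite lerDl divr_ge0 ?sqr_ge0// mulr_ge0// ltW.
rewrite RintegralD// RintegralZl//= Rintegral_prob_cst.
have : \int[P]_x (f x ^+ 2) <= r ^+ 2 by rewrite Rintegral_le_EFin.
move=> h; apply: (@le_trans _ _ ((2 * r)^-1 * r ^+ 2 + r / 2)).
  by rewrite lerD2r ler_wpM2l// invr_ge0 mulr_ge0// ltW.
by rewrite le_eqVlt; apply/orP; left; apply/eqP; field; rewrite gt_eqF.
Qed.

(** The variance of [psi (X)] is at most its second moment about [psi 0], and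
    [|psi (X) - psi 0| <= L |X|]. Centering at an arbitrary [m] adds the squared bias; in
    [efron_stein], [m] is the mean over all coordinates while the integral is over one. *)
Lemma var_lipschitz (X : T -> R) (psi : R -> R) (L v : R) :
  measurable_fun setT X -> measurable_fun setT psi ->
  (\int[P]_x (X x ^+ 2)%:E <= v%:E)%E ->
  (forall z z', `|psi z - psi z'| <= L * `|z - z'|) ->
  P.-integrable setT (EFin \o (psi \o X)) /\
  forall m, (\int[P]_x ((psi (X x) - m) ^+ 2)%:E <=
    (L ^+ 2 * v + (\int[P]_x psi (X x) - m) ^+ 2)%:E)%E.
Proof.
move=> mX mpsi Xv lip.
have iX2 := integrable_sqr_ltoo mX Xv.
pose Y x := psi (X x) - psi 0.
have mY : measurable_fun setT Y.
  by apply: measurable_funB => //; exact: measurableT_comp.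
have YX x : Y x ^+ 2 <= L ^+ 2 * X x ^+ 2.
  have := lip (X x) 0; rewrite subr0 -/(Y x) => h.
  rewrite -(real_normK (num_real (Y x))) -(real_normK (num_real (X x))) -exprMn.
  by rewrite ler_sqr ?nnegrE// (le_trans _ h).
have iLX : P.-integrable setT (EFin \o (fun x => L ^+ 2 * X x ^+ 2)).
  exact: integrableZ_EFin.
have iY2 : P.-integrable setT (EFin \o (fun x => Y x ^+ 2)).
  apply: (integrable_bound _ iLX); first exact: measurable_funX.
  by move=> x; rewrite ger0_norm ?sqr_ge0.
have iY := integrable_of_sqr mY iY2.
have psiE x : psi (X x) = Y x + psi 0 by rewrite /Y subrK.
have ipsi : P.-integrable setT (EFin \o (psi \o X)).
  apply: eq_integrable (integrableD_EFin iY (integrable_prob_cst (psi 0))) => // x _.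
  by rewrite /= psiE.
split => // m; set b := psi 0 - m.
have iYb : P.-integrable setT (EFin \o (fun x => 2 * b * Y x)).
  exact: integrableZ_EFin.
have E1 : \int[P]_x psi (X x) = \int[P]_x Y x + psi 0.
  under eq_Rintegral do rewrite psiE.
  by rewrite (RintegralD measurableT iY (integrable_prob_cst _)) Rintegral_prob_cst.
have i1 : P.-integrable setT (EFin \o (fun x => Y x ^+ 2 + 2 * b * Y x)).
  exact: (integrableD_EFin iY2 iYb).
have i2 : P.-integrable setT (EFin \o (fun x => Y x ^+ 2 + 2 * b * Y x + cst (b ^+ 2) x)).
  exact: (integrableD_EFin i1 (integrable_prob_cst _)).
have E2 x : (psi (X x) - m) ^+ 2 = Y x ^+ 2 + 2 * b * Y x + cst (b ^+ 2) x.
  by rewrite psiE /b /=; ring.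
under eq_integral do rewrite E2.
rewrite -Rintegral_le_EFin// (RintegralD measurableT i1 (integrable_prob_cst _)).
rewrite Rintegral_prob_cst RintegralD// RintegralZl// E1.
have : \int[P]_x (Y x ^+ 2) <= L ^+ 2 * v.
  apply: (@le_trans _ _ (\int[P]_x (L ^+ 2 * X x ^+ 2))); first exact: le_Rintegral.
  by rewrite RintegralZl// ler_wpM2l ?sqr_ge0// Rintegral_le_EFin.
(* The difference of the two sides is at least [q ^+ 2], the gap between the second moment of [Y]
   and its variance. *)
rewrite /b; set q := \int[P]_x Y x; set q2 := \int[P]_x _; nra.
Qed.

End integrability.

(** Positive and negative parts are measurable by Tonelli; [fine] of their difference covers the
    sections that are not integrable. *)
Lemma measurable_fun_Rintegral {R : realType} {d1 d2} {T1 : measurableType d1}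
  {T2 : measurableType d2} (P : probability T2 R) (f : T1 * T2 -> R) :
  measurable_fun setT f -> measurable_fun setT (fun x => \int[P]_y f (x, y)).
Proof.
move=> mf; apply: (measurableT_comp (fine_measurable measurableT)) => /=.
have mf' : measurable_fun setT (EFin \o f) by exact/measurable_EFinP.
rewrite [X in measurable_fun _ X](_ : _ = fun x =>
  ((\int[P]_y (EFin \o f)^\+ (x, y)) - \int[P]_y (EFin \o f)^\- (x, y))%E); last first.
  by apply/funext => x; rewrite [LHS]integralE; congr (_ - _)%E;
    apply: eq_integral => y _; rewrite ?funeposE ?funenegE.
apply: emeasurable_funB; apply: measurable_fun_fubini_tonelli_F => //.
  exact: measurable_funepos.
exact: measurable_funeneg.
Qed.

Section efron_stein.
Context {R : realType} {I : choiceType} (D : set I).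
Context {d} {Om : measurableType d} (P : probability Om R).
Variable G : I -> Om -> R.
Hypothesis mG : forall i, D i -> measurable_fun setT (G i).
Hypothesis indG : mutually_independent P D G.
Local Notation smp := (@sample R I D d Om G).

Lemma Rintegral_resample k (F : @coord_space R I D -> R) : D k ->
  measurable_fun setT F -> P.-integrable setT (EFin \o (F \o smp)) ->
  \int[P]_om F (smp om) =
  \int[P]_om \int[P]_om' F (upd (smp om) k (G k om')).
Proof.
move=> Dk mF iF.
have iF2 := resample_integrable mG indG Dk mF iF.
have mF' : measurable_fun setT (EFin \o F) by exact/measurable_EFinP.
rewrite [LHS]/Rintegral (resample_integral mG indG Dk (F := EFin \o F))//.
rewrite -integral12_prod_meas1// /Rintegral; congr fine.
have iFF := integrable_fubini_F iF2.
have mFF := measurable_int _ iFF.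
(* Fubini makes the inner integral finite for almost every point only, so [fine] can be removed only
   almost everywhere. *)
apply: ae_eq_integral => //.
  apply/measurable_EFinP; apply: (measurableT_comp (fine_measurable measurableT)).
  exact: mFF.
apply: filterS (integrable_ae measurableT iFF) => x /= h _.
by rewrite fineK//; exact: h.
Qed.

(** Induction on the list of coordinates. Averaging [F] over a fresh copy of coordinate [k] gives a
    function [F1] of the remaining list with the same Lipschitz constants. With the other
    coordinates fixed, [var_lipschitz] bounds the mean of [(F - m)^2] by
    [L k ^+ 2 * v k + (F1 - m)^2], and the second term falls under the induction hypothesis. *)
Lemma efron_stein (s : seq I) (L v : I -> R) (F : @coord_space R I D -> R) :
  (forall k, k \in s -> D k) -> measurable_fun setT F ->
  (forall t t', {in s, t =1 t'} -> F t = F t') ->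
  (forall k, k \in s -> forall t z z',
     `|F (upd t k z) - F (upd t k z')| <= L k * `|z - z'|) ->
  (forall k, k \in s -> (\int[P]_om (G k om ^+ 2)%:E <= (v k)%:E)%E) ->
  P.-integrable setT (EFin \o (F \o smp)) /\
  (\int[P]_om ((F (smp om) - \int[P]_om' F (smp om')) ^+ 2)%:E <=
   (\sum_(k <- s) L k ^+ 2 * v k)%:E)%E.
Proof.
elim: s F => [|k s IH] F sD mF dep lip hv.
  have Fc t : F t = F point by exact: dep.
  have -> : F = cst (F point) by apply/funext.
  split; first exact: integrable_prob_cst.
  rewrite big_nil /= Rintegral_prob_cst subrr expr0n /=.
  by rewrite integral0_eq.
have ks : k \in k :: s by rewrite mem_head.
have ss i : i \in s -> i \in k :: s by rewrite inE orbC => ->.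
have Dk := sD _ ks.
have mFu (t : @coord_space R I D) : measurable_fun setT (fun z => F (upd t k z)).
  apply: (measurableT_comp mF); exact: measurable_upd2.
have var t := var_lipschitz (mG Dk) (mFu t) (hv _ ks) (lip _ ks t).
pose F1 t := \int[P]_om' F (upd t k (G k om')).
have mF1 : measurable_fun setT (F1 : @coord_space R I D -> R).
  apply: (@measurable_fun_Rintegral _ _ _ (@coord_space R I D) _ P (fun p => F (upd p.1 k (G k p.2)))).
  apply: (measurableT_comp mF); apply: measurable_upd2; first exact: measurable_fst.
  exact: (measurableT_comp (mG Dk) measurable_snd).
have [iF1 vF1] : P.-integrable setT (EFin \o (F1 \o smp)) /\
  (\int[P]_om ((F1 (smp om) - \int[P]_om' F1 (smp om')) ^+ 2)%:E <=
   (\sum_(k <- s) L k ^+ 2 * v k)%:E)%E.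
  apply: IH => //.
  - by move=> i /ss/sD.
  - move=> t t' tt'; rewrite /F1; congr Rintegral; apply/funext => om'.
    apply: dep => i; rewrite inE /upd; case: eqP => //= _; exact: tt'.
  (* If [k] occurs again in [s], then [F1] does not vary with that coordinate at all. *)
  - move=> i si t z z'; have [->|ik] := eqVneq i k.
      rewrite /F1; under eq_Rintegral do rewrite upd_upd.
      under [X in _ - X]eq_Rintegral do rewrite upd_upd.
      have := lip _ ks t z z'; rewrite subrr normr0; apply: le_trans.
      exact: normr_ge0.
    rewrite /F1 -RintegralB//; [|exact: (var _).1..].
    apply: (le_trans (le_normr_Rintegral _ _)) => //.
      exact: (integrableB_EFin (var _).1 (var _).1).
    rewrite -[leRHS](Rintegral_prob_cst P); apply: le_Rintegral => //.
    + apply: integrable_norm.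
      exact: (integrableB_EFin (var _).1 (var _).1).
    + exact: integrable_prob_cst.
    + move=> om _ /=; rewrite !(updC t _ _ ik); exact: lip (ss _ si) _ _ _.
  - by move=> i /ss/hv.
set m := \int[P]_om F1 (smp om) in vF1.
have msmp := measurable_sample mG.
(* Here [m] is the mean of [F1]. The integrability of [F] follows from this bound, and only then is
   [m] identified with the mean of [F]. *)
have bound : (\int[P]_om ((F (smp om) - m) ^+ 2)%:E <=
   (\sum_(k <- k :: s) L k ^+ 2 * v k)%:E)%E.
  rewrite (resample_ge0 mG indG Dk (F := fun t => ((F t - m) ^+ 2)%:E)); last 2 first.
  - by apply/measurable_EFinP/measurable_funX; exact: measurable_funB.
  - by move=> t; rewrite lee_fin sqr_ge0.
  have mF1s : measurable_fun setT (fun om => F1 (smp om) - m).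
    by apply: measurable_funB => //; exact: (measurableT_comp mF1).
  have iS : P.-integrable setT (EFin \o (fun om => (F1 (smp om) - m) ^+ 2)).
    exact: (integrable_sqr_ltoo mF1s vF1).
  have iS2 := integrableD_EFin (integrable_prob_cst P (L k ^+ 2 * v k)) iS.
  apply: (@le_trans _ _ (\int[P]_om (L k ^+ 2 * v k + (F1 (smp om) - m) ^+ 2)%:E)%E).
    apply: ge0_le_integral => //.
    + by move=> om _; apply: integral_ge0 => om' _; rewrite lee_fin sqr_ge0.
    + apply: (@measurable_fun_fubini_tonelli_F _ _ _ _ _ P (fun p => ((F (upd (smp p.1) k (G k p.2)) - m) ^+ 2)%:E)) => /=.
        apply/measurable_EFinP/measurable_funX; apply: measurable_funB => //.
        exact: (measurableT_comp mF (measurable_resampled mG Dk)).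
      by move=> p; rewrite lee_fin sqr_ge0.
    + exact: (measurable_int _ iS2).
    + by move=> om _; exact: (var (smp om)).2.
  rewrite -Rintegral_le_EFin// (RintegralD measurableT (integrable_prob_cst P _) iS).
  by rewrite Rintegral_prob_cst big_cons lerD2l Rintegral_le_EFin.
have mFm : measurable_fun setT (fun om => F (smp om) - m).
  by apply: measurable_funB => //; exact: (measurableT_comp mF).
have iF : P.-integrable setT (EFin \o (F \o smp)).
  have iFm := integrable_of_sqr mFm (integrable_sqr_ltoo mFm bound).
  apply: eq_integrable (integrableD_EFin iFm (integrable_prob_cst P m)) => // om _.
  by rewrite /= subrK.
have mE : \int[P]_om F (smp om) = m by exact: (Rintegral_resample Dk mF iF).
by rewrite mE.
Qed.

End efron_stein.

(** * Gaussian integration by parts *)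

Section gaussian.
Context {R : realType}.
Local Notation mu := (@lebesgue_measure R).
Variables (s : R) (s0 : 0 < s).
Local Notation pdf := (normal_pdf 0 s).

Let sN0 : s != 0. Proof. by rewrite gt_eqF. Qed.

(** The Radon-Nikodym derivative of the normal law agrees almost everywhere with its density, both
    having the same integral over every measurable set. *)
Lemma normal_probE (f : R -> \bar R) : measurable_fun setT f ->
  (forall x, 0 <= f x)%E ->
  (\int[normal_prob 0 s]_x f x = \int[mu]_x (f x * (pdf x)%:E))%E.
Proof.
move=> mf f0; have dom := @normal_prob_dominates R 0 s.
rewrite -(Radon_Nikodym_SigmaFinite.change_of_variables dom f0 measurableT mf).
have idn := Radon_Nikodym_SigmaFinite.f_integrable dom.
have mpdf : measurable_fun setT (EFin \o pdf).
  by apply/measurable_EFinP; exact: measurable_normal_pdf.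
apply: ae_eq_integral => //.
- apply: emeasurable_funM => //; exact: (measurable_int _ idn).
- exact: emeasurable_funM.
- apply: ae_eqe_mul2l; apply: integral_ae_eq => // A _ mA.
  by rewrite -Radon_Nikodym_SigmaFinite.f_integral.
Qed.

(** Integration by parts is done on compact segments; this dominated convergence then sends the ends
    to infinity. *)
Lemma cvg_Rintegral_seg (h : R -> R) : mu.-integrable setT (EFin \o h) ->
  (fun n : nat => \int[mu]_(x in `[- n%:R, n%:R]) h x) @ \oo --> \int[mu]_x h x.
Proof.
move=> ih; apply: fine_cvg; rewrite -/(Rintegral _ _ _) EFin_Rintegral//.
rewrite [X in X @ _ --> _](_ : _ = fun n : nat =>
   (\int[mu]_x ((EFin \o h) \_ (`[(- n%:R)%R, n%:R])) x)%E); last first.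
  by apply/funext => n; rewrite [LHS]integral_mkcond.
have mh := measurable_int _ ih.
pose h_ (n : nat) := (EFin \o h) \_ (`[(- n%:R)%R, n%:R]).
have mh_ n : @measurable_fun _ _ (measurableTypeR R) _ setT (h_ n).
  by apply/(measurable_restrictT _ _).1 => //; exact: measurable_funTS.
have h_h : {ae mu, forall x, setT x -> h_ ^~ x @ \oo --> (EFin \o h) x}.
  apply: aeW => x _; apply: cvg_near_cst.
  near=> n; rewrite /h_ patchE; case: ifPn => //; rewrite notin_setE /= in_itv /=.
  suff : `|x| <= n%:R by rewrite ler_norml => ->.
  by near: n; exact: nbhs_infty_ger.
have h_le : {ae mu, forall x n, setT x -> (`|h_ n x| <= `|(EFin \o h) x|)%E}.
  apply: aeW => x n _; rewrite /h_ patchE; case: ifPn => // _.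
  by rewrite abse0.
by have [] := @dominated_convergence _ (measurableTypeR R) R mu setT measurableT
  h_ (EFin \o h) (abse \o (EFin \o h)) mh_ mh h_h (integrable_abse ih) h_le.
Unshelve. all: by end_near. Qed.

(** This primitive of [x * pdf x] is what trades a factor [x] for a derivative in Gaussian
    integration by parts. *)
Lemma is_derive_normal_pdf (x : R) :
  is_derive x 1 (fun y => - s ^+ 2 * pdf y) (x * pdf x).
Proof.
rewrite normal_pdfE//=.
have d1 : is_derive x 1 (fun y : R => - (y - 0) ^+ 2 / (s ^+ 2 *+ 2)) (- x / s ^+ 2).
  apply: is_derive_eq; rewrite /GRing.scale /=.
  by rewrite -[s ^+ 2 *+ 2]mulr_natr !(subr0, addr0, mulr0, mul0r, expr1, mulr1); field.
have d2 := is_derive1_comp (is_derive_expR _) d1.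
apply: (@is_derive_eq _ _ _ (fun y => - s ^+ 2 * (normal_peak s * (expR \o (fun y : R => - (y - 0) ^+ 2 / (s ^+ 2 *+ 2))) y))).
by rewrite /normal_fun /GRing.scale /=; field.
Qed.

Lemma normal_pdf_parts (Psi psi : R -> R) (n : nat) :
  (forall x : R, is_derive x 1 Psi (psi x)) -> continuous psi -> (0 < n)%N ->
  \int[mu]_(x in `[- n%:R, n%:R]) (Psi x * (x * pdf x)) =
  - s ^+ 2 * (Psi n%:R * pdf n%:R - Psi (- n%:R) * pdf n%:R) +
  s ^+ 2 * \int[mu]_(x in `[- n%:R, n%:R]) (psi x * pdf x).
Proof.
move=> dPsi cpsi n0.
have dc (f df : R -> R) : (forall x : R, is_derive x 1 f (df x)) -> continuous f.
  move=> fdf x; apply: differentiable_continuous; apply/derivable1_diffP.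
  by have [] := fdf x.
have lr (f df : R -> R) : (forall x : R, is_derive x 1 f (df x)) ->
    derivable_oo_LRcontinuous f (- n%:R) n%:R.
  move=> fdf; split => [x _||]; first by have [] := fdf x.
  - apply: cvg_at_right_filter; exact: (dc _ _ fdf).
  - apply: cvg_at_left_filter; exact: (dc _ _ fdf).
have cpdf := @continuous_normal_pdf R 0 s sN0.
rewrite (@Rintegration_by_parts R Psi (fun y => - s ^+ 2 * pdf y) psi (fun x => x * pdf x)).
- have -> : pdf (- n%:R) = pdf n%:R.
    by rewrite normal_pdfE// /normal_fun !subr0 sqrrN.
  have -> : \int[mu]_(x in `[- n%:R, n%:R]) (psi x * (- s ^+ 2 * pdf x)) =
      - s ^+ 2 * \int[mu]_(x in `[- n%:R, n%:R]) (psi x * pdf x).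
    rewrite -RintegralZl//; first by apply: eq_Rintegral => x _; rewrite mulrCA.
    apply: continuous_compact_integrable; first exact: segment_compact.
    apply: continuous_subspaceT => x; apply: cvgM; [exact: cpsi|exact: cpdf].
  ring.
- by rewrite gtrN// ltr0n.
- exact: continuous_subspaceT.
- exact: lr dPsi.
- by move=> x _; rewrite derive1E; have [] := dPsi x.
- apply: continuous_subspaceT => x; apply: cvgM; [exact: cvg_id|exact: cpdf].
- exact: (lr _ _ is_derive_normal_pdf).
- by move=> x _; rewrite derive1E; have [] := is_derive_normal_pdf x.
Qed.

(** From [exp u >= 1 + u] with [u = n^2 / (2 s^2)], and [n <= n^2]. The rate is crude, but it
    suffices for boundary terms with a bounded [Psi]. *)
Lemma normal_pdf_decay (n : nat) :
  pdf n%:R <= normal_peak s * (1 + 2 * s ^+ 2) * harmonic n.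
Proof.
rewrite normal_pdfE// -mulrA ler_wpM2l ?normal_peak_ge0// /normal_fun subr0 /=.
rewrite mulNr expRN ler_pdivlMr// mulrC ler_pdivrMr ?expR_gt0//.
set u := _ / _; have u0 : 0 <= u by rewrite /u divr_ge0 ?sqr_ge0// mulrn_wge0// sqr_ge0.
have E : 2 * s ^+ 2 * u = n%:R ^+ 2 by rewrite /u -[s ^+ 2 *+ 2]mulr_natr; field.
apply: (@le_trans _ _ ((1 + 2 * s ^+ 2) * (1 + u))); last first.
  by rewrite ler_wpM2l ?expR_ge1Dx// addr_ge0// mulr_ge0// sqr_ge0.
have := sqr_ge0 s; have : (n%:R : R) <= n%:R ^+ 2.
  by clear; case: n => [|n]; [rewrite expr0n|rewrite ler_eXnr// ler1n].
by rewrite -natr1; nra.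
Qed.

Context {d} {T : measurableType d} (P : probability T R) (X : T -> R).
Hypothesis mX : measurable_fun setT X.
Hypothesis lawX : forall B, measurable B -> P (X @^-1` B) = normal_prob 0 s B.

Lemma normal_law_ge0 (f : R -> \bar R) : measurable_fun setT f ->
  (forall x, 0 <= f x)%E ->
  (\int[P]_t f (X t) = \int[mu]_x (f x * (pdf x)%:E))%E.
Proof.
move=> mf f0; rewrite -normal_probE//.
have mX' : @measurable_fun _ _ T (measurableTypeR R) setT X := mX.
rewrite -(@eq_measure_integral _ (measurableTypeR R) R setT (normal_prob 0 s)
  (@pushforward _ _ T (measurableTypeR R) _ P X) f (fun A mA _ => lawX mA)).
by rewrite (@ge0_integral_pushforward _ _ T (measurableTypeR R) R X mX').
Qed.

Lemma normal_law_integrable (f : R -> R) : measurable_fun setT f ->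
  P.-integrable setT (EFin \o (f \o X)) ->
  mu.-integrable setT (EFin \o (fun x => f x * pdf x)).
Proof.
move=> mf /integrableP[_ fi]; apply/integrableP; split.
  by apply/measurable_EFinP; apply: measurable_funM => //; exact: measurable_normal_pdf.
rewrite [ltLHS](_ : _ = \int[mu]_x (`|f x|%:E * (pdf x)%:E))%E; last first.
  apply: eq_integral => x _ /=.
  by rewrite normrM EFinM (ger0_norm (normal_pdf_ge0 _ _ _)).
rewrite -(@normal_law_ge0 (fun x => `|f x|%:E))//.
by apply/measurable_EFinP; exact: measurableT_comp.
Qed.

Lemma normal_law (f : R -> R) : measurable_fun setT f ->
  \int[P]_t f (X t) = \int[mu]_x (f x * pdf x).
Proof.
move=> mf; rewrite /Rintegral; congr fine; rewrite integralE [RHS]integralE.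
have mEf : measurable_fun setT (EFin \o f) by exact/measurable_EFinP.
congr (_ - _)%E.
  transitivity (\int[P]_t ((EFin \o f)^\+ (X t))%E)%E.
    by apply: eq_integral => t _; rewrite !funeposE.
  rewrite (normal_law_ge0 (f := (EFin \o f)^\+%E))//; last exact: measurable_funepos.
  apply: eq_integral => x _; rewrite !funeposE /= -!EFin_max -EFinM.
  by rewrite maxr_pMl ?normal_pdf_ge0// mul0r.
transitivity (\int[P]_t ((EFin \o f)^\- (X t))%E)%E.
  by apply: eq_integral => t _; rewrite !funenegE.
rewrite (normal_law_ge0 (f := (EFin \o f)^\-%E))//; last exact: measurable_funeneg.
apply: eq_integral => x _; rewrite !funenegE /= -!EFin_max -EFinM.
by rewrite maxr_pMl ?normal_pdf_ge0// mul0r mulNr.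
Qed.

(** Parts with [Psi = id] on [[-n, n]]: as [id] is unbounded, the boundary term is not shown to
    vanish but is discarded, being nonpositive. The remaining integral is at most the total mass 1,
    and the segments increase to the line. *)
Lemma normal_second_moment : (\int[P]_t (X t ^+ 2)%:E <= (s ^+ 2)%:E)%E.
Proof.
rewrite (normal_law_ge0 (f := fun x => (x ^+ 2)%:E)); last 2 first.
- by apply/measurable_EFinP; exact: measurable_funX.
- by move=> x; rewrite lee_fin sqr_ge0.
have mf : @measurable_fun _ _ (measurableTypeR R) _ setT
    (fun x : R => ((x ^+ 2)%:E * (pdf x)%:E)%E).
  apply: emeasurable_funM; apply/measurable_EFinP; first exact: measurable_funX.
  exact: measurable_normal_pdf.
have f0 (x : R) : (0 <= (x ^+ 2)%:E * (pdf x)%:E)%E.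
  by rewrite mule_ge0// lee_fin ?sqr_ge0 ?normal_pdf_ge0.
have cv : (\int[mu]_(x in `[(- n%:R)%R, n%:R]) ((x ^+ 2)%:E * (pdf x)%:E))%E
    @[n --> \oo] --> (\int[mu]_x ((x ^+ 2)%:E * (pdf x)%:E))%E.
  rewrite (_ : setT = \bigcup_(i : nat) (`[(- i%:R)%R, i%:R]%classic : set R)); last first.
    apply/seteqP; split => // x _; exists (Num.bound `|x|) => //=.
    by rewrite in_itv /= -ler_norml ltW// archi_boundP.
  apply: (@ge0_nondecreasing_set_cvg_integral _ (measurableTypeR R) R
    (fun n : nat => `[(- n%:R)%R, n%:R]%classic : set R)).
  - move=> m n mn; apply/subsetPset => x /=; rewrite !in_itv /= -!ler_norml.
    by move=> xm; rewrite (le_trans xm)// ler_nat.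
  - by move=> i; exact: measurable_itv.
  - by move=> i; exact: measurable_funTS.
  - by [].
rewrite -(cvg_lim _ cv)//; apply: lime_le; first exact: cvgP cv.
near=> n; have n0 : (0 < n)%N by near: n; exact: nbhs_infty_gt.
have cpdf := @continuous_normal_pdf R 0 s sN0.
have ii (f : R -> R) : continuous f ->
    mu.-integrable `[- n%:R, n%:R] (EFin \o f).
  move=> cf; apply: continuous_compact_integrable; first exact: segment_compact.
  exact: continuous_subspaceT.
have ipdf : mu.-integrable `[- n%:R, n%:R] (EFin \o pdf) by exact: ii.
have ix2 : mu.-integrable `[- n%:R, n%:R] (EFin \o (fun x => x ^+ 2 * pdf x)).
  apply: ii => x; apply: cvgM; [exact: exprn_continuous|exact: cpdf].
rewrite [leLHS](_ : _ = (\int[mu]_(x in `[- n%:R, n%:R]) (x ^+ 2 * pdf x))%:E); last first.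
  by rewrite fineK//; apply: integrable_fin_num => //; exact: measurable_itv.
have id1 (x : R) : is_derive x 1 (@id R) 1 by exact: is_derive_id.
have cst1 : continuous (fun _ : R => 1 : R) by move=> ?; exact: cvg_cst.
have := normal_pdf_parts id1 cst1 n0.
rewrite (_ : \int[mu]_(x in _) (id x * _) =
   \int[mu]_(x in `[- n%:R, n%:R]) (x ^+ 2 * pdf x)); last first.
  by apply: eq_Rintegral => x _ /=; rewrite mulrA expr2.
move=> ->; rewrite lee_fin.
rewrite (_ : \int[mu]_(x in _) (1 * _) = \int[mu]_(x in `[- n%:R, n%:R]) pdf x); last first.
  by apply: eq_Rintegral => x _; rewrite mul1r.
have le1 : \int[mu]_(x in `[- n%:R, n%:R]) pdf x <= 1.
  rewrite -lee_fin fineK; last by apply: integrable_fin_num => //; exact: measurable_itv.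
  rewrite -(@integral_normal_pdf R 0 s); apply: ge0_subset_integral => //.
  - by apply/measurable_EFinP; exact: measurable_normal_pdf.
  - by move=> x _; rewrite lee_fin normal_pdf_ge0.
have := normal_pdf_ge0 0 s (n%:R : R); have := sqr_ge0 s.
have : 0 <= (n%:R : R) by [].
set a := \int[mu]_(x in _) _ in le1 *; set b := pdf _; set c := n%:R; move=> c0 ss b0.
have := mulr_ge0 c0 b0; rewrite /=; nra.
Unshelve. all: by end_near. Qed.

(** Boundedness of [Psi] makes the boundary terms vanish in the limit of large segments, and makes
    [X * Psi (X)] integrable because [X] has a finite second moment. *)
Lemma normal_parts (Psi psi : R -> R) (M : R) :
  (forall x : R, is_derive x 1 Psi (psi x)) -> continuous psi ->
  (forall x, `|Psi x| <= M) -> (forall x, `|psi x| <= M) ->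
  \int[P]_t (X t * Psi (X t)) = s ^+ 2 * \int[P]_t psi (X t).
Proof.
move=> dPsi cpsi PsiM psiM.
have M0 : 0 <= M by exact: le_trans (PsiM 0).
have cPsi : continuous Psi.
  by move=> x; apply: differentiable_continuous; apply/derivable1_diffP; have [] := dPsi x.
have mpsi : measurable_fun setT psi by exact: continuous_measurable_fun.
have mPsi : measurable_fun setT Psi by exact: continuous_measurable_fun.
have mxPsi : measurable_fun setT (fun x : R => x * Psi x) by exact: measurable_funM.
have iX : P.-integrable setT (EFin \o X).
  exact: (integrable_of_sqr mX (integrable_sqr_ltoo mX normal_second_moment)).
have i1 : mu.-integrable setT (EFin \o (fun x => (x * Psi x) * pdf x)).
  apply: normal_law_integrable => //.
  apply: (@integrable_bound _ _ _ _ _ (fun t => M * `|X t|)).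
  - exact: (measurableT_comp mxPsi mX).
  - exact: (integrableZ_EFin M (integrable_norm iX)).
  - by move=> t /=; rewrite normrM mulrC ler_wpM2r.
have i2 : mu.-integrable setT (EFin \o (fun x => psi x * pdf x)).
  apply: normal_law_integrable => //; apply: (@integrable_bounded _ _ _ P _ M).
    exact: (measurableT_comp mpsi mX).
  by move=> t; exact: psiM.
rewrite (normal_law mxPsi) (normal_law mpsi).
have c1 := cvg_Rintegral_seg i1; have c2 := cvg_Rintegral_seg i2.
apply: (@cvg_unique _ _ _ _ _ _ c1) => //.
have c3 : (fun n : nat => - s ^+ 2 * (Psi n%:R * pdf n%:R - Psi (- n%:R) * pdf n%:R))
    @ \oo --> 0.
  apply/norm_cvg0P.
  pose C := s ^+ 2 * (2 * M) * (normal_peak s * (1 + 2 * s ^+ 2)).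
  apply: (@squeeze_cvgr _ _ _ _ (cst 0) (fun n => C * harmonic n)).
  - near=> n; rewrite /= normr_ge0 /= -mulrBl !normrM normrN.
    rewrite (ger0_norm (sqr_ge0 s)) (ger0_norm (normal_pdf_ge0 _ _ _)).
    have h1 : `|Psi n%:R - Psi (- n%:R)| <= 2 * M.
      by rewrite (le_trans (ler_normB _ _))// mulr2n mulrDl !mul1r lerD.
    apply: (@le_trans _ _ (s ^+ 2 *
        (2 * M * (normal_peak s * (1 + 2 * s ^+ 2) * harmonic n)))).
      rewrite ler_wpM2l ?sqr_ge0// ler_pM ?normal_pdf_ge0//.
      exact: normal_pdf_decay.
    by rewrite /C /= !mulrA.
  - exact: cvg_cst.
  - rewrite -[X in _ --> X](mulr0 C); apply: cvgM; first exact: cvg_cst.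
    exact: cvg_harmonic.
have -> : s ^+ 2 * \int[mu]_x (psi x * pdf x) =
  0 + s ^+ 2 * \int[mu]_x (psi x * pdf x) by rewrite add0r.
have c4 : (fun n : nat => - s ^+ 2 * (Psi n%:R * pdf n%:R - Psi (- n%:R) * pdf n%:R)
      + s ^+ 2 * \int[mu]_(x in `[- n%:R, n%:R]) (psi x * pdf x)) @ \oo -->
    0 + s ^+ 2 * \int[mu]_x (psi x * pdf x).
  by apply: cvgD => //; apply: cvgM => //; exact: cvg_cst.
have : (fun n : nat => \int[mu]_(x in `[- n%:R, n%:R]) (x * Psi x * pdf x)) @ \oo -->
    0 + s ^+ 2 * \int[mu]_x (psi x * pdf x); last by [].
apply: cvg_trans c4; apply: near_eq_cvg; near=> n.
rewrite /= -normal_pdf_parts//; last by near: n; exact: nbhs_infty_gt.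
by apply: eq_Rintegral => x _; ring.
Unshelve. all: by end_near. Qed.

End gaussian.

(** * Gibbs averages and free energies *)

(** Measurability is asked of the members of [r] only, since coordinates outside the valid set are
    arbitrary. *)
Lemma measurable_sum_seq {R : realType} {d} {T : measurableType d} (I : eqType)
    (r : seq I) (f : I -> T -> R) :
  (forall k, k \in r -> measurable_fun setT (f k)) ->
  measurable_fun setT (fun t => \sum_(k <- r) f k t).
Proof.
elim: r => [|k r IH] mf.
  by under eq_fun do rewrite big_nil; exact: measurable_cst.
under eq_fun do rewrite big_cons; apply: measurable_funD.
  by apply: mf; exact: mem_head.
by apply: IH => i ir; apply: mf; rewrite inE ir orbT.
Qed.

Lemma integrable_sum_seq {R : realType} {d} {T : measurableType d} (I : eqType)
    (mu : {measure set T -> \bar R}) (r : seq I) (f : I -> T -> R) :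
  (forall k, k \in r -> mu.-integrable setT (EFin \o f k)) ->
  mu.-integrable setT (EFin \o (fun t => \sum_(k <- r) f k t)).
Proof.
by move=> fi; under eq_fun do rewrite big_seq; exact: integrable_sum_EFin.
Qed.

Section gibbs_algebra.
Context {R : realType} {N : nat}.
Local Notation conf := {ffun 'I_N -> bool}.
Implicit Types (H a : conf -> R).

Definition partition_fun H : R := \sum_s expR (H s).
Definition free_energy H : R := ln (partition_fun H).
Definition avg1 H a : R := \sum_s gibbs H s * a s.

Lemma partition_fun_gt0 H : 0 < partition_fun H.
Proof.
rewrite /partition_fun (bigD1 [ffun=> true])//= ltr_wpDr ?expR_gt0//.
by apply: sumr_ge0 => s _; exact: expR_ge0.
Qed.

Lemma gibbs_ge0 H s : 0 <= gibbs H s.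
Proof. by rewrite /gibbs divr_ge0 ?expR_ge0// ltW// partition_fun_gt0. Qed.

Lemma gibbs_sum1 H : \sum_s gibbs H s = 1.
Proof.
by rewrite /gibbs -mulr_suml divff// gt_eqF// partition_fun_gt0.
Qed.

(** In this form a product of weights over replicas is a single exponential. *)
Lemma gibbsE H s : gibbs H s = expR (H s - free_energy H).
Proof. by rewrite expRB /free_energy lnK// posrE partition_fun_gt0. Qed.

(** Replicas outside the image of [h] are summed out. Configurations are grouped by their pullback
    [t] along [h]; each group is a product set, over which the sum of products factorizes. The
    weights may depend on the replica, which [gibbs_avg_new] exploits. *)
Lemma sum_prod_reindex (k m : nat) (h : 'I_k -> 'I_m) (B : 'I_m -> conf -> R)
    (F : {ffun 'I_k -> conf} -> R) : injective h ->
  \sum_(ss : {ffun 'I_m -> conf}) (\prod_l B l (ss l)) * F [ffun j => ss (h j)] =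
  (\sum_(t : {ffun 'I_k -> conf}) (\prod_j B (h j) (t j)) * F t) *
  \prod_(l | l \notin codom h) \sum_s B l s.
Proof.
move=> hi.
rewrite (partition_big (fun ss : {ffun 'I_m -> conf} => [ffun j => ss (h j)]) xpredT)//=.
rewrite mulr_suml; apply: eq_bigr => t _.
(* The values allowed at replica [l]: only [t j] when [l = h j], everything when [l] is outside the
   image. *)
pose Q (l : 'I_m) : pred conf := [pred s | [forall j, (h j == l) ==> (s == t j)]].
have QE (ss : {ffun 'I_m -> conf}) : ([ffun j => ss (h j)] == t) = (ss \in family Q).
  apply/eqP/familyP => [st l|st].
    by rewrite !inE; apply/forallP => j; apply/implyP => /eqP <-; rewrite -st ffunE.
  apply/ffunP => j; rewrite ffunE; have := st (h j); rewrite !inE.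
  by move=> /forallP/(_ j); rewrite eqxx => /eqP.
rewrite (eq_bigl _ _ QE) (eq_bigr (fun ss : {ffun 'I_m -> conf} => (\prod_l B l (ss l)) * F t)); last first.
  by move=> ss; rewrite -QE => /eqP ->.
rewrite -mulr_suml -(@bigA_distr_big_dep _ _ _ _ _ _ _ Q (fun i j => B i j)).
rewrite mulrAC; congr (_ * _); rewrite (bigID (fun l => l \in codom h))/=; congr (_ * _).
  transitivity (\prod_(i in h @: 'I_k) \sum_(s | Q i s) B i s).
    by apply: eq_bigl => i; apply/codomP/imsetP => [[j ->]|[j _ ->]]; exists j.
  rewrite big_imset /=; last by move=> i j _ _; exact: hi.
  apply: eq_bigr => j _; rewrite (big_pred1 (t j))// => s.
  rewrite /Q /=; apply/forallP/eqP => [/(_ j)|-> j']; first by rewrite eqxx => /eqP.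
  by apply/implyP => /eqP/hi ->.
apply: eq_bigr => l lh; apply: eq_bigl => s; rewrite /Q /=; apply/forallP => j.
by apply/implyP => /eqP hj; rewrite -hj codom_f in lh.
Qed.

Lemma gibbs_avg_reindex H (k m : nat) (h : 'I_k -> 'I_m)
    (F : {ffun 'I_k -> conf} -> R) : injective h ->
  gibbs_avg H (fun ss : {ffun 'I_m -> conf} => F [ffun j => ss (h j)]) =
  gibbs_avg H F.
Proof.
move=> hi; rewrite /gibbs_avg (sum_prod_reindex (fun=> gibbs H) F hi).
by rewrite [X in _ * X]big1 ?mulr1// => l _; exact: gibbs_sum1.
Qed.

(** Independence of the last replica, whose factor [a] is absorbed into its weight. Read from right
    to left, it turns products of averages into one average over an additional replica: this is how
    replica [n + 1] enters the identities. *)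
Lemma gibbs_avg_new H (n : nat) (F : {ffun 'I_n -> conf} -> R) a :
  gibbs_avg H (fun ss : {ffun 'I_n.+1 -> conf} =>
    F [ffun j => ss (widen_ord (leqnSn n) j)] * a (ss ord_max)) =
  gibbs_avg H F * avg1 H a.
Proof.
have hi : injective (widen_ord (leqnSn n)) 
  by move=> i j /(congr1 val)/= ij; exact: val_inj.
pose B (l : 'I_n.+1) s := gibbs H s * (if l == ord_max then a s else 1).
have := sum_prod_reindex B F hi.
have -> : \prod_(l | l \notin codom (widen_ord (leqnSn n))) \sum_s B l s = avg1 H a.
  rewrite (big_pred1 ord_max).
    by apply: eq_bigr => s _; rewrite /B eqxx.
  move=> l /=; apply/negP/eqP => [lh|-> /codomP[j /(congr1 val)/= jn]]; last first.
    by have := ltn_ord j; rewrite -jn ltnn.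
  apply/val_inj => /=; apply/eqP; rewrite eqn_leq -ltnS ltn_ord /= leqNgt.
  apply/negP => ln; apply: lh; apply/codomP; exists (Ordinal ln); exact: val_inj.
have -> : \sum_(t : {ffun 'I_n -> conf}) (\prod_j B (widen_ord (leqnSn n) j) (t j)) * F t
    = gibbs_avg H F.
  apply: eq_bigr => t _; congr (_ * _); apply: eq_bigr => j _; rewrite /B.
  case: eqP => [/(congr1 val)/= jn|_]; last by rewrite mulr1.
  by have := ltn_ord j; rewrite jn ltnn.
move=> <-; apply: eq_bigr => ss _.
have -> : \prod_l B l (ss l) = (\prod_l gibbs H (ss l)) * a (ss ord_max).
  rewrite /B big_split/=; congr (_ * _).
  by rewrite (bigD1 ord_max)//= eqxx big1 ?mulr1// => i /negbTE ->.
by rewrite -mulrA [a _ * _]mulrC.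
Qed.

Lemma gibbs_avg_cst H n (c : R) : gibbs_avg H (fun _ : {ffun 'I_n -> conf} => c) = c.
Proof.
rewrite /gibbs_avg -mulr_suml -(bigA_distr_bigA (fun _ : 'I_n => gibbs H)).
by rewrite big1 ?mul1r// => i _; exact: gibbs_sum1.
Qed.

Lemma gibbs_avgD H n (F1 F2 : {ffun 'I_n -> conf} -> R) :
  gibbs_avg H (fun ss => F1 ss + F2 ss) = gibbs_avg H F1 + gibbs_avg H F2.
Proof. by rewrite -big_split; apply: eq_bigr => ss _; rewrite /= mulrDr. Qed.

Lemma gibbs_avgZ H n (c : R) (F : {ffun 'I_n -> conf} -> R) :
  gibbs_avg H (fun ss => c * F ss) = c * gibbs_avg H F.
Proof. by rewrite mulr_sumr; apply: eq_bigr => ss _; rewrite mulrCA. Qed.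

Lemma gibbs_avg_sum H n (T : Type) (r : seq T) (F : T -> {ffun 'I_n -> conf} -> R) :
  gibbs_avg H (fun ss => \sum_(i <- r) F i ss) = \sum_(i <- r) gibbs_avg H (F i).
Proof. by rewrite exchange_big /=; apply: eq_bigr => ss _; rewrite mulr_sumr. Qed.

Lemma gibbs_avg_le H n (F1 F2 : {ffun 'I_n -> conf} -> R) :
  (forall ss, F1 ss <= F2 ss) -> gibbs_avg H F1 <= gibbs_avg H F2.
Proof.
move=> F12; apply: ler_sum => ss _; rewrite ler_wpM2l//.
by apply: prodr_ge0 => l _; exact: gibbs_ge0.
Qed.

Lemma normr_gibbs_avg H n (F : {ffun 'I_n -> conf} -> R) :
  `|gibbs_avg H F| <= gibbs_avg H (fun ss => `|F ss|).
Proof.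
apply: (le_trans (ler_norm_sum _ _ _)); apply: ler_sum => ss _.
rewrite normrM ger0_norm//.
by apply: prodr_ge0 => l _; exact: gibbs_ge0.
Qed.

Lemma gibbs_avg_bound H n (F : {ffun 'I_n -> conf} -> R) M :
  (forall ss, `|F ss| <= M) -> `|gibbs_avg H F| <= M.
Proof.
move=> FM; apply: (le_trans (normr_gibbs_avg _ _)).
by rewrite -[leRHS](gibbs_avg_cst H n); exact: gibbs_avg_le.
Qed.

Lemma gibbs_avg1E H n (l0 : 'I_n) a :
  gibbs_avg H (fun ss : {ffun 'I_n -> conf} => a (ss l0)) = avg1 H a.
Proof.
have hi : injective (fun _ : 'I_1 => l0) by move=> i j _; rewrite !ord1.
have := gibbs_avg_reindex H (fun t : {ffun 'I_1 -> conf} => a (t ord0)) hi.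
rewrite (_ : (fun ss : {ffun 'I_n -> conf} => _) = (fun ss => a (ss l0))); last first.
  by apply/funext => ss; rewrite ffunE.
move=> ->.
have hi0 : injective (fun i : 'I_0 => widen_ord (leq0n 1) i) by case.
have := gibbs_avg_new H (fun _ : {ffun 'I_0 -> conf} => 1) a.
rewrite gibbs_avg_cst mul1r => <-; apply: eq_bigr => ss _; rewrite mul1r.
by congr (_ * a (ss _)); exact: val_inj.
Qed.

Lemma free_energy_le H H' c : (forall s, H s <= H' s + c) ->
  free_energy H <= free_energy H' + c.
Proof.
move=> HH; rewrite -ler_expR expRD /free_energy !lnK ?posrE ?partition_fun_gt0//.
by rewrite mulr_suml; apply: ler_sum => s _; rewrite -expRD ler_expR.
Qed.

Lemma free_energy_lip H H' c : (forall s, `|H s - H' s| <= c) ->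
  `|free_energy H - free_energy H'| <= c.
Proof.
move=> HH; rewrite ler_distl lerBlDr; apply/andP; split; apply: free_energy_le => s;
  by have := HH s; rewrite ler_distl => /andP[]; lra.
Qed.

Lemma free_energy_addC H c :
  free_energy (fun s => H s + c) = free_energy H + c.
Proof.
apply/eqP; rewrite eq_le free_energy_le//= -lerBrDr.
by apply: free_energy_le => s; rewrite addrK.
Qed.

Lemma partition_fun_shift H a :
  partition_fun (fun s => H s + a s) = partition_fun H * avg1 H (expR \o a).
Proof.
rewrite mulr_sumr; apply: eq_bigr => s _; rewrite /gibbs expRD /=.
rewrite mulrA mulrCA divff ?mulr1//.
by rewrite gt_eqF// partition_fun_gt0.
Qed.

Lemma avg1D H a a' : avg1 H (fun s => a s + a' s) = avg1 H a + avg1 H a'.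
Proof. by rewrite -big_split; apply: eq_bigr => s _; rewrite /= mulrDr. Qed.

Lemma avg1_cst H c : avg1 H (fun=> c) = c.
Proof. by rewrite /avg1 -mulr_suml gibbs_sum1 mul1r. Qed.

Lemma avg1Z H c a : avg1 H (fun s => c * a s) = c * avg1 H a.
Proof. by rewrite mulr_sumr; apply: eq_bigr => s _; rewrite mulrCA. Qed.

Lemma avg1_le H a a' : (forall s, a s <= a' s) -> avg1 H a <= avg1 H a'.
Proof. by move=> aa; apply: ler_sum => s _; rewrite ler_wpM2l// gibbs_ge0. Qed.

(** Average the tangent bound [exp a >= exp m * (1 + a - m)], where [m] is the mean of [a], so that
    the linear term vanishes. *)
Lemma free_energy_jensen H a :
  free_energy H + avg1 H a <= free_energy (fun s => H s + a s).
Proof.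
set m := avg1 H a.
rewrite -ler_expR expRD /free_energy !lnK ?posrE ?partition_fun_gt0//.
rewrite partition_fun_shift ler_pM2l ?partition_fun_gt0//.
have -> : expR m = avg1 H (fun s => expR m * (1 + (a s + - m))).
  by rewrite avg1Z avg1D avg1_cst avg1D avg1_cst -/m subrr addr0 mulr1.
apply: avg1_le => s /=; have -> : a s = m + (a s - m) by rewrite addrC subrK.
rewrite expRD ler_wpM2l ?expR_ge0//.
by rewrite (addrC m) addrK expR_ge1Dx.
Qed.

(* [t^+ <= K + exp (t - K)] for [K >= 0], averaged with [exp K] equal to the
   ratio of partition functions. *)
Lemma avg1_maxr_le H a :
  avg1 H (fun s => Num.max (a s) 0) <=
  1 + Num.max (free_energy (fun s => H s + a s) - free_energy H) 0.
Proof.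
set K := Num.max (_ - _) 0.
have K0 : 0 <= K by rewrite le_max lexx orbT.
apply: (@le_trans _ _ (avg1 H (fun s => K + expR (- K) * (expR \o a) s))).
  apply: avg1_le => s; rewrite -expRD ge_max; apply/andP; split.
    have := expR_ge1Dx (- K + a s); lra.
  by rewrite addr_ge0// expR_ge0.
rewrite avg1D avg1_cst avg1Z addrC lerD2r expRN mulrC ler_pdivrMr ?expR_gt0// mul1r.
rewrite -(ler_pM2l (partition_fun_gt0 H)) -partition_fun_shift.
have -> : partition_fun (fun s => H s + a s) =
    partition_fun H * expR (free_energy (fun s => H s + a s) - free_energy H).
  rewrite expRB /free_energy !lnK ?posrE ?partition_fun_gt0// mulrC divfK//.
  by rewrite gt_eqF// partition_fun_gt0.
by rewrite ler_pM2l ?partition_fun_gt0// ler_expR le_max lexx.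
Qed.

(** [r |a|] is the sum of the positive parts of [r a] and [- r a]. Each costs 1 and the increment of
    a free energy, whence the constant 2. *)
Lemma avg1_normr_le H a (r : R) : 0 < r ->
  r * avg1 H (fun s => `|a s|) <=
  2 + Num.max (free_energy (fun s => H s + r * a s) - free_energy H) 0
    + Num.max (free_energy (fun s => H s - r * a s) - free_energy H) 0.
Proof.
move=> r0; rewrite -avg1Z.
have -> : avg1 H (fun s => r * `|a s|) =
    avg1 H (fun s => Num.max (r * a s) 0 + Num.max (- (r * a s)) 0).
  apply: eq_bigr => s _; congr (_ * _).
  have -> : r * `|a s| = `|r * a s| by rewrite normrM gtr0_norm.
  have [h|h] := leP 0 (r * a s).
    by rewrite ger0_norm// max_r ?addr0// oppr_le0.
  by rewrite ltr0_norm// add0r max_l// oppr_ge0 ltW.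
rewrite avg1D; have := avg1_maxr_le H (fun s => r * a s).
have := avg1_maxr_le H (fun s => - (r * a s)); lra.
Qed.

End gibbs_algebra.

Lemma is_derive_bigsum {R : realType} (T : Type) (r : seq T) (f : T -> R -> R)
    (df : T -> R) (z : R) : (forall i, is_derive z 1 (f i) (df i)) ->
  is_derive z 1 (fun z => \sum_(i <- r) f i z) (\sum_(i <- r) df i).
Proof.
move=> h; elim: r => [|i r IH].
  rewrite big_nil [X in is_derive _ _ X _](_ : _ = cst 0); first exact: is_derive_cst.
  by apply/funext => x; rewrite big_nil.
rewrite big_cons [X in is_derive _ _ X _](_ : _ = f i + (fun z => \sum_(i <- r) f i z)).
  exact: is_deriveD.
by apply/funext => x; rewrite big_cons.
Qed.

Section gibbs_derivative.
Context {R : realType} {N : nat}.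
Local Notation conf := {ffun 'I_N -> bool}.
Variables (H a : conf -> R).
Local Notation Hz := (fun z : R => fun s : conf => H s + z * a s).

Lemma is_derive_free_energy (z : R) :
  is_derive z 1 (fun z => free_energy (Hz z)) (avg1 (Hz z) a).
Proof.
have dH (s : conf) : is_derive z 1 (fun z : R => H s + z * a s) (a s).
  by apply: is_derive_eq; rewrite /GRing.scale /= !(mul1r, add0r, mulr0, mulr1, addr0).
have dE (s : conf) : is_derive z 1 (fun z : R => expR (H s + z * a s)) (expR (H s + z * a s) * a s).
  exact: (is_derive1_comp (is_derive_expR _) (dH s)).
have dZ : is_derive z 1 (fun z => partition_fun (Hz z)) (\sum_s expR (H s + z * a s) * a s).
  exact: is_derive_bigsum.
apply: is_derive_eq; first exact: (is_derive1_comp (is_derive1_ln (partition_fun_gt0 (Hz z))) dZ).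
rewrite /avg1 mulr_sumr; apply: eq_bigr => s _.
by rewrite /gibbs -/(partition_fun (Hz z)) mulrA; congr (_ * _); rewrite mulrC.
Qed.

(** The product of the weights is the exponential of the energies of the [n] replicas minus [n] free
    energies. Differentiation brings down the sum of the [a (ss l)], and [n] times the Gibbs mean of
    [a] from the free energy. *)
Lemma is_derive_gibbs_avg n (F : {ffun 'I_n -> conf} -> R) (z : R) :
  is_derive z 1 (fun z => gibbs_avg (Hz z) F)
   (gibbs_avg (Hz z) (fun ss => F ss * \sum_l a (ss l))
    - n%:R * (gibbs_avg (Hz z) F * avg1 (Hz z) a)).
Proof.
pose A (ss : {ffun 'I_n -> conf}) := \sum_(l < n) H (ss l).
pose B (ss : {ffun 'I_n -> conf}) := \sum_(l < n) a (ss l).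
have gE z' : gibbs_avg (Hz z') F = \sum_ss
    F ss * expR (A ss + z' * B ss - n%:R * free_energy (Hz z')).
  apply: eq_bigr => ss _; rewrite mulrC; congr (_ * _).
  under eq_bigr do rewrite gibbsE.
  rewrite -expR_sum; congr expR; rewrite sumrB big_split /= -mulr_sumr sumr_const card_ord.
  by rewrite mulr_natl.
rewrite [X in is_derive _ _ X _](_ : _ = (fun z' : R => \sum_ss
    F ss * expR (A ss + z' * B ss - n%:R * free_energy (Hz z')))); last exact/funext.
have dF := is_derive_free_energy z.
have d1 ss : is_derive z 1 (fun z' : R => A ss + z' * B ss - n%:R * free_energy (Hz z'))
    (B ss - n%:R * avg1 (Hz z) a).
  by apply: is_derive_eq; rewrite /GRing.scale /= !(mul1r, add0r, mulr0, mulr1, addr0).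
have d2 ss : is_derive z 1 (fun z' : R => F ss * expR (A ss + z' * B ss - n%:R * free_energy (Hz z')))
    (F ss * (expR (A ss + z * B ss - n%:R * free_energy (Hz z)) * (B ss - n%:R * avg1 (Hz z) a))).
  have d3 := is_derive1_comp (is_derive_expR _) (d1 ss).
  apply: (@is_derive_eq _ _ _ (fun z' => F ss * (expR \o (fun z' : R => A ss + z' * B ss - n%:R * free_energy (Hz z'))) z')).
  by rewrite /GRing.scale /= ?mulr0 ?addr0.
apply: is_derive_eq; first exact: is_derive_bigsum.
rewrite mulrA -gibbs_avgZ [in RHS]mulrC.
rewrite /gibbs_avg [X in _ = _ - X]mulr_sumr -sumrB; apply: eq_bigr => ss _.
have -> : \prod_(l < n) gibbs (Hz z) (ss l) = expR (A ss + z * B ss - n%:R * free_energy (Hz z)).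
  under eq_bigr do rewrite gibbsE.
  rewrite -expR_sum; congr expR; rewrite sumrB big_split /= -mulr_sumr sumr_const card_ord.
  by rewrite mulr_natl.
rewrite -/(B ss); ring.
Qed.

Lemma continuous_gibbs_avg n (F : {ffun 'I_n -> conf} -> R) :
  continuous (fun z => gibbs_avg (Hz z) F).
Proof.
move=> z; apply: differentiable_continuous; apply/derivable1_diffP.
by have [] := is_derive_gibbs_avg F z.
Qed.

Lemma continuous_avg1 (b : conf -> R) : continuous (fun z => avg1 (Hz z) b).
Proof.
under eq_fun do rewrite -(gibbs_avg1E _ (ord0 : 'I_1)).
exact: continuous_gibbs_avg.
Qed.

End gibbs_derivative.

Section gibbs_measurable.
Context {R : realType} {N : nat}.
Local Notation conf := {ffun 'I_N -> bool}.
Context {d} {T : measurableType d} (H : T -> conf -> R).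
Hypothesis mH : forall s, measurable_fun setT (fun t => H t s).

Lemma measurable_free_energy : measurable_fun setT (fun t => free_energy (H t)).
Proof.
apply: measurableT_comp => //; apply: measurable_sum => s.
exact: measurableT_comp.
Qed.

Lemma measurable_gibbs s : measurable_fun setT (fun t => gibbs (H t) s).
Proof.
under eq_fun do rewrite gibbsE.
apply: measurableT_comp => //; apply: measurable_funB => //.
exact: measurable_free_energy.
Qed.

Lemma measurable_gibbs_avg n (F : T -> {ffun 'I_n -> conf} -> R) :
  (forall ss, measurable_fun setT (F ^~ ss)) ->
  measurable_fun setT (fun t => gibbs_avg (H t) (F t)).
Proof.
move=> mF; apply: measurable_sum => ss; apply: measurable_funM => //.
by apply: measurable_prod => l _; exact: measurable_gibbs.
Qed.

Lemma measurable_avg1 (F : T -> conf -> R) :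
  (forall s, measurable_fun setT (F ^~ s)) ->
  measurable_fun setT (fun t => avg1 (H t) (F t)).
Proof.
move=> mF; apply: measurable_sum => s; apply: measurable_funM => //.
exact: measurable_gibbs.
Qed.

End gibbs_measurable.

(** * Linear Gaussian perturbations of a Hamiltonian *)

(** [E] and [C] stand for the values of a convex function at the ends of a step, [U] and [W] for its
    subgradient increments there: [E - C] lies between [W] and [U]. *)
Lemma normr_diff_le {R : realType} (A B C E U W : R) :
  U <= A -> - B <= W -> B <= A -> E - U <= C -> C + W <= E -> `|E - C| <= A.
Proof. by move=> *; rewrite ler_norml; apply/andP; split; lra. Qed.

(** [fp], [f0], [fm] are the free energies at [x + h], [x], [x - h], with means [tp], [t0], [tm],
    and [k] is a subgradient increment. Replacing the free energies by their means costs their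
    deviations, that of [f0] twice. The hypotheses make [tp - t0 - k] and [tm - t0 + k] nonnegative,
    so the maxima disappear and [k] cancels. *)
Lemma second_difference_le {R : realType} (fp f0 fm tp t0 tm k : R) :
  t0 + k <= tp -> t0 - k <= tm ->
  2 + Num.max (fp - k - f0) 0 + Num.max (fm + k - f0) 0 <=
  2 + (tp + tm - 2 * t0) + `|fp - tp| + `|fm - tm| + 2 * `|f0 - t0|.
Proof.
move=> jp jm.
have := ler_norm (fp - tp); have := ler_norm (fm - tm); have := ler_norm (f0 - t0).
rewrite -(normrN (f0 - t0)); have := ler_norm (- (f0 - t0)); rewrite (normrN (f0 - t0)).
have := normr_ge0 (fp - tp); have := normr_ge0 (fm - tm).
set p := `|fp - tp|; set q := `|fm - tm|; set r := `|f0 - t0| => *.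
have A : Num.max (fp - k - f0) 0 <= tp - t0 - k + p + r.
  by rewrite ge_max; apply/andP; split; lra.
have B : Num.max (fm + k - f0) 0 <= tm - t0 + k + q + r.
  by rewrite ge_max; apply/andP; split; lra.
lra.
Qed.

Lemma Rintegral_le4 {R : realType} {d} {T : measurableType d} (P : probability T R)
    (K V : R) (F Fp Fm F0 : T -> R) :
  P.-integrable setT (EFin \o F) -> P.-integrable setT (EFin \o Fp) ->
  P.-integrable setT (EFin \o Fm) -> P.-integrable setT (EFin \o F0) ->
  (forall x, F x <= K + Fp x + Fm x + 2 * F0 x) ->
  \int[P]_x Fp x <= V -> \int[P]_x Fm x <= V -> \int[P]_x F0 x <= V ->
  \int[P]_x F x <= K + 4 * V.
Proof.
move=> iF ip im i0 Fle Vp Vm V0.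
have i1 := integrableD_EFin (integrable_prob_cst P K) ip.
have i2 := integrableD_EFin i1 im.
have i3 := integrableZ_EFin 2 i0.
apply: (@le_trans _ _ (\int[P]_x (cst K x + Fp x + Fm x + 2 * F0 x))).
  by apply: le_Rintegral => //; exact: integrableD_EFin.
rewrite (RintegralD measurableT i2 i3) (RintegralD measurableT i1 im).
rewrite (RintegralD measurableT (integrable_prob_cst P K) ip) RintegralZl//.
rewrite Rintegral_prob_cst; lra.
Qed.

Section perturbed_gibbs.
Context {R : realType} {I : choiceType} (D : set I).
Context {d} {Om : measurableType d} (P : probability Om R) (G : I -> Om -> R).
Hypothesis mG : forall i, D i -> measurable_fun setT (G i).
Hypothesis indG : mutually_independent P D G.
Context {N : nat}.
Local Notation conf := {ffun 'I_N -> bool}.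
Local Notation smp := (@sample R I D d Om G).
Variables (H0 : @coord_space R I D -> conf -> R) (s1 : seq I) (b : I -> conf -> R) (c : R).
Hypothesis s1D : forall k, k \in s1 -> D k.
Hypothesis s1u : uniq s1.
Hypothesis lawG : forall k, k \in s1 ->
  forall B, measurable B -> P (G k @^-1` B) = normal_prob 0 1 B.
Hypothesis mH0 : forall s, measurable_fun setT (fun y => H0 y s).
Hypothesis H0_upd : forall k, k \in s1 -> forall y z s, H0 (upd y k z) s = H0 y s.

(** [gfield] stands for h_{N,w,p} as a linear form in its own Gaussian coordinates [s1]; [H0]
    collects every other term of the Hamiltonian. *)
Definition gfield (y : @coord_space R I D) (s : conf) : R := \sum_(k <- s1) b k s * y k.
Definition ham (x : R) (y : @coord_space R I D) (s : conf) : R :=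
  H0 y s + x * c * gfield y s.
(** The covariance of the Gaussian field, later identified with the power [p] of the overlap R_w. *)
Definition covar (s s' : conf) : R := \sum_(k <- s1) b k s * b k s'.
Definition mean_field (x : R) : R :=
  \int[P]_om avg1 (ham x (smp om)) (gfield (smp om)).
Definition mean_fe (x : R) : R := \int[P]_om free_energy (ham x (smp om)).

Lemma gfield_upd y k z s : k \in s1 ->
  gfield (upd y k z) s = gfield (upd y k 0) s + z * b k s.
Proof.
move=> ks; rewrite /gfield !(bigD1_seq k)//= !updE mulr0 add0r mulrC addrC.
congr (_ + _); apply: eq_bigr => i ik; by rewrite !upd_neq.
Qed.

(** Along one coordinate the Hamiltonian is affine, so [is_derive_gibbs_avg] applies with base point
    0. *)
Lemma ham_upd x y k z s : k \in s1 ->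
  ham x (upd y k z) s = ham x (upd y k 0) s + z * (x * c * b k s).
Proof. by move=> ks; rewrite /ham (gfield_upd _ _ _ ks) !H0_upd//; ring. Qed.

Lemma ham_shift x h y s : ham (x + h) y s = ham x y s + h * c * gfield y s.
Proof. by rewrite /ham; ring. Qed.

Lemma measurable_gfield s : measurable_fun setT (fun y => gfield y s).
Proof.
apply: measurable_sum_seq => k ks; apply: measurable_funM => //.
by apply: measurable_coord; exact: s1D.
Qed.

Lemma measurable_ham x s : measurable_fun setT (fun y => ham x y s).
Proof.
apply: measurable_funD => //; apply: measurable_funM => //.
exact: measurable_gfield.
Qed.

Lemma integrable_coord k : k \in s1 -> P.-integrable setT (EFin \o G k).
Proof.
move=> ks; have mGk := mG (s1D ks).
apply: (integrable_of_sqr mGk); apply: (integrable_sqr_ltoo mGk (c := 1 ^+ 2)).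
exact: (normal_second_moment ltr01 mGk (lawG ks)).
Qed.

Lemma integrable_gfield s : P.-integrable setT (EFin \o (fun om => gfield (smp om) s)).
Proof.
apply: integrable_sum_seq => k ks; apply: integrableZ_EFin.
exact: integrable_coord.
Qed.

Let msmp := measurable_sample mG.

Lemma measurable_ham_smp x s : measurable_fun setT (fun om => ham x (smp om) s).
Proof. exact: (measurableT_comp (measurable_ham x s) msmp). Qed.

Lemma integrable_gibbs_avg x n (F : Om -> {ffun 'I_n -> conf} -> R) :
  (forall ss, P.-integrable setT (EFin \o F ^~ ss)) ->
  P.-integrable setT (EFin \o (fun om => gibbs_avg (ham x (smp om)) (F om))).
Proof.
move=> iF; have mF ss : measurable_fun setT (F ^~ ss).
  exact/measurable_EFinP/(measurable_int _ (iF ss)).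
apply: (integrable_bound (g := fun om => \sum_ss `|F om ss|)).
- by apply: measurable_gibbs_avg => // s; exact: measurable_ham_smp.
- by apply: integrable_sum_EFin => ss _; exact: integrable_norm (iF ss).
- move=> om; apply: gibbs_avg_bound => ss.
  rewrite (bigD1 ss)//= lerDl; apply: sumr_ge0 => i _; exact: normr_ge0.
Qed.

Lemma integrable_gibbs_avg_cst x n (F : {ffun 'I_n -> conf} -> R) :
  P.-integrable setT (EFin \o (fun om => gibbs_avg (ham x (smp om)) F)).
Proof. by apply: integrable_gibbs_avg => ss; exact: integrable_prob_cst. Qed.

Lemma integrable_avg1 x (F : Om -> conf -> R) :
  (forall s, P.-integrable setT (EFin \o F ^~ s)) ->
  P.-integrable setT (EFin \o (fun om => avg1 (ham x (smp om)) (F om))).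
Proof.
move=> iF; have := @integrable_gibbs_avg x 1 (fun om ss => F om (ss ord0)) (fun ss => iF (ss ord0)).
apply: eq_integrable => // om _ /=; by rewrite gibbs_avg1E.
Qed.

(** Resampling coordinate [k] on both sides leaves, for each value of the other coordinates, an
    identity in one normal variable, which is [normal_parts]. *)
Lemma gauss_parts_coord x k n (F : {ffun 'I_n -> conf} -> R) : k \in s1 ->
  \int[P]_om (G k om * gibbs_avg (ham x (smp om)) F) =
  \int[P]_om (gibbs_avg (ham x (smp om)) (fun ss => F ss * \sum_l x * c * b k (ss l))
    - n%:R * (gibbs_avg (ham x (smp om)) F *
              avg1 (ham x (smp om)) (fun s => x * c * b k s))).
Proof.
move=> ks; have Dk := s1D ks.
pose M0 : R := \sum_ss `|F ss|.
have FM ss : `|F ss| <= M0.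
  by rewrite /M0 (bigD1 ss)//= lerDl; apply: sumr_ge0.
pose a (s : conf) : R := x * c * b k s.
pose Psi (y : @coord_space R I D) := gibbs_avg (ham x y) F.
pose psi (y : @coord_space R I D) := gibbs_avg (ham x y) (fun ss => F ss * \sum_l a (ss l))
    - n%:R * (gibbs_avg (ham x y) F * avg1 (ham x y) a).
have mPsi : measurable_fun setT Psi.
  by apply: measurable_gibbs_avg => s //; exact: measurable_ham.
have mpsi : measurable_fun setT psi.
  apply: measurable_funB; first by apply: measurable_gibbs_avg => s //; exact: measurable_ham.
  apply: measurable_funM => //; apply: measurable_funM => //.
  by apply: measurable_avg1 => s //; exact: measurable_ham.
pose M1 : R := \sum_(ss : {ffun 'I_n -> conf}) `|F ss * \sum_l a (ss l)|.
pose M2 : R := \sum_s `|a s|.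
have psiM y : `|psi y| <= M1 + n%:R * (M0 * M2).
  rewrite (le_trans (ler_normB _ _))// lerD//.
    apply: gibbs_avg_bound => ss.
    by rewrite /M1 (bigD1 ss)//= lerDl; apply: sumr_ge0.
  rewrite !normrM normr_nat ler_wpM2l// ler_pM//; first exact: gibbs_avg_bound.
  rewrite -(gibbs_avg1E _ (ord0 : 'I_1)); apply: gibbs_avg_bound => ss.
  by rewrite /M2 (bigD1 (ss ord0))//= lerDl; apply: sumr_ge0.
have PsiM y : `|Psi y| <= M0 by exact: gibbs_avg_bound.
have M20 : 0 <= M2 by exact: sumr_ge0.
have M10 : 0 <= M1 by exact: sumr_ge0.
have M00 : 0 <= M0 by exact: sumr_ge0.
(* A single constant that bounds both the Gibbs average and its derivative, as [normal_parts]
   requires. *)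
pose M : R := M0 + (M1 + n%:R * (M0 * M2)).
have M3 : 0 <= M1 + n%:R * (M0 * M2) by rewrite addr_ge0// mulr_ge0// mulr_ge0.
rewrite (_ : \int[P]_om _ = \int[P]_om (smp om k * Psi (smp om)))//.
rewrite (Rintegral_resample mG indG Dk (F := fun y => y k * Psi y)); last 2 first.
- apply: measurable_funM => //; exact: measurable_coord.
- apply: (integrable_bound (g := fun om => M0 * `|G k om|)).
  + apply: measurable_funM; first exact: mG.
    exact: (measurableT_comp mPsi msmp).
  + exact: integrableZ_EFin (integrable_norm (integrable_coord ks)).
  + by move=> om; rewrite /= normrM mulrC ler_wpM2r.
rewrite [RHS](_ : _ = \int[P]_om psi (smp om))//.
have ipsi : P.-integrable setT (EFin \o (psi \o smp)).
  exact: (@integrable_bounded _ _ _ P (psi \o smp) _ (measurableT_comp mpsi msmp)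
    (fun om => psiM (smp om))).
rewrite [RHS](Rintegral_resample mG indG Dk mpsi ipsi).
apply: eq_Rintegral => om _; set y := smp om.
have dPsi (z : R) : is_derive z 1 (fun z => Psi (upd y k z)) (psi (upd y k z)).
  have hE z' : ham x (upd y k z') = (fun s => ham x (upd y k 0) s + z' * a s).
    by apply/funext => s; rewrite ham_upd.
  rewrite /Psi /psi (hE z); under eq_fun do rewrite hE.
  exact: is_derive_gibbs_avg.
have cpsi : continuous (fun z => psi (upd y k z)).
  have hE z' : ham x (upd y k z') = (fun s => ham x (upd y k 0) s + z' * a s).
    by apply/funext => s; rewrite ham_upd.
  rewrite /psi => z; under eq_fun do rewrite hE.
  apply: cvgB; first exact: continuous_gibbs_avg.
  apply: cvgM; first exact: cvg_cst.
  apply: cvgM; [exact: continuous_gibbs_avg|exact: continuous_avg1].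
have := normal_parts ltr01 (mG Dk) (lawG ks) dPsi cpsi (M := M).
rewrite expr1n mul1r => <-.
- by apply: eq_Rintegral => om' _; rewrite updE.
- by move=> z; rewrite (le_trans (PsiM _))// /M lerDl.
- by move=> z; rewrite (le_trans (psiM _))// /M lerDr.
Qed.

(** The factor [b k (ss l0)] is attached to [F] before integrating by parts in coordinate [k];
    summed over [k], it pairs with the factor produced by the derivative to give [covar]. The
    product of two averages becomes an average with a new replica. *)
Lemma gauss_parts x n (F : {ffun 'I_n -> conf} -> R) (l0 : 'I_n) :
  \int[P]_om gibbs_avg (ham x (smp om)) (fun ss => F ss * gfield (smp om) (ss l0)) =
  x * c * (\sum_l \int[P]_om gibbs_avg (ham x (smp om)) (fun ss => F ss * covar (ss l0) (ss l))
   - n%:R * \int[P]_om gibbs_avg (ham x (smp om)) (fun ss : {ffun 'I_n.+1 -> conf} =>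
       F [ffun j => ss (widen_ord (leqnSn n) j)] *
       covar (ss (widen_ord (leqnSn n) l0)) (ss ord_max))).
Proof.
pose Fk k (ss : {ffun 'I_n -> conf}) := F ss * b k (ss l0).
have -> : \int[P]_om gibbs_avg (ham x (smp om)) (fun ss => F ss * gfield (smp om) (ss l0)) =
    \sum_(k <- s1) \int[P]_om (G k om * gibbs_avg (ham x (smp om)) (Fk k)).
  rewrite big_seq -Rintegral_sum; last first.
    move=> k ks; apply: eq_integrable (integrable_gibbs_avg (F := fun om ss => Fk k ss * G k om) x _) => //.
      move=> om _ /=; rewrite -gibbs_avgZ; congr EFin; apply: eq_bigr => ss _.
      by congr (_ * _); exact: mulrC.
    by move=> ss; exact: integrableZ_EFin (integrable_coord ks).
  apply: eq_Rintegral => om _; rewrite -big_seq.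
  under [RHS]eq_bigr do rewrite -gibbs_avgZ.
  rewrite -gibbs_avg_sum; apply: eq_bigr => ss _; congr (_ * _).
  by rewrite /gfield mulr_sumr; apply: eq_bigr => k _; rewrite /Fk /sample; ring.
rewrite big_seq (eq_bigr _ (fun k ks => gauss_parts_coord x (Fk k) ks)).
rewrite -(@Rintegral_sum _ _ _ P _ s1 (fun k => k \in s1)); last first.
  move=> k ks; apply: integrableB_EFin; first exact: integrable_gibbs_avg_cst.
  apply: eq_integrable (integrableZ_EFin n%:R (integrable_gibbs_avg_cst x
    (fun ss : {ffun 'I_n.+1 -> conf} => Fk k [ffun j => ss (widen_ord (leqnSn n) j)] *
      (x * c * b k (ss ord_max))))) => // om _ /=.
  by rewrite (gibbs_avg_new _ (Fk k) (fun s => x * c * b k s)).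
rewrite -Rintegral_sum; last by move=> l _; exact: integrable_gibbs_avg_cst.
rewrite -RintegralZl//; last exact: integrable_gibbs_avg_cst.
rewrite -RintegralB//; last 2 first.
- by apply: integrable_sum_EFin => l _; exact: integrable_gibbs_avg_cst.
- exact/integrableZ_EFin/integrable_gibbs_avg_cst.
rewrite -RintegralZl//; last first.
  apply: integrableB_EFin.
    by apply: integrable_sum_EFin => l _; exact: integrable_gibbs_avg_cst.
  exact/integrableZ_EFin/integrable_gibbs_avg_cst.
apply: eq_Rintegral => om _; rewrite -big_seq sumrB mulrBr; congr (_ - _).
  rewrite -!gibbs_avg_sum -gibbs_avgZ; apply: eq_bigr => ss _; congr (_ * _).
  rewrite mulr_sumr; under eq_bigr do rewrite mulr_sumr.
  rewrite exchange_big /=; apply: eq_bigr => l _.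
  by rewrite /covar !mulr_sumr; apply: eq_bigr => k _; rewrite /Fk; ring.
rewrite -!mulr_sumr mulrCA; congr (_ * _).
under eq_bigr do rewrite -gibbs_avg_new.
rewrite -gibbs_avg_sum -gibbs_avgZ; apply: eq_bigr => ss _; congr (_ * _).
by rewrite /covar !mulr_sumr; apply: eq_bigr => k _; rewrite /Fk !ffunE; ring.
Qed.

Variable q0 : R.
Hypothesis covar_diag : forall s, covar s s = q0.

Definition mean_overlap x : R :=
  \int[P]_om gibbs_avg (ham x (smp om))
    (fun ss : {ffun 'I_2 -> conf} => covar (ss ord0) (ss ord_max)).

(** The case [n = 1], [F = 1] of [gauss_parts]: the sum reduces to the diagonal term, and the new
    replica yields the overlap of two replicas. *)
Lemma mean_fieldE x : mean_field x = x * c * (q0 - mean_overlap x).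
Proof.
have := @gauss_parts x 1 (fun=> 1) ord0.
under eq_Rintegral do (under [X in gibbs_avg _ X]eq_fun do rewrite mul1r; rewrite gibbs_avg1E).
rewrite -/(mean_field x) => ->; congr (_ * (_ - _)).
  rewrite big_ord1 -[RHS](Rintegral_prob_cst P); apply: eq_Rintegral => om _.
  under [X in gibbs_avg _ X]eq_fun do rewrite mul1r covar_diag.
  exact: gibbs_avg_cst.
rewrite mul1r; apply: eq_Rintegral => om _; apply: eq_bigr => ss _; rewrite mul1r.
by congr (_ * covar (ss _) _); exact: val_inj.
Qed.

(** The left side is the absolute value of the mean of [F * (g - mean_field x)]. Integrating by
    parts both in the mean of [F * g] and in [mean_field x] produces the diagonal term [q0] twice,
    with opposite signs. *)
Lemma ghirlanda_guerra_le x n (F : {ffun 'I_n -> conf} -> R) (M : R) (l0 : 'I_n) :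
  (forall ss, `|F ss| <= M) ->
  `|x * c| * `|\sum_(l | l != l0)
        \int[P]_om gibbs_avg (ham x (smp om)) (fun ss => F ss * covar (ss l0) (ss l))
     - n%:R * \int[P]_om gibbs_avg (ham x (smp om)) (fun ss : {ffun 'I_n.+1 -> conf} =>
       F [ffun j => ss (widen_ord (leqnSn n) j)] *
       covar (ss (widen_ord (leqnSn n) l0)) (ss ord_max))
     + mean_overlap x * \int[P]_om gibbs_avg (ham x (smp om)) F| <=
  M * \int[P]_om avg1 (ham x (smp om)) (fun s => `|gfield (smp om) s - mean_field x|).
Proof.
move=> FM; rewrite -normrM.
have M0 : 0 <= M by exact: le_trans (normr_ge0 _) (FM [ffun=> [ffun=> true]]).
have iFg : P.-integrable setT (EFin \o (fun om =>
    gibbs_avg (ham x (smp om)) (fun ss => F ss * gfield (smp om) (ss l0)))).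
  by apply: integrable_gibbs_avg => ss; exact: integrableZ_EFin (integrable_gfield _).
have iF := integrable_gibbs_avg_cst x F.
rewrite [X in `|X|](_ : _ = \int[P]_om gibbs_avg (ham x (smp om))
    (fun ss => F ss * (gfield (smp om) (ss l0) - mean_field x))); last first.
  transitivity (\int[P]_om gibbs_avg (ham x (smp om)) (fun ss => F ss * gfield (smp om) (ss l0))
     - mean_field x * \int[P]_om gibbs_avg (ham x (smp om)) F).
    rewrite gauss_parts [in RHS](bigD1 l0)//= mean_fieldE.
    have -> : \int[P]_om gibbs_avg (ham x (smp om)) (fun ss => F ss * covar (ss l0) (ss l0)) =
        q0 * \int[P]_om gibbs_avg (ham x (smp om)) F.
      rewrite -RintegralZl//; apply: eq_Rintegral => om _; rewrite -gibbs_avgZ.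
      by apply: eq_bigr => ss _; rewrite covar_diag; ring.
    ring.
  rewrite -RintegralZl// -RintegralB//; last exact: integrableZ_EFin.
  apply: eq_Rintegral => om _; rewrite -gibbs_avgZ -mulN1r -gibbs_avgZ -gibbs_avgD.
  by apply: eq_bigr => ss _; ring.
have iabs : P.-integrable setT (EFin \o (fun om =>
    avg1 (ham x (smp om)) (fun s => `|gfield (smp om) s - mean_field x|))).
  apply: integrable_avg1 => s; apply: (integrable_norm (f := fun om => gfield (smp om) s - mean_field x)).
  exact: integrableB_EFin (integrable_gfield _) (integrable_prob_cst _ _).
have iFgm : P.-integrable setT (EFin \o (fun om => gibbs_avg (ham x (smp om))
    (fun ss => F ss * (gfield (smp om) (ss l0) - mean_field x)))).
  apply: integrable_gibbs_avg => ss; apply: integrableZ_EFin.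
  exact: integrableB_EFin (integrable_gfield _) (integrable_prob_cst _ _).
apply: (le_trans (le_normr_Rintegral _ _)) => //.
rewrite -RintegralZl//; apply: le_Rintegral => //.
- exact: (integrable_norm iFgm).
- exact: integrableZ_EFin.
- move=> om _; rewrite -(gibbs_avg1E _ l0) -gibbs_avgZ.
  apply: (le_trans (normr_gibbs_avg _ _)); apply: gibbs_avg_le => ss.
  by rewrite normrM ler_wpM2r.
Qed.

(** [c * mean_field x] is a subgradient of [mean_fe] at [x]; both signs of [h] will be used. *)
Lemma mean_fe_jensen (x h : R) :
  P.-integrable setT (EFin \o (fun om => free_energy (ham x (smp om)))) ->
  P.-integrable setT (EFin \o (fun om => free_energy (ham (x + h) (smp om)))) ->
  mean_fe x + h * c * mean_field x <= mean_fe (x + h).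
Proof.
move=> i1 i2; have ig : P.-integrable setT (EFin \o (fun om =>
    avg1 (ham x (smp om)) (gfield (smp om)))).
  by apply: integrable_avg1 => s; exact: integrable_gfield.
rewrite /mean_field -RintegralZl// /mean_fe -RintegralD//; last exact: integrableZ_EFin.
apply: le_Rintegral => //; first exact: integrableD_EFin i1 (integrableZ_EFin _ ig).
move=> om _; rewrite -avg1Z.
have -> : ham (x + h) (smp om) = (fun s => ham x (smp om) s + h * c * gfield (smp om) s).
  by apply/funext => s; exact: ham_shift.
exact: free_energy_jensen.
Qed.

(* Both tails of [h c (g - E<g>)] are controlled by increments of the free energy,
   and [c E<g>] is a subgradient of [mean_fe] by Jensen. *)
Lemma fluctuation_le (x h V : R) : 0 < h -> 0 < c ->
  (forall y, y \in [:: x; x + h; x - h] ->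
    P.-integrable setT (EFin \o (fun om => free_energy (ham y (smp om)))) /\
    \int[P]_om `|free_energy (ham y (smp om)) - mean_fe y| <= V) ->
  h * c * \int[P]_om avg1 (ham x (smp om)) (fun s => `|gfield (smp om) s - mean_field x|) <=
  2 + 4 * V + (mean_fe (x + h) + mean_fe (x - h) - 2 * mean_fe x).
Proof.
move=> h0 c0 conc.
have [i0 V0] := conc x (mem_head _ _).
have [ip Vp] : P.-integrable setT (EFin \o (fun om => free_energy (ham (x + h) (smp om)))) /\
    \int[P]_om `|free_energy (ham (x + h) (smp om)) - mean_fe (x + h)| <= V.
  by apply: conc; rewrite !inE eqxx orbT.
have [im Vm] : P.-integrable setT (EFin \o (fun om => free_energy (ham (x - h) (smp om)))) /\
    \int[P]_om `|free_energy (ham (x - h) (smp om)) - mean_fe (x - h)| <= V.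
  by apply: conc; rewrite !inE eqxx !orbT.
have iD y : P.-integrable setT (EFin \o (fun om => free_energy (ham y (smp om)))) ->
    P.-integrable setT (EFin \o (fun om => `|free_energy (ham y (smp om)) - mean_fe y|)).
  move=> iy; apply: (integrable_norm (f := fun om => free_energy (ham y (smp om)) - mean_fe y)).
  exact: integrableB_EFin iy (integrable_prob_cst _ _).
have [[ia0 iap] iam] := (iD _ i0, iD _ ip, iD _ im).
have jp := mean_fe_jensen i0 ip.
have jm := mean_fe_jensen (h := - h) i0 im.
set m := mean_field x in jp jm *.
have iabs : P.-integrable setT (EFin \o (fun om =>
    avg1 (ham x (smp om)) (fun s => `|gfield (smp om) s - m|))).
  apply: integrable_avg1 => s; apply: (integrable_norm (f := fun om => gfield (smp om) s - m)).
  exact: integrableB_EFin (integrable_gfield _) (integrable_prob_cst _ _).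
rewrite -RintegralZl// [leRHS](_ : _ = 2 + (mean_fe (x + h) + mean_fe (x - h)
  - 2 * mean_fe x) + 4 * V); last by rewrite addrAC.
apply: (Rintegral_le4 (integrableZ_EFin (h * c) iabs) iap iam ia0 _ Vp Vm V0) => om.
apply: (le_trans (avg1_normr_le _ _ (mulr_gt0 h0 c0))).
have -> : free_energy (fun s => ham x (smp om) s + h * c * (gfield (smp om) s - m)) =
    free_energy (ham (x + h) (smp om)) - h * c * m.
  rewrite -free_energy_addC; congr free_energy; apply/funext => s.
  by rewrite ham_shift; ring.
have -> : free_energy (fun s => ham x (smp om) s - h * c * (gfield (smp om) s - m)) =
    free_energy (ham (x - h) (smp om)) + h * c * m.
  rewrite -free_energy_addC; congr free_energy; apply/funext => s.
  by rewrite ham_shift; ring.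
apply: (second_difference_le _ _ _ jp); by rewrite -!mulNr.
Qed.

(** The increment lies between the subgradient increments at its two ends, and [mean_fieldE] bounds
    [mean_field y] by [2 y c] since covariances are at most 1. *)
Lemma mean_fe_diff (x h : R) : 0 <= h -> 0 <= c -> 0 <= x -> h <= x ->
  (forall s s', `|covar s s'| <= 1) ->
  P.-integrable setT (EFin \o (fun om => free_energy (ham x (smp om)))) ->
  P.-integrable setT (EFin \o (fun om => free_energy (ham (x - h) (smp om)))) ->
  `|mean_fe x - mean_fe (x - h)| <= 2 * x * h * c ^+ 2.
Proof.
move=> h0 c0 x0 hx cov1 i1 i2.
have mb (y : R) : 0 <= y -> `|mean_field y| <= 2 * y * c.
  move=> y0; rewrite mean_fieldE normrM (ger0_norm (mulr_ge0 y0 c0)).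
  have ov : `|mean_overlap y| <= 1.
    apply: (le_trans (le_normr_Rintegral _ _)) => //; first exact: integrable_gibbs_avg_cst.
    rewrite -[leRHS](Rintegral_prob_cst P); apply: le_Rintegral => //.
    - exact: (integrable_norm (integrable_gibbs_avg_cst _ _)).
    - exact: integrable_prob_cst.
    - by move=> om _; apply: gibbs_avg_bound => ss.
  have q01 : `|q0| <= 1 by rewrite -(covar_diag [ffun=> true]).
  apply: (@le_trans _ _ (y * c * 2)).
    by rewrite ler_wpM2l ?mulr_ge0// (le_trans (ler_normB _ _))//; lra.
  by rewrite mulrC mulrA.
have j1 := mean_fe_jensen (h := - h) i1 i2.
have E : x - h + h = x by rewrite subrK.
have i1' : P.-integrable setT (EFin \o (fun om => free_energy (ham (x - h + h) (smp om)))).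
  by rewrite E.
have j2 := mean_fe_jensen i2 i1'; rewrite E in j2.
have := mb _ x0; rewrite ler_norml => /andP[_ m1].
have : 0 <= x - h by rewrite subr_ge0.
move=> /[dup] xh0 /mb; rewrite ler_norml => /andP[m2 _].
have hc0 : 0 <= h * c by exact: mulr_ge0.
have a1 := ler_wpM2l hc0 m1; have a2 := ler_wpM2l hc0 m2.
have a3 : h * c * (2 * (x - h) * c) <= h * c * (2 * x * c).
  by rewrite ler_wpM2l// ler_wpM2r// ler_wpM2l// gerBl.
rewrite mulrN in a2; rewrite mulNr mulNr in j1.
rewrite [h * c * (2 * x * c)](_ : _ = 2 * x * h * c ^+ 2) in a1 a3; last by ring.
exact: normr_diff_le a1 a2 a3 j1 j2.
Qed.

End perturbed_gibbs.

(** * The truncated Hamiltonian as a linear form in the disorder *)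

Section geometric.
Context {R : realType}.

Lemma sum_half_pow (K : nat) : \sum_(m <- iota 0 K) (2 : R) ^- m <= 2.
Proof.
suff -> : \sum_(m <- iota 0 K) (2 : R) ^- m = 2 - 2 * 2 ^- K.
  by rewrite gerBl mulr_ge0// invr_ge0 exprn_ge0.
elim: K => [|K IH]; first by rewrite big_nil expr0 invr1; ring.
rewrite -[K.+1]addn1 iotaD big_cat /= big_seq1 IH add0n addn1 exprS invfM.
by field; rewrite expf_neq0.
Qed.

Lemma sum_half_pow1 (K : nat) : \sum_(1 <= q < K) (2 : R) ^- q <= 1.
Proof.
case: K => [|K]; first by rewrite big_geq.
suff -> : \sum_(1 <= q < K.+1) (2 : R) ^- q = 1 - 2 ^- K.
  by rewrite gerBl invr_ge0 exprn_ge0.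
elim: K => [|K IH]; first by rewrite big_geq// expr0 invr1 subrr.
rewrite big_nat_recr//= IH exprS invfM.
by field; rewrite expf_neq0.
Qed.

End geometric.

(** The source of the power [p] in the covariance: summing over words of length [p] multiplies out
    the power of a sum over sites. *)
Lemma sum_tuple_prod {R : comPzRingType} (T : finType) (p : nat) (f : T -> R) :
  \sum_(t : p.-tuple T) \prod_(i <- t) f i = (\sum_i f i) ^+ p.
Proof.
transitivity (\sum_(g : {ffun 'I_p -> T}) \prod_k f (g k)).
  rewrite (reindex (@tuple_of_finfun T p)); last first.
    by exists (@finfun_of_tuple T p) => g _; [exact: tuple_of_finfunK|exact: finfun_of_tupleK].
  apply: eq_bigr => g _; rewrite big_tuple; apply: eq_bigr => k _.
  by rewrite tnth_mktuple.
by rewrite -(bigA_distr_bigA (fun _ => f)) prodr_const card_ord.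
Qed.

Section linear_hamiltonian.
Context {R : realType} {S : finType} {N : nat}.
Variables (spec : 'I_N -> S) (J : set nat) (wof : nat -> S -> R) (gamma : R).
Hypothesis HWsub : forall m, J m -> forall s, 0 <= wof m s <= 1.
Local Notation conf := {ffun 'I_N -> bool}.
Local Notation idx := (('I_N * 'I_N) + (nat * seq 'I_N))%type.
Local Notation rN := (Num.sqrt (N%:R : R)).

(** [inl (i, j)] is the coupling of two sites in H_N; [inr (m, t)] is the coefficient of g^{w,p} at
    the word [t], where [w = wof m] and p is the length of [t]. *)
Definition valid : set idx :=
  [set k | match k with inl _ => True | inr mt => J mt.1 /\ (1 <= size mt.2)%N end].

(** The coefficient of the Gaussian variable of word [t] in h_{N,w,p}. *)
Definition amplitude (m : nat) (t : seq 'I_N) (sg : conf) : R :=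
  rN^-1 ^+ size t * \prod_(i <- t) (spin (sg i) * Num.sqrt (wof m (spec i))).

Definition coef (x : nat * nat -> R) (k : idx) (sg : conf) : R :=
  match k with
  | inl ij => rN^-1 * (spin (sg ij.1) * spin (sg ij.2))
  | inr mt => N%:R `^ gamma * 2 ^- (mt.1 + size mt.2) * x (mt.1, size mt.2) *
              amplitude mt.1 mt.2 sg
  end.

Definition words (K : nat) : seq (seq 'I_N) :=
  [seq val t | q <- index_iota 1 K, t <- enum {: q.-tuple 'I_N}].

Definition levels (K : nat) : seq nat := [seq m <- iota 0 K | `[< J m >]].

Definition coords (K : nat) : seq idx :=
  [seq inl ij | ij <- enum {: 'I_N * 'I_N}] ++
  [seq inr (m, t) | m <- levels K, t <- words K].

Definition block (m p : nat) : seq idx :=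
  [seq inr (m, val t) | t <- enum {: p.-tuple 'I_N}].

(** The partial sums whose [limn] defines [h_N]. Parameters are indexed by pairs so that [upd] can
    change a single one. *)
Definition pert_trunc (K : nat) (x : nat * nat -> R) (gP : nat -> seq 'I_N -> R)
    (sg : conf) : R :=
  \sum_(m < K) \sum_(1 <= p < K)
     (if `[< J m >] then
        (2 : R) ^- (m + p) * x (m : nat, p) * h_wp spec (wof m) p (gP m) sg
      else 0).

Definition ham_trunc (K : nat) (x : nat * nat -> R) (g : 'I_N -> 'I_N -> R)
    (gP : nat -> seq 'I_N -> R) (sg : conf) : R :=
  H_SK g sg + N%:R `^ gamma * pert_trunc K x gP sg.

Lemma mem_words K t : (t \in words K) = (1 <= size t < K)%N.
Proof.
apply/allpairsPdep/idP => [[q [u [qK _ ->]]]|tK].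
  by rewrite size_tuple -mem_index_iota.
exists (size t), (in_tuple t); split => //; first by rewrite mem_index_iota.
by rewrite mem_enum.
Qed.

Lemma words_uniq K : uniq (words K).
Proof.
apply: allpairs_uniq_dep; first exact: iota_uniq.
  by move=> q _; exact: enum_uniq.
move=> [q t] [q' t'] _ _ /= tt'.
have qq' : q = q' by rewrite -(size_tuple t) -(size_tuple t') tt'.
by move: t' tt'; rewrite -qq' => t' /val_inj ->.
Qed.

Lemma coords_uniq K : uniq (coords K).
Proof.
rewrite cat_uniq map_inj_uniq ?enum_uniq/=; last by move=> ? ? [].
rewrite allpairs_uniq ?filter_uniq ?iota_uniq ?words_uniq//; last first.
  by move=> [m t] [m' t'] _ _ /= [-> ->].
rewrite andbT; apply/hasPn => k /allpairsP[[m t] /= [_ _ ->]].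
by apply/mapP => -[].
Qed.

Lemma coords_inr K m t :
  (inr (m, t) \in coords K) = [&& (m < K)%N, `[< J m >] & (1 <= size t < K)%N].
Proof.
rewrite mem_cat; have -> /= : (inr (m, t) \in [seq inl ij | ij <- enum {: 'I_N * 'I_N}]) = false.
  by apply/negP => /mapP[].
have mlev : (m \in levels K) = (m < K)%N && `[< J m >].
  by rewrite mem_filter mem_iota andbC.
rewrite -mem_words andbA -mlev.
apply/allpairsP/andP => [[[m' t'] /= [mK tK [-> ->]]]//|[mK tK]].
by exists (m, t).
Qed.

Lemma coords_valid K k : k \in coords K -> valid k.
Proof.
case: k => [//|[m t]]; rewrite coords_inr => /and3P[_ /asboolP Jm /andP[t1 _]].
by split.
Qed.

Lemma block_uniq m p : uniq (block m p).
Proof.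
by rewrite map_inj_uniq ?enum_uniq// => t t' [tt']; exact: val_inj.
Qed.

Lemma mem_block m p k : (k \in block m p) =
  match k with inl _ => false | inr mt => (mt.1 == m) && (size mt.2 == p) end.
Proof.
apply/mapP/idP => [[t _ ->]|]; first by rewrite /= eqxx size_tuple eqxx.
case: k => [//|[m' t]] /= /andP[/eqP -> /eqP tp].
have ts : size t == p by rewrite tp.
by exists (Tuple ts) => //; rewrite mem_enum.
Qed.

Lemma block_coords K m p : (m < K)%N -> J m -> (1 <= p < K)%N ->
  {subset block m p <= coords K}.
Proof.
move=> mK Jm pK [ij|[m' t]]; rewrite mem_block//= coords_inr.
by move=> /andP[/eqP -> /eqP ->]; rewrite mK pK asboolT.
Qed.

Lemma h_wpE m p (gp : seq 'I_N -> R) sg :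
  h_wp spec (wof m) p gp sg =
  \sum_(t : p.-tuple 'I_N) amplitude m t sg * gp (val t).
Proof.
rewrite /h_wp mulr_sumr; apply: eq_bigr => t _.
rewrite /amplitude size_tuple big_tuple; ring.
Qed.

Lemma ham_truncE K x (y : idx -> R) sg :
  ham_trunc K x (fun i j => y (inl (i, j))) (fun m t => y (inr (m, t))) sg =
  \sum_(k <- coords K) coef x k sg * y k.
Proof.
rewrite /ham_trunc /coords big_cat /=; congr (_ + _).
  rewrite big_map big_enum /= /H_SK mulr_sumr.
  transitivity (\sum_(i < N) \sum_(j < N)
      rN^-1 * (y (inl (i, j)) * spin (sg i) * spin (sg j))).
    by apply: eq_bigr => i _; rewrite mulr_sumr.
  rewrite pair_big /=; apply: eq_bigr => -[i j] _ /=; ring.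
rewrite big_allpairs_dep /= /levels big_filter big_mkcond /=.
have -> : iota 0 K = index_iota 0 K by rewrite /index_iota subn0.
rewrite big_mkord /pert_trunc mulr_sumr.
apply: eq_bigr => m _; case: ifPn => Jm; last first.
  by rewrite big1 ?mulr0.
rewrite mulr_sumr big_allpairs_dep; apply: eq_bigr => p _.
rewrite h_wpE !mulr_sumr big_enum; apply: eq_bigr => t _ /=.
by rewrite size_tuple; ring.
Qed.

(** The value on [inl] is a default: [amp] is summed over blocks, which contain no such index. *)
Definition amp (k : idx) (sg : conf) : R :=
  if k is inr mt then amplitude mt.1 mt.2 sg else 0.

(** Outside the block no coefficient involves the parameter at [(m, p)]; this puts the truncated
    Hamiltonian in the form [ham]. *)
Lemma ham_trunc_split K m p x z (y : idx -> R) sg :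
  (m < K)%N -> J m -> (1 <= p < K)%N ->
  \sum_(k <- coords K) coef (upd x (m, p) z) k sg * y k =
  \sum_(k <- coords K | k \notin block m p) coef x k sg * y k +
  z * (N%:R `^ gamma * 2 ^- (m + p)) * \sum_(k <- block m p) amp k sg * y k.
Proof.
move=> mK Jm pK; rewrite (bigID (fun k => k \in block m p)) /= addrC; congr (_ + _).
  apply: eq_bigr => -[//|[m' t]]; rewrite mem_block /= => mt.
  by rewrite upd_neq// xpair_eqE.
rewrite -big_filter mulr_sumr (perm_big (block m p)) /=; last first.
  apply: uniq_perm; rewrite ?filter_uniq ?coords_uniq ?block_uniq// => k.
  rewrite mem_filter; case: (boolP (k \in block m p)) => //= kb.
  exact: (block_coords mK Jm pK).
rewrite !big_map; apply: eq_bigr => t _ /=; rewrite size_tuple updE; ring.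
Qed.

Lemma normr_spin b : `|spin b : R| = 1.
Proof. by case: b; rewrite /spin ?normrN normr1. Qed.

Lemma normr_amplitude m t sg : J m -> `|amplitude m t sg| <= rN^-1 ^+ size t.
Proof.
move=> Jm; rewrite /amplitude normrM ger0_norm ?exprn_ge0 ?invr_ge0//.
rewrite ler_piMr ?exprn_ge0 ?invr_ge0//.
elim: t => [|i t IH]; first by rewrite big_nil normr1.
rewrite big_cons !normrM normr_spin mul1r.
have /andP[w0 w1] := HWsub Jm (spec i).
rewrite mulr_ile1// ger0_norm ?sqrtr_ge0//.
by rewrite -[leRHS]sqrtr1 ler_wsqrtr.
Qed.

(** The factor 3 bounds a parameter of [1, 2] shifted by a step [h < 1]. *)
Definition lip_const (k : idx) : R :=
  match k with
  | inl _ => rN^-1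
  | inr mt => N%:R `^ gamma * 2 ^- (mt.1 + size mt.2) * 3 * rN^-1 ^+ size mt.2
  end.

Lemma normr_coef x k sg : valid k ->
  (forall m p, J m -> (1 <= p)%N -> `|x (m, p)| <= 3) ->
  `|coef x k sg| <= lip_const k.
Proof.
case: k => [[i j] _ _|[m t] [/= Jm t1] x3] /=.
  by rewrite !normrM !normr_spin !mulr1 ger0_norm// invr_ge0.
rewrite normrM ler_pM//; last exact: normr_amplitude.
rewrite normrM ger0_norm ?mulr_ge0 ?powR_ge0 ?invr_ge0 ?exprn_ge0//.
by rewrite ler_wpM2l ?x3// mulr_ge0 ?powR_ge0 ?invr_ge0 ?exprn_ge0.
Qed.

(** There are [N^2] couplings of weight [1 / N], and [N^q] words of length [q] of squared weight
    [N^(-q)], so the word count cancels. The factor [N^(2 gamma)] is at most [N], and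
    [18 = 3^2 * 2], where 2 and 1 bound the geometric sums over [m] and [q]. *)
Lemma sum_lip_const K (Dm : R) (v : idx -> R) : (0 < N)%N -> 0 <= gamma <= 1 / 2 ->
  (forall ij, 0 <= v (inl ij) <= Dm) -> (forall mt, v (inr mt) = 1) ->
  \sum_(k <- coords K) lip_const k ^+ 2 * v k <= (Dm + 18) * N%:R.
Proof.
move=> N0 /andP[g0 g12] vl vr.
have NR0 : 0 < N%:R :> R by rewrite ltr0n.
have rNK : rN^-1 ^+ 2 = N%:R^-1 by rewrite exprVn sqr_sqrtr// ltW.
rewrite big_cat /= mulrDl lerD//.
  rewrite big_map big_enum /=.
  apply: (@le_trans _ _ (\sum_(ij : 'I_N * 'I_N) N%:R^-1 * Dm)).
    apply: ler_sum => ij _; rewrite rNK ler_wpM2l ?invr_ge0 ?(ltW NR0)//.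
    by have /andP[] := vl ij.
  rewrite sumr_const card_prod card_ord -[leLHS]mulr_natl natrM mulrA -(mulrA N%:R) divff ?gt_eqF//.
  by rewrite mulr1 mulrC.
rewrite big_allpairs_dep /= /levels big_filter.
have g2 : (N%:R `^ gamma) ^+ 2 <= N%:R :> R.
  rewrite expr2 -powRD; last by apply/implyP => _; rewrite gt_eqF.
  rewrite -[leRHS](powRr1 (ltW NR0)) ler_powR ?ler1n//.
  by rewrite -mulr2n -[leLHS]mulr_natr -ler_pdivlMr.
apply: (@le_trans _ _ (\sum_(m <- iota 0 K) 9 * N%:R * 2 ^- m * 1)); last first.
  rewrite -mulr_suml mulr1 -mulr_sumr.
  apply: (@le_trans _ _ (9 * N%:R * 2)); first by rewrite ler_wpM2l ?sum_half_pow// mulr_ge0// ltW.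
  by rewrite le_eqVlt; apply/orP; left; apply/eqP; ring.
rewrite [leLHS]big_mkcond /=; apply: ler_sum => m _.
have nn : 0 <= 9 * N%:R * 2 ^- m :> R by rewrite !mulr_ge0 ?invr_ge0 ?exprn_ge0// ltW.
case: ifPn => _; last by rewrite mulr_ge0.
apply: (le_trans _ (ler_wpM2l nn (sum_half_pow1 K))).
rewrite big_allpairs_dep mulr_sumr; apply: ler_sum => q _.
rewrite big_enum /= (eq_bigr (fun _ => (N%:R `^ gamma * 2 ^- (m + q) * 3 * rN^-1 ^+ q) ^+ 2)); last first.
  by move=> t _ /=; rewrite size_tuple vr mulr1.
rewrite sumr_const card_tuple card_ord -[leLHS]mulr_natl natrX.
have -> : N%:R ^+ q * (N%:R `^ gamma * 2 ^- (m + q) * 3 * rN^-1 ^+ q) ^+ 2 =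
    9 * (N%:R `^ gamma) ^+ 2 * (2 ^- m) ^+ 2 * (2 ^- q) ^+ 2 * (N%:R ^+ q * (rN^-1 ^+ 2) ^+ q).
  rewrite -!exprM [(2 * q)%N]mulnC exprM exprD invfM; ring.
rewrite rNK -exprMn divff ?gt_eqF// expr1n mulr1.
have h2 n : 0 <= (2 : R) ^- n <= 1.
  by rewrite invr_ge0 exprn_ge0//= invf_le1 ?exprn_gt0// exprn_ege1// ler1n.
have /andP[m0 m1] := h2 m; have /andP[q0 q1] := h2 q.
have a1 : (2 ^- m) ^+ 2 <= 2 ^- m :> R by rewrite expr2 ler_piMr.
have a2 : (2 ^- q) ^+ 2 <= 2 ^- q :> R by rewrite expr2 ler_piMr.
have a0 : 9 * (N%:R `^ gamma) ^+ 2 <= 9 * N%:R :> R by rewrite ler_wpM2l.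
have g0' : 0 <= 9 * (N%:R `^ gamma) ^+ 2 :> R by rewrite mulr_ge0// sqr_ge0.
exact: (ler_pM (mulr_ge0 g0' (sqr_ge0 _)) (sqr_ge0 _) (ler_pM g0' (sqr_ge0 _) a0 a1) a2).
Qed.

Lemma overlap_wE (w : S -> R) (s1 s2 : conf) :
  overlap_w spec w s1 s2 = N%:R^-1 * \sum_i w (spec i) * (spin (s1 i) * spin (s2 i)).
Proof.
rewrite (partition_big spec xpredT)//= mulr_sumr; apply: eq_bigr => s _.
rewrite /overlap_s.
(* An empty species contributes zero on both sides, whatever the inverse of zero is. *)
have [n0|n0] := eqVneq (Nsp spec s) 0%N.
  rewrite n0 !mul0r big_pred0 ?mulr0// => i; apply/negbTE/negP => si.
  have := card0_eq n0 i; rewrite mem_set//=; exact: si.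
rewrite [X in _ = _ * X](eq_bigr (fun i => w s * (spin (s1 i) * spin (s2 i)))); last first.
  by move=> i /eqP ->.
rewrite -mulr_sumr mulrACA [X in X * _]mulrAC divff ?mul1r ?pnatr_eq0//.
Qed.

(** The product over the letters of a word factorizes, the two square roots of w_s multiply to w_s,
    and [sum_tuple_prod] gathers the words. *)
Lemma covar_block m p s1 s2 : (0 < N)%N -> J m ->
  \sum_(k <- block m p) amp k s1 * amp k s2 = overlap_w spec (wof m) s1 s2 ^+ p.
Proof.
move=> N0 Jm; rewrite big_map big_enum /= overlap_wE exprMn -sum_tuple_prod mulr_sumr.
have NR0 : 0 < N%:R :> R by rewrite ltr0n.
apply: eq_bigr => t _; rewrite /amplitude size_tuple.
rewrite mulrACA -expr2 -exprM mulnC exprM exprVn sqr_sqrtr ?(ltW NR0)// -big_split /=.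
congr (_ * _); apply: eq_bigr => i _.
have /andP[w0 _] := HWsub Jm (spec i).
rewrite mulrACA mulrC; congr (_ * _); by rewrite -expr2 sqr_sqrtr.
Qed.

Lemma normr_overlap_w m s1 s2 : J m -> `|overlap_w spec (wof m) s1 s2| <= 1.
Proof.
move=> Jm; rewrite overlap_wE normrM ger0_norm ?invr_ge0//.
have [N0|N0] := posnP N.
  have -> : (N%:R : R) = 0 by rewrite N0.
  by rewrite invr0 mul0r.
have NR0 : 0 < N%:R :> R by rewrite ltr0n.
rewrite ler_pdivrMl// mulr1 (le_trans (ler_norm_sum _ _ _))//.
rewrite -[leRHS](_ : \sum_(i < N) 1 = _); last by rewrite sumr_const card_ord.
apply: ler_sum => i _; rewrite !normrM !normr_spin !mulr1.
by have /andP[w0 w1] := HWsub Jm (spec i); rewrite ger0_norm.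
Qed.

Lemma overlap_w_diag (w : S -> R) s1 s2 :
  overlap_w spec w s1 s1 = overlap_w spec w s2 s2.
Proof.
rewrite !overlap_wE; congr (_ * _); apply: eq_bigr => i _; congr (_ * _).
by case: (s1 i); case: (s2 i); rewrite /spin; ring.
Qed.

End linear_hamiltonian.

(** * Averaged second differences *)

(** The second difference is [D (z + h) - D z], so its integral over [1, 2] telescopes to that of
    [D] over [2, 2 + h] minus that over [1, 1 + h]. Each is at most [h * B] in absolute value. *)
Lemma second_difference_integral {R : realType} (th : R -> R) (h B : R) :
  continuous th -> 0 < h < 1 ->
  (forall z, 1 <= z <= 3 -> `|th z - th (z - h)| <= B) ->
  \int[lebesgue_measure]_(z in `[1, 2]) (th (z + h) + th (z - h) - 2 * th z) <= 2 * h * B.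
Proof.
move=> cth /andP[h0 h1] thB.
pose D z := th z - th (z - h).
have csh (c : R) : continuous (fun z => th (z + c)).
  move=> z; apply: continuous_comp; last exact: cth.
  by apply: cvgD; [exact: cvg_id|exact: cvg_cst].
have cD : continuous D by move=> z; apply: cvgB; [exact: cth|exact: csh].
(* A primitive of [D] based at 0, so that every point where it is differentiated is interior to
   [0, 4]. *)
pose A u := \int[lebesgue_measure]_(z in `[0, u]) D z.
have dA (u : R) : 0 < u < 4 -> is_derive u 1 A (D u).
  move=> /andP[u0 u4].
  have iD : lebesgue_measure.-integrable `[0, 4] (EFin \o D).
    apply: continuous_compact_integrable; first exact: segment_compact.
    exact: continuous_subspaceT.
  have [dv dve] := @continuous_FTC1_closed R D 0 u 4 u4 iD u0 (cD u).
  exact: (DeriveDef dv (etrans (esym (derive1E _ _)) dve)).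
pose W z := A (z + h) - A z.
have dW (z : R) : 0 < z < 3 -> is_derive z 1 W (D (z + h) - D z).
  move=> /andP[z0 z3].
  have d1 : is_derive (z + h) 1 A (D (z + h)).
    by apply: dA; rewrite addr_gt0//=; lra.
  have d2 : is_derive z 1 A (D z) by apply: dA; rewrite z0/=; lra.
  have d0 : is_derive z 1 (fun z : R => z + h) 1.
    by apply: is_derive_eq; rewrite addr0.
  have d3 : is_derive z 1 (A \o (fun z : R => z + h)) (D (z + h) * 1).
    exact: is_derive1_comp.
  rewrite -[D (z + h)]mulr1; exact: is_deriveB.
have cW (z : R) : 0 < z < 3 -> {for z, continuous W}.
  move=> /dW; case=> dv _; apply: differentiable_continuous; exact/derivable1_diffP.
have mvt a : 1 <= a <= 2 -> `|A (a + h) - A a| <= B * h.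
  move=> /andP[a1 a2].
  have [|||c cI ->] := @MVT R A D a (a + h).
  - by rewrite ltrDl.
  - move=> x; rewrite in_itv/= => /andP[ax xh]; apply: dA; lra.
  - apply: derivable_within_continuous => x; rewrite in_itv/= => /andP[ax xh].
    have x4 : 0 < x < 4 by lra.
    by have [] := dA x x4.
  rewrite addrAC subrr add0r normrM (ger0_norm (ltW h0)) ler_wpM2r ?(ltW h0)//.
  by apply: thB; move: cI; rewrite in_itv/=; lra.
have -> : \int[lebesgue_measure]_(z in `[1, 2]) (th (z + h) + th (z - h) - 2 * th z) = W 2 - W 1.
  rewrite /Rintegral (@continuous_FTC2 R (fun z => th (z + h) + th (z - h) - 2 * th z) W)//.
  - by rewrite ltr1n.
  - apply: continuous_subspaceT => z; apply: cvgB; last first.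
      by apply: cvgM; [exact: cvg_cst|exact: cth].
    by apply: cvgD; exact: csh.
  - split.
    + by move=> x; rewrite in_itv/= => ?; have [] : is_derive x 1 W (D (x + h) - D x) by apply: dW; lra.
    + by apply: cvg_at_right_filter; apply: cW; lra.
    + by apply: cvg_at_left_filter; apply: cW; lra.
  - move=> x; rewrite in_itv/= => x12.
    have [_] : is_derive x 1 W (D (x + h) - D x) by apply: dW; lra.
    by rewrite derive1E => ->; rewrite /D addrK; ring.
have m1 : `|A (1 + h) - A 1| <= B * h by apply: mvt; lra.
have m2 : `|A (2 + h) - A 2| <= B * h by apply: mvt; lra.
move: m1 m2; rewrite !ler_norml => /andP[p1 p2] /andP[q1 q2].
by rewrite /W; move: p1 q2; set a := A _ - A _; set b := A _ - A _ => p1 q2; lra.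
Qed.

Lemma second_difference_average {R : realType} (th T : R -> R) (C a h B : R) :
  continuous th -> 0 < h < 1 ->
  (forall z, 1 <= z <= 3 -> `|th z - th (z - h)| <= B) ->
  0 <= C -> measurable_fun setT T -> (forall z, 0 <= T z) ->
  (forall z, 1 <= z <= 2 -> T z <= C * (a + (th (z + h) + th (z - h) - 2 * th z))) ->
  (\int[lebesgue_measure]_(z in `[1%R, 2%R]) (T z)%:E <= (C * (a + 2 * h * B))%:E)%E.
Proof.
move=> cth h01 thB C0 mT T0 le.
pose D2 z := th (z + h) + th (z - h) - 2 * th z.
have csh (b : R) : continuous (fun z => th (z + b)).
  move=> z; apply: continuous_comp; last exact: cth.
  by apply: cvgD; [exact: cvg_id|exact: cvg_cst].
have cD2 : continuous D2.
  move=> z; apply: cvgB; last by apply: cvgM; [exact: cvg_cst|exact: cth].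
  by apply: cvgD; exact: csh.
have iD2 : lebesgue_measure.-integrable `[1, 2] (EFin \o D2).
  apply: continuous_compact_integrable; first exact: segment_compact.
  exact: continuous_subspaceT.
have icst (b : R) : lebesgue_measure.-integrable `[1, 2] (EFin \o cst b).
  apply: continuous_compact_integrable; first exact: segment_compact.
  by apply: continuous_subspaceT => z; exact: cvg_cst.
have iS : lebesgue_measure.-integrable `[1, 2] (EFin \o (fun z => a + D2 z)).
  by have := integrableD _ (icst (a)) iD2; apply.
have iR : lebesgue_measure.-integrable `[1, 2]
    (EFin \o (fun z => C * (a + D2 z))).
  by have := integrableZl _ C iS; apply.
apply: (@le_trans _ _ (\int[lebesgue_measure]_(z in `[1%R, 2%R]) (C * (a + D2 z))%:E)%E).
  apply: ge0_le_integral => //.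
  - by move=> z _; rewrite lee_fin.
  - by apply/measurable_EFinP; exact: measurable_funTS.
  - exact: measurable_int iR.
have -> : (\int[lebesgue_measure]_(z in `[1%R, 2%R]) (C * (a + D2 z))%:E)%E =
   (C * (a + \int[lebesgue_measure]_(z in `[1%R, 2%R]) D2 z))%:E.
  rewrite -[LHS]fineK; last exact: integrable_fin_num.
  congr EFin; rewrite -/(Rintegral _ _ _) RintegralZl// RintegralD//.
  congr (C * (_ + _)); rewrite Rintegral_cst//= lebesgue_measure_itv/= lte_fin ltr1n /=.
  by rewrite (_ : 2 - 1 = 1 :> R) ?mulr1//; ring.
  exact: icst.
by rewrite lee_fin ler_wpM2l// lerD2l; exact: second_difference_integral.
Qed.

(** * The bound at a fixed perturbation *)

(* [Delta] with the perturbed Hamiltonian replaced by an arbitrary one. *)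
Definition gg_defect {R : realType} {S : finType} {d} {Omega : measurableType d}
    (P : probability Omega R) (N : nat) (spec : 'I_N -> S)
    (H : Omega -> {ffun 'I_N -> bool} -> R)
    (n : nat) (f : #|{: S * 'I_n * 'I_n}|.-tuple R -> R) (w : S -> R) (p : nat) : R :=
  let E (F : {ffun 'I_n.+1 -> {ffun 'I_N -> bool}} -> R) :=
    Rintegral P setT (fun om => gibbs_avg (H om) F) in
  let fR (ss : {ffun 'I_n.+1 -> {ffun 'I_N -> bool}}) :=
    f (overlap_array spec (fun i : 'I_n => ss (widen_ord (leqnSn n) i))) in
  let Rw (ss : {ffun 'I_n.+1 -> {ffun 'I_N -> bool}}) (l : 'I_n.+1) :=
    overlap_w spec w (ss ord0) (ss l) ^+ p in
  `| E (fun ss => fR ss * Rw ss ord_max)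
     - n%:R^-1 * E fR * E (fun ss => Rw ss (inord 1))
     - n%:R^-1 * \sum_(1 <= l < n) E (fun ss => fR ss * Rw ss (inord l)) |.

(** [B] is [n] times the defect, [A] the fluctuation of the field and [X] the free energy bound on
    [h c A]. *)
Lemma defect_rescale {R : realFieldType} (n h c M X B A : R) :
  0 < n -> 0 < h -> 0 < c -> 0 <= M -> c * B <= M * A -> h * c * A <= X ->
  n^-1 * B <= M / (n * h * c ^+ 2) * X.
Proof.
move=> n0 h0 c0 M0 cB hA.
have hcB : h * c ^+ 2 * B <= M * X.
  have -> : h * c ^+ 2 * B = (h * c) * (c * B) by ring.
  apply: (@le_trans _ _ (h * c * (M * A))).
    by rewrite ler_wpM2l// mulr_ge0// ltW.
  by rewrite mulrCA ler_wpM2l.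
have -> : M / (n * h * c ^+ 2) * X = n^-1 * ((M * X) / (h * c ^+ 2)).
  by field; rewrite !gt_eqF.
rewrite ler_wpM2l ?invr_ge0 ?(ltW n0)// ler_pdivlMr ?mulr_gt0 ?exprn_gt0//.
by rewrite mulrC.
Qed.

Lemma shift_range {R : realFieldType} (z h z' : R) : 1 <= z -> z <= 2 -> 0 < h -> h < 1 ->
  z' \in [:: z; z + h; z - h] -> 0 <= z' <= 3.
Proof. by move=> z1 z2 h0 h1; rewrite !inE => /or3P[] /eqP ->; apply/andP; split; lra. Qed.

Section finite_volume.
Context {R : realType} {S : finType} {N : nat}.
Variables (spec : 'I_N -> S) (J : set nat) (wof : nat -> S -> R) (gamma : R).
Variable Delta2 : S -> S -> R.
Hypothesis HD2pos : forall s t, 0 <= Delta2 s t.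
Hypothesis HWsub : forall m, J m -> forall s, 0 <= wof m s <= 1.
Hypothesis N0 : (0 < N)%N.
Hypothesis gamma_range : 0 <= gamma <= 1 / 2.
Context {d} {Om : measurableType d} (P : probability Om R).
Variables (gSK : 'I_N -> 'I_N -> Om -> R) (gP : nat -> seq 'I_N -> Om -> R).
Local Notation conf := {ffun 'I_N -> bool}.
Local Notation idx := (('I_N * 'I_N) + (nat * seq 'I_N))%type.

Definition disorder (k : idx) : Om -> R :=
  match k with inl ij => gSK ij.1 ij.2 | inr mt => gP mt.1 mt.2 end.

Local Notation D := (@valid N J).
Hypothesis HgSK : forall i j, centered_gaussian P (gSK i j) (Delta2 (spec i) (spec j)).
Hypothesis HgP : forall m (t : seq 'I_N), J m -> (1 <= size t)%N ->
  centered_gaussian P (gP m t) 1.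
Hypothesis Hindep : mutually_independent P D disorder.

Lemma measurable_disorder k : D k -> measurable_fun setT (disorder k).
Proof.
case: k => [[i j] _|[m t] [/= Jm t1]]; first by have [] := HgSK i j.
by have [] := HgP Jm t1.
Qed.

Definition variance (k : idx) : R :=
  if k is inl ij then Delta2 (spec ij.1) (spec ij.2) else 1.

(** A vanishing variance is the degenerate case, where the variable is almost surely 0. *)
Lemma centered_gaussian_second_moment (X : Om -> R) v : 0 <= v ->
  centered_gaussian P X v -> (\int[P]_om (X om ^+ 2)%:E <= v%:E)%E.
Proof.
move=> v0 [mX [X0 Xn]]; have [v_0|vn] := eqVneq v 0; last first.
  have sv : 0 < Num.sqrt v by rewrite sqrtr_gt0 lt_neqAle eq_sym vn.
  by have := normal_second_moment sv mX (Xn vn); rewrite sqr_sqrtr.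
have mA : measurable (X @^-1` [set 0]).
  by rewrite -[Y in measurable Y]setTI; exact: mX (measurable_set1 0).
rewrite (ae_eq_integral (cst 0%E)) ?integral0 ?lee_fin//.
  by apply/measurable_EFinP; exact: measurable_funX.
exists (~` (X @^-1` [set 0])); split; first exact: measurableC.
  by have := probability_setC P mA; rewrite X0// subee.
by move=> om /=; apply: contra_not => -> _; rewrite expr0n.
Qed.

Lemma disorder_second_moment k : D k ->
  (\int[P]_om (disorder k om ^+ 2)%:E <= (variance k)%:E)%E.
Proof.
case: k => [[i j] _|[m t] [/= Jm t1]].
  exact: centered_gaussian_second_moment (HD2pos _ _) (HgSK i j).
exact: centered_gaussian_second_moment ler01 (HgP Jm t1).
Qed.

(** A crude common bound for the entries of [Delta2], independent of [N]. *)
Definition total_variance : R := \sum_s \sum_t Delta2 s t.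

Lemma variance_le ij : 0 <= variance (inl ij) <= total_variance.
Proof.
rewrite /= HD2pos /= /total_variance (bigD1 (spec ij.1))//= (bigD1 (spec ij.2))//=.
by rewrite -addrA lerDl addr_ge0// !sumr_ge0// => s _; rewrite sumr_ge0.
Qed.

(** The bound V of the overview: the square root of the variance bound of [sum_lip_const]. *)
Definition fluct_bound : R := Num.sqrt ((total_variance + 18) * N%:R).

Local Notation smp := (@sample R idx D d Om disorder).
Local Notation Htr K x om :=
  (ham_trunc spec J wof gamma K x (fun i j => gSK i j om) (fun m t => gP m t om)).

Lemma ham_trunc_sample K x om sg :
  Htr K x om sg = \sum_(k <- coords J K) coef spec wof gamma x k sg * smp om k.
Proof. by rewrite -ham_truncE. Qed.

Definition linear_fe K x (y : @coord_space R idx D) : R :=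
  free_energy (fun sg : conf => \sum_(k <- coords J K) coef spec wof gamma x k sg * y k).

Lemma linear_fe_sample K x om : free_energy (Htr K x om) = linear_fe K x (smp om).
Proof. by rewrite /linear_fe; congr free_energy; apply/funext => sg; exact: ham_trunc_sample. Qed.

(** Moving one coordinate shifts every energy by at most its coefficient bound, and the free energy
    is 1-Lipschitz for the sup norm. [L] is left free: a crude choice gives integrability for all
    [x], [lip_const] the rate. *)
Lemma linear_fe_efron_stein K x (L : idx -> R) :
  (forall k sg, k \in coords J K -> `|coef spec wof gamma x k sg| <= L k) ->
  P.-integrable setT (EFin \o (linear_fe K x \o smp)) /\
  (\int[P]_om ((linear_fe K x (smp om) - \int[P]_om' linear_fe K x (smp om')) ^+ 2)%:E <=
   (\sum_(k <- coords J K) L k ^+ 2 * variance k)%:E)%E.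
Proof.
move=> coefL; apply: (efron_stein measurable_disorder Hindep) => //.
- by move=> k; exact: coords_valid.
- apply: measurable_free_energy => sg; apply: measurable_sum_seq => k /coords_valid Dk.
  by apply: measurable_funM => //; exact: measurable_coord.
- move=> y y' yy'; congr free_energy; apply/funext => sg.
  by rewrite big_seq [in RHS]big_seq; apply: eq_bigr => k /yy' ->.
- move=> k ks y z z'; apply: free_energy_lip => sg.
  rewrite -sumrB (bigD1_seq k)//= ?coords_uniq// big1 ?addr0; last first.
    by move=> i ik; rewrite !upd_neq// subrr.
  by rewrite !updE -mulrBr normrM ler_wpM2r// coefL.
- by move=> k /coords_valid; exact: disorder_second_moment.
Qed.

Lemma integrable_fe K x : P.-integrable setT (EFin \o (fun om => free_energy (Htr K x om))).
Proof.
(* This constant places no restriction on the parameters, so [mean_fe_at] makes sense for every real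
   argument. *)
pose L k := \sum_sg `|coef spec wof gamma x k sg|.
have [|] := @linear_fe_efron_stein K x L.
  by move=> k sg _; rewrite /L (bigD1 sg)//= lerDl sumr_ge0.
move=> iF _; apply: eq_integrable iF => // om _ /=.
by rewrite linear_fe_sample.
Qed.

Lemma fe_concentration K x :
  (forall m p, J m -> (1 <= p)%N -> `|x (m, p)| <= 3) ->
  \int[P]_om `|free_energy (Htr K x om) - \int[P]_om' free_energy (Htr K x om')|
  <= fluct_bound.
Proof.
move=> x3; have [|iF vF] := @linear_fe_efron_stein K x (lip_const gamma).
  by move=> k sg /coords_valid Dk; exact: (normr_coef spec gamma HWsub sg Dk x3).
have V0 : 0 < fluct_bound.
  rewrite sqrtr_gt0 mulr_gt0 ?ltr0n// ltr_wpDl//.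
  by apply: sumr_ge0 => s _; exact: sumr_ge0.
apply: Rintegral_normr_le => //.
  apply: measurable_funB => //; apply/measurable_EFinP.
  exact: measurable_int (integrable_fe K x).
rewrite sqr_sqrtr; last first.
  by rewrite mulr_ge0// addr_ge0//; apply: sumr_ge0 => s _; exact: sumr_ge0.
have -> : \int[P]_om' free_energy (Htr K x om') = \int[P]_om' linear_fe K x (smp om').
  by apply: eq_Rintegral => om _; exact: linear_fe_sample.
under eq_integral do rewrite linear_fe_sample.
apply: (le_trans vF); rewrite lee_fin; apply: sum_lip_const => //.
exact: variance_le.
Qed.

Section fixed_level.
Variables (K m p : nat).
Hypotheses (mK : (m < K)%N) (Jm : J m) (pK : (1 <= p < K)%N).
Variable x : nat * nat -> R.
Hypothesis x12 : forall m' p', J m' -> (1 <= p')%N -> 1 <= x (m', p') <= 2.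

(** The factor called c in the overview. *)
Definition strength : R := N%:R `^ gamma * 2 ^- (m + p).
Local Notation c := strength.

Lemma strength_gt0 : 0 < c.
Proof. by rewrite mulr_gt0 ?powR_gt0 ?ltr0n// invr_gt0 exprn_gt0. Qed.

(** The terms that do not involve the block, in the role of [H0]. *)
Definition rest (y : @coord_space R idx D) (sg : conf) : R :=
  \sum_(k <- coords J K | k \notin block m p) coef spec wof gamma x k sg * y k.

(* The truncated Hamiltonian as a function of the single parameter [x (m, p)]. *)
Definition ham_at (z : R) (om : Om) := Htr K (upd x (m, p) z) om.
Definition mean_fe_at (z : R) : R := \int[P]_om free_energy (ham_at z om).

Lemma ham_atE z om : ham_at z om = ham rest (block m p) (amp spec wof) c z (smp om).
Proof.
apply/funext => sg; rewrite /ham_at ham_trunc_sample.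
by rewrite (ham_trunc_split _ _ _ x z _ _ mK Jm pK).
Qed.

Lemma block_valid k : k \in block m p -> D k.
Proof. by move=> /(block_coords mK Jm pK); exact: coords_valid. Qed.

Lemma block_law k : k \in block m p ->
  forall B, measurable B -> P (disorder k @^-1` B) = normal_prob 0 1 B.
Proof.
move=> kb; have := block_valid kb; case: k kb => [ij|[m' t]]; rewrite mem_block//=.
move=> _ [/= Jm' t1] B mB; have [_ [_ h]] := HgP Jm' t1.
by rewrite h ?sqrtr1// oner_eq0.
Qed.

Lemma measurable_rest sg : measurable_fun setT (rest ^~ sg).
Proof.
rewrite [X in measurable_fun _ X](_ : _ = fun y : @coord_space R idx D =>
    \sum_(k <- [seq k <- coords J K | k \notin block m p])
      coef spec wof gamma x k sg * y k); last first.
  by apply/funext => y; rewrite big_filter.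
apply: measurable_sum_seq => k; rewrite mem_filter => /andP[_ /coords_valid Dk].
by apply: measurable_funM => //; exact: measurable_coord.
Qed.

Lemma rest_upd k : k \in block m p -> forall y z sg, rest (upd y k z) sg = rest y sg.
Proof.
move=> kb y z sg; apply: eq_bigr => i ib; rewrite upd_neq//.
by apply: contraNneq ib => ->.
Qed.

Lemma covar_diag_block (sg : conf) :
  covar (block m p) (amp spec wof) sg sg =
  overlap_w spec (wof m) [ffun=> true] [ffun=> true] ^+ p.
Proof. by rewrite /covar (covar_block spec HWsub)// (overlap_w_diag _ _ sg [ffun=> true]). Qed.

Lemma normr_covar_block (sg sg' : conf) : `|covar (block m p) (amp spec wof) sg sg'| <= 1.
Proof. by rewrite /covar (covar_block spec HWsub)// normrX exprn_ile1// (normr_overlap_w spec HWsub). Qed.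

Lemma ham_at_concentration z : 0 <= z <= 3 ->
  \int[P]_om `|free_energy (ham_at z om) - mean_fe_at z| <= fluct_bound.
Proof.
move=> /andP[z0 z3]; apply: fe_concentration => m' p' Jm' p1.
rewrite /upd; case: eqP => _; first by rewrite ger0_norm.
have /andP[x1 x2] := x12 Jm' p1; rewrite ger0_norm; last exact: le_trans x1.
by rewrite (le_trans x2)// ler_nat.
Qed.

Lemma mean_fe_at_diff z h : 0 <= h <= z ->
  `|mean_fe_at z - mean_fe_at (z - h)| <= 2 * z * h * c ^+ 2.
Proof.
move=> /andP[h0 hz].
have z0 := le_trans h0 hz.
have E z' : mean_fe_at z' = mean_fe P disorder rest (block m p) (amp spec wof) c z'.
  by apply: eq_Rintegral => om _; rewrite ham_atE.
have I z' : P.-integrable setT (EFin \o (fun om =>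
    free_energy (ham rest (block m p) (amp spec wof) c z' (smp om)))).
  by apply: eq_integrable (integrable_fe K (upd x (m, p) z')) => // om _; rewrite /= -ham_atE.
rewrite !E; apply: (mean_fe_diff measurable_disorder Hindep block_valid (block_uniq _ _)
  block_law measurable_rest rest_upd covar_diag_block) => //.
- exact: ltW strength_gt0.
- exact: normr_covar_block.
Qed.

(** The function is Lipschitz, with constant c times the mean of the sum of [|g|] over
    configurations. Continuity is what the fundamental theorem of calculus asks for when [z] is
    averaged. *)
Lemma mean_fe_at_continuous : continuous mean_fe_at.
Proof.
pose g om sg := gfield (block m p) (amp spec wof) (smp om) sg.
pose B om := c * \sum_sg `|g om sg|.
have iB : P.-integrable setT (EFin \o B).
  apply: integrableZ_EFin; apply: integrable_sum_EFin => sg _.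
  apply: (integrable_norm (f := fun om => g om sg)).
  exact: (integrable_gfield measurable_disorder (amp spec wof) block_valid block_law).
have C0 : 0 <= \int[P]_om B om.
  apply: Rintegral_ge0 => om _; rewrite mulr_ge0 ?(ltW strength_gt0)//.
  by apply: sumr_ge0 => sg _; exact: normr_ge0.
have lip z z' : `|mean_fe_at z - mean_fe_at z'| <= `|z - z'| * \int[P]_om B om.
  rewrite /mean_fe_at -RintegralB//; [|exact: integrable_fe..].
  have iD : P.-integrable setT (EFin \o (fun om =>
      free_energy (ham_at z om) - free_energy (ham_at z' om))).
    by apply: integrableB_EFin; exact: integrable_fe.
  apply: (le_trans (le_normr_Rintegral _ _)) => //.
  rewrite -RintegralZl//; apply: le_Rintegral => //.
  - exact: (integrable_norm iD).
  - exact: integrableZ_EFin.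
  - move=> om _; apply: free_energy_lip => sg.
    rewrite !ham_atE /ham opprD addrACA subrr add0r -!mulrBl normrM normrM.
    rewrite (ger0_norm (ltW strength_gt0)) -mulrA ler_wpM2l//.
    rewrite /B ler_wpM2l ?(ltW strength_gt0)//.
    by rewrite (bigD1 sg)//= lerDl sumr_ge0.
set C := \int[P]_om B om in C0 lip.
have C1 : 0 < C + 1 by rewrite ltr_wpDl.
move=> z; apply/cvgrPdist_lt => e e0; rewrite /prop_near1 /=.
have d0 : 0 < e / (C + 1) by exact: divr_gt0.
exists (e / (C + 1)) => //= z' zz'.
apply: (le_lt_trans (lip z z')).
apply: (@le_lt_trans _ _ (`|z - z'| * (C + 1))); first by rewrite ler_wpM2l// lerDl.
by rewrite -ltr_pdivlMr.
Qed.

Lemma gg_defect_le n (f : #|{: S * 'I_n * 'I_n}|.-tuple R -> R) (M z h : R) :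
  (2 <= n)%N -> (forall v, `|f v| <= M) -> 1 <= z <= 2 -> 0 < h < 1 ->
  gg_defect P spec (ham_at z) f (wof m) p <=
  M / (n%:R * h * c ^+ 2) *
    (2 + 4 * fluct_bound + (mean_fe_at (z + h) + mean_fe_at (z - h) - 2 * mean_fe_at z)).
Proof.
move=> n2 fM /andP[z1 z2] /andP[h0 h1].
have n0 : (0 < n)%N by exact: leq_trans n2.
pose l0 : 'I_n := Ordinal n0.
pose w_ := widen_ord (leqnSn n).
have wi : injective w_ by move=> i j /(congr1 val)/= ij; exact: val_inj.
have w0 : w_ l0 = ord0 by exact: val_inj.
pose F (t : {ffun 'I_n -> conf}) : R := f (overlap_array spec (fun i => t i)).
have FE (ss : {ffun 'I_n.+1 -> conf}) :
    f (overlap_array spec (fun i : 'I_n => ss (w_ i))) = F [ffun j => ss (w_ j)].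
  by rewrite /F; congr (f (overlap_array spec _)); apply/funext => i; rewrite ffunE.
have FM t : `|F t| <= M by exact: fM.
pose Q := covar (block m p) (amp spec wof).
have QE sg sg' : overlap_w spec (wof m) sg sg' ^+ p = Q sg sg'.
  by rewrite /Q /covar (covar_block spec HWsub).
have E z' : mean_fe_at z' = mean_fe P disorder rest (block m p) (amp spec wof) c z'.
  by apply: eq_Rintegral => om _; rewrite ham_atE.
have I z' : P.-integrable setT (EFin \o (fun om =>
    free_energy (ham rest (block m p) (amp spec wof) c z' (smp om)))).
  by apply: eq_integrable (integrable_fe K (upd x (m, p) z')) => // om _; rewrite /= -ham_atE.
have c0 := strength_gt0.
have nR0 : 0 < n%:R :> R by rewrite ltr0n.
have GG := ghirlanda_guerra_le measurable_disorder Hindep c block_valid (block_uniq _ _)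
  block_law measurable_rest rest_upd covar_diag_block z l0 FM.
have FL := @fluctuation_le _ _ _ _ _ _ _ measurable_disorder _ _ _ _ c block_valid
  block_law measurable_rest z h fluct_bound h0 c0.
set A := \int[P]_om avg1 _ _ in GG FL.
have {}FL : h * c * A <= 2 + 4 * fluct_bound +
    (mean_fe_at (z + h) + mean_fe_at (z - h) - 2 * mean_fe_at z).
  rewrite !E; apply: FL => z' z'in; split; first exact: I.
  have := ham_at_concentration (shift_range z1 z2 h0 h1 z'in); rewrite E; under eq_Rintegral do rewrite ham_atE.
  by [].
have M0 : 0 <= M by exact: le_trans (normr_ge0 _) (FM [ffun=> [ffun=> true]]).
have -> : gg_defect P spec (ham_at z) f (wof m) p = n%:R^-1 *
  `|\sum_(l | l != l0)
        \int[P]_om gibbs_avg (ham rest (block m p) (amp spec wof) c z (smp om)) (fun ss => F ss * Q (ss l0) (ss l))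
     - n%:R * \int[P]_om gibbs_avg (ham rest (block m p) (amp spec wof) c z (smp om)) (fun ss : {ffun 'I_n.+1 -> conf} =>
       F [ffun j => ss (w_ j)] * Q (ss (w_ l0)) (ss ord_max))
     + mean_overlap P disorder rest (block m p) (amp spec wof) c z *
       \int[P]_om gibbs_avg (ham rest (block m p) (amp spec wof) c z (smp om)) F|.
  (* The expression inside [gg_defect] is [- n%:R^-1] times the one of [ghirlanda_guerra_le], hence
     the change of sign under the norm. *)
  rewrite -[n%:R^-1](ger0_norm (ltW _)) ?invr_gt0// -normrM -normrN /gg_defect.
  congr `|_|; rewrite mulrDr mulrBr !mulrA mulVf ?gt_eqF// mul1r.
  have T1 : \int[P]_om gibbs_avg (ham_at z om) (fun ss : {ffun 'I_n.+1 -> conf} =>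
        f (overlap_array spec (fun i : 'I_n => ss (widen_ord (leqnSn n) i))) *
        overlap_w spec (wof m) (ss ord0) (ss ord_max) ^+ p) =
      \int[P]_om gibbs_avg (ham rest (block m p) (amp spec wof) c z (smp om))
       (fun ss : {ffun 'I_n.+1 -> conf} =>
         F [ffun j => ss (w_ j)] * Q (ss (w_ l0)) (ss ord_max)).
    apply: eq_Rintegral => om _; rewrite ham_atE; apply: eq_bigr => ss _.
    by rewrite FE QE w0.
  have T2 : \int[P]_om gibbs_avg (ham_at z om) (fun ss : {ffun 'I_n.+1 -> conf} =>
        f (overlap_array spec (fun i : 'I_n => ss (widen_ord (leqnSn n) i)))) =
      \int[P]_om gibbs_avg (ham rest (block m p) (amp spec wof) c z (smp om)) F.
    apply: eq_Rintegral => om _; rewrite ham_atE -[RHS](gibbs_avg_reindex _ _ wi).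
    by apply: eq_bigr => ss _; rewrite FE.
  have T3 : \int[P]_om gibbs_avg (ham_at z om) (fun ss : {ffun 'I_n.+1 -> conf} =>
        overlap_w spec (wof m) (ss ord0) (ss (inord 1)) ^+ p) =
      mean_overlap P disorder rest (block m p) (amp spec wof) c z.
    apply: eq_Rintegral => om _; rewrite ham_atE.
    have n3 : (2 <= n.+1)%N by exact: leqW.
    have hi : injective (widen_ord n3) by move=> i j /(congr1 val)/= ij; exact: val_inj.
    rewrite -[RHS](gibbs_avg_reindex _ _ hi); apply: eq_bigr => ss _; congr (_ * _).
    rewrite QE !ffunE; congr (Q (ss _) (ss _)); first exact: val_inj.
    by apply: val_inj; rewrite /= inordK.
  have T4 l : (1 <= l < n)%N -> \int[P]_om gibbs_avg (ham_at z om) (fun ss : {ffun 'I_n.+1 -> conf} =>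
        f (overlap_array spec (fun i : 'I_n => ss (widen_ord (leqnSn n) i))) *
        overlap_w spec (wof m) (ss ord0) (ss (inord l)) ^+ p) =
      \int[P]_om gibbs_avg (ham rest (block m p) (amp spec wof) c z (smp om))
        (fun ss => F ss * Q (ss l0) (ss (insubd l0 l))).
    move=> /andP[l1 ln]; apply: eq_Rintegral => om _; rewrite ham_atE.
    rewrite -[RHS](gibbs_avg_reindex _ _ wi); apply: eq_bigr => ss _; congr (_ * _).
    rewrite FE QE !ffunE w0; congr (_ * Q _ (ss _)).
    by apply: val_inj; rewrite /= inordK ?(ltnW ln)// ?ltnS ?(ltnW ln)// val_insubd ln.
  rewrite T1 T2 T3 (eq_big_nat _ _ T4).
  (* The naturals [1 <= l < n] are the ordinals other than [l0 = 0]; [insubd] never returns its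
     default, since [l < n]. *)
  have -> : \sum_(1 <= l < n) \int[P]_om gibbs_avg (ham rest (block m p) (amp spec wof) c z (smp om))
        (fun ss => F ss * Q (ss l0) (ss (insubd l0 l))) =
     \sum_(l | l != l0) \int[P]_om gibbs_avg (ham rest (block m p) (amp spec wof) c z (smp om))
        (fun ss => F ss * Q (ss l0) (ss l)).
    pose T l := \int[P]_om gibbs_avg (ham rest (block m p) (amp spec wof) c z (smp om))
        (fun ss => F ss * Q (ss l0) (ss l)).
    rewrite -/(T _) [RHS](eq_big (fun l : 'I_n => (l : nat) != 0%N)
      (fun l => T (insubd l0 (val l)))); last 2 first.
    - by move=> l; rewrite -val_eqE.
    - by move=> l _; rewrite valKd.
    rewrite -(big_mkord (fun l => l != 0%N) (fun l => T (insubd l0 l))).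
    rewrite big_ltn_cond//= [RHS]big_nat_cond [LHS]big_nat_cond.
    by apply: eq_bigl => l; case: l.
  ring.
have cz : `|z * c| = z * c by rewrite ger0_norm// mulr_ge0 ?(ltW c0)// (le_trans ler01).
rewrite cz -/Q -/w_ in GG.
set B := `|_| in GG *.
have B0 : 0 <= B by exact: normr_ge0.
(* The factor [z] is dropped because [z >= 1]. *)
have cB : c * B <= M * A.
  apply: le_trans GG; rewrite ler_wpM2r// ler_peMl// ltW//.
exact: (@defect_rescale _ n%:R h c M _ B A).
Qed.

End fixed_level.
End finite_volume.

(** * Passing to the limit *)

(* Off the convergence set, [limn] is the junk value [point]. *)
Lemma measurable_limn {R : realType} {d} {T : measurableType d} (u : nat -> T -> R) :
  (forall n, measurable_fun setT (u n)) ->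
  measurable_fun setT (fun t => limn (u ^~ t)).
Proof.
move=> mu.
(* The convergence set as the Cauchy criterion with countable quantifiers, hence measurable. *)
pose C := \bigcap_(k in [set: nat]) \bigcup_(n in [set: nat]) \bigcap_(m in [set: nat])
  [set t | `|u (n + m)%N t - u n t| <= k.+1%:R^-1].
have mC : measurable C.
  apply: bigcap_measurableType => k _; apply: bigcup_measurable => n _.
  apply: bigcap_measurableType => m _; rewrite -[X in measurable X]setTI.
  apply: measurable_fun_le => //; apply: measurableT_comp => //; exact: measurable_funB.
have CE t : C t <-> cvgn (u ^~ t).
  split=> [Ct|/cvg_ex[l ul] k _].
    apply/cauchy_cvgP/cauchy_exP => e e0.
    have [k _ kn] := near_infty_natSinv_lt (PosNum e0).
    have [n _ h] := Ct k I; exists (u n t); exists n => // m /= nm.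
    rewrite /ball /= distrC -(subnKC nm) (le_lt_trans (h (m - n)%N I))//.
    exact: (kn k (leqnn _)).
  have e0 : 0 < k.+1%:R^-1 / 2 :> R by rewrite divr_gt0.
  move/cvgrPdist_lt : ul => /(_ _ e0)[n _ h]; exists n => // m _ /=.
  have h1 := h (n + m)%N (leq_addr _ _); have h2 := h n (leqnn _).
  rewrite (splitr k.+1%:R^-1) (le_trans (ler_distD l _ _))//.
  by rewrite lerD// ltW// distrC.
pose v n t := if t \in C then u n t else point.
apply: (@measurable_fun_cvg _ T R setT v).
  move=> n; apply: measurable_fun_ifT => //.
  apply: (measurable_fun_bool true); rewrite setTI (_ : _ @^-1` _ = C)//.
  by apply/seteqP; split => t /= tC; [exact: set_mem tC|exact: mem_set].
move=> t _; rewrite /v; case: (boolP (t \in C)) => tC /=.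
  by move: tC; rewrite inE => /CE.
have -> : limn (u ^~ t) = point.
  by apply: dvgP => /CE Ct; move: tC; rewrite notin_setE; apply.
exact: cvg_cst.
Qed.

Lemma cvg_Rintegral_bounded {R : realType} {d} {T : measurableType d}
    (P : probability T R) (u : nat -> T -> R) (v : T -> R) (M : R) :
  (forall n, measurable_fun setT (u n)) -> measurable_fun setT v ->
  (forall n t, `|u n t| <= M) ->
  {ae P, forall t, u ^~ t @ \oo --> v t} ->
  (fun n => \int[P]_t u n t) @ \oo --> \int[P]_t v t.
Proof.
move=> mu mv uM uv.
have [|||||iv _ cv] := @dominated_convergence _ _ _ P setT measurableT
  (fun n t => (u n t)%:E) (fun t => (v t)%:E) (fun=> M%:E).
- by move=> n; apply/measurable_EFinP.
- exact/measurable_EFinP.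
- by apply: filterS uv => t ut _; apply: cvg_EFin; [exact: nearW|exact: ut].
- exact: integrable_prob_cst.
- by apply/aeW => t n _; rewrite lee_fin.
by apply: fine_cvg; rewrite fineK//; exact: integrable_fin_num.
Qed.

(** By monotone convergence the limit in the extended reals has a finite integral, so it is finite
    almost everywhere. *)
Lemma ae_cvg_nondecreasing {R : realType} {d} {T : measurableType d}
    (P : probability T R) (Y : nat -> T -> R) (C : R) :
  (forall n, measurable_fun setT (Y n)) -> (forall n t, 0 <= Y n t) ->
  (forall t, nondecreasing_seq (Y ^~ t)) ->
  (forall n, (\int[P]_t (Y n t)%:E <= C%:E)%E) ->
  {ae P, forall t, cvgn (Y ^~ t)}.
Proof.
move=> mY Y0 ndY YC.
pose L t := limn (fun n => (Y n t)%:E).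
have ndE t : nondecreasing_seq (fun n => (Y n t)%:E).
  by move=> n m nm; rewrite lee_fin; exact: ndY.
have cE t : (fun n => (Y n t)%:E) @ \oo --> L t.
  exact: ereal_nondecreasing_is_cvgn.
have mL : measurable_fun setT L.
  apply: (@emeasurable_fun_cvg _ _ _ _ (fun n t => (Y n t)%:E)) => //.
  by move=> n; exact/measurable_EFinP.
have L0 t : (0 <= L t)%E.
  apply: lime_ge; first exact: cvgP (cE t).
  by apply: nearW => n; rewrite lee_fin.
have LC : (\int[P]_t L t <= C%:E)%E.
  rewrite monotone_convergence//; last 2 first.
  - by move=> n; exact/measurable_EFinP.
  - by move=> n t _; rewrite lee_fin.
  apply: lime_le; last by apply: nearW.
  apply: ereal_nondecreasing_is_cvgn => n m nm; apply: ge0_le_integral => //.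
  - by move=> t _; rewrite lee_fin.
  - exact/measurable_EFinP.
  - exact/measurable_EFinP.
  - by move=> t _; rewrite lee_fin; exact: ndY.
have iL : P.-integrable setT L.
  apply/integrableP; split => //; under eq_integral do rewrite gee0_abs//.
  exact: le_lt_trans LC (ltry _).
apply: filterS (integrable_ae measurableT iL) => t /(_ I) Lt.
apply: nondecreasing_is_cvgn => //; exists (fine (L t)) => _ [n _ <-].
rewrite -lee_fin fineK//; have := ereal_nondecreasing_cvgn (ndE t).
move=> /cvg_lim; rewrite -/(L t) => ->//.
by apply: ereal_sup_ubound; exists n.
Qed.

(** The truncation of [h_N]: both indices are cut at the same [K]. *)
Definition square_sum {R : realType} (a : nat -> nat -> R) (K : nat) : R :=
  \sum_(m < K) \sum_(1 <= q < K) a m q.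

Lemma square_sum_nondecreasing {R : realType} (a : nat -> nat -> R) :
  (forall m q, 0 <= a m q) -> nondecreasing_seq (square_sum a).
Proof.
move=> a0; apply/nondecreasing_seqP => K; rewrite /square_sum big_ord_recr /=.
rewrite ler_wpDr//; first exact: sumr_ge0.
apply: ler_sum => m _; case: K m => [[//]|K m].
by rewrite [leRHS]big_nat_recr//= lerDl.
Qed.

(* [a + 2 b] is nonnegative, so its square sums are monotone. *)
Lemma is_cvg_square_sum {R : realType} (a b : nat -> nat -> R) :
  (forall m q, `|a m q| <= 2 * b m q) ->
  cvgn (square_sum b) -> cvgn (square_sum a).
Proof.
move=> ab cb.
have b0 m q : 0 <= 2 * b m q by exact: le_trans (ab m q).
pose c m q := a m q + 2 * b m q.
have cE : square_sum a = square_sum c \- (fun K => 2 * square_sum b K).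
  apply/funext => K /=; rewrite /square_sum mulr_sumr -sumrB; apply: eq_bigr => m _.
  rewrite mulr_sumr -sumrB; apply: eq_bigr => q _; by rewrite /c addrK.
have c2 : cvgn (fun K => 2 * square_sum b K) by apply: is_cvgM => //; exact: is_cvg_cst.
rewrite cE; apply: is_cvgB => //; apply: nondecreasing_is_cvgn.
  apply: square_sum_nondecreasing => m q; have := ab m q; rewrite ler_norml /c; lra.
exists (2 * limn (square_sum b) * 2) => _ [K _ <-].
have bK : square_sum b K <= limn (square_sum b).
  apply: nondecreasing_cvgn_le => //; apply: square_sum_nondecreasing => m q.
  by have := b0 m q; lra.
apply: (@le_trans _ _ (4 * square_sum b K)); last lra.
rewrite /square_sum mulr_sumr; apply: ler_sum => m _.
rewrite mulr_sumr; apply: ler_sum => q _; have := ab m q; rewrite ler_norml /c; lra.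
Qed.

Lemma cvg_sum_seq {R : realType} {I : Type} (r : seq I) (u : I -> nat -> R) (l : I -> R) :
  (forall i, u i @ \oo --> l i) ->
  (fun k => \sum_(i <- r) u i k) @ \oo --> \sum_(i <- r) l i.
Proof.
move=> ul; elim: r => [|i r IH].
  by rewrite big_nil; under eq_fun do rewrite big_nil; exact: cvg_cst.
by rewrite big_cons; under eq_fun do rewrite big_cons; exact: cvgD.
Qed.

Lemma cvg_prod_seq {R : realType} {I : Type} (r : seq I) (u : I -> nat -> R) (l : I -> R) :
  (forall i, u i @ \oo --> l i) ->
  (fun k => \prod_(i <- r) u i k) @ \oo --> \prod_(i <- r) l i.
Proof.
move=> ul; elim: r => [|i r IH].
  by rewrite big_nil; under eq_fun do rewrite big_nil; exact: cvg_cst.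
by rewrite big_cons; under eq_fun do rewrite big_cons; exact: cvgM.
Qed.

Section gg_defect.
Context {R : realType} {S : finType} {N : nat} (spec : 'I_N -> S).
Context {d} {Om : measurableType d} (P : probability Om R).
Variables (n : nat) (f : #|{: S * 'I_n * 'I_n}|.-tuple R -> R) (w : S -> R) (p : nat).
Local Notation conf := {ffun 'I_N -> bool}.

Lemma measurable_gg_defect {d'} {T : measurableType d'} (H : T * Om -> conf -> R) :
  (forall sg, measurable_fun setT (H ^~ sg)) ->
  measurable_fun setT (fun t => gg_defect P spec (fun om => H (t, om)) f w p).
Proof.
move=> mH.
have mE (F : {ffun 'I_n.+1 -> conf} -> R) :
    measurable_fun setT (fun t => \int[P]_om gibbs_avg (H (t, om)) F).
  apply: (@measurable_fun_Rintegral _ _ _ _ _ P (fun z => gibbs_avg (H z) F)).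
  by apply: measurable_gibbs_avg.
apply: measurableT_comp => //; apply: measurable_funB.
  apply: measurable_funB => //; apply: measurable_funM => //.
  by apply: measurable_funM.
by apply: measurable_funM => //; apply: measurable_sum_seq.
Qed.

(** At fixed [N] a Gibbs average is a finite sum in which only the weights vary. They are continuous
    in finitely many energies, and the averages are bounded uniformly in [k]. *)
Lemma gg_defect_cvg (Hk : nat -> Om -> conf -> R) (H : Om -> conf -> R) :
  (forall k sg, measurable_fun setT ((Hk k) ^~ sg)) ->
  (forall sg, measurable_fun setT (H ^~ sg)) ->
  {ae P, forall om, forall sg, (fun k => Hk k om sg) @ \oo --> H om sg} ->
  (fun k => gg_defect P spec (Hk k) f w p) @ \oo --> gg_defect P spec H f w p.
Proof.
move=> mHk mH HkH.
have cE (F : {ffun 'I_n.+1 -> conf} -> R) :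
    (fun k => \int[P]_om gibbs_avg (Hk k om) F) @ \oo --> \int[P]_om gibbs_avg (H om) F.
  apply: (@cvg_Rintegral_bounded _ _ _ _ _ _ (\sum_ss `|F ss|)).
  - by move=> k; apply: measurable_gibbs_avg.
  - exact: measurable_gibbs_avg.
  - move=> k om; apply: gibbs_avg_bound => ss.
    by rewrite (bigD1 ss)//= lerDl sumr_ge0.
  apply: filterS HkH => om Hom; apply: cvg_sum_seq => ss; apply: cvgM; last exact: cvg_cst.
  apply: cvg_prod_seq => l; apply: cvgM.
    exact: (cvg_comp _ _ (Hom _) (@continuous_expR R _)).
  apply: cvgV; first by rewrite gt_eqF//; exact: partition_fun_gt0.
  by apply: cvg_sum_seq => s; exact: (cvg_comp _ _ (Hom _) (@continuous_expR R _)).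
apply: cvg_norm; apply: cvgB; last first.
  by apply: cvgM; [exact: cvg_cst|apply: cvg_sum_seq => l].
by apply: cvgB => //; apply: cvgM => //; apply: cvgM => //; exact: cvg_cst.
Qed.

(** Each of the three terms is at most [M]; this constant dominates the limit under the average over
    the parameters. *)
Lemma gg_defect_bound (H : Om -> conf -> R) (M : R) : 
  (forall sg, measurable_fun setT (H ^~ sg)) ->
  (forall v, `|f v| <= M) -> (forall s1 s2, `|overlap_w spec w s1 s2| <= 1) ->
  gg_defect P spec H f w p <= 3 * M.
Proof.
move=> mH fM w1.
have M0 : 0 <= M by exact: le_trans (normr_ge0 _) (fM [tuple of nseq _ 0]).
have EM (F : {ffun 'I_n.+1 -> conf} -> R) B : (forall ss, `|F ss| <= B) ->
    `|\int[P]_om gibbs_avg (H om) F| <= B.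
  move=> FB; have mF : measurable_fun setT (fun om => gibbs_avg (H om) F).
    exact: measurable_gibbs_avg.
  have iF : P.-integrable setT (EFin \o (fun om => gibbs_avg (H om) F)).
    by apply: (@integrable_bounded _ _ _ P _ B mF) => om; exact: gibbs_avg_bound.
  apply: (le_trans (le_normr_Rintegral _ _)) => //.
  rewrite -[leRHS](Rintegral_prob_cst P); apply: le_Rintegral => //.
  - exact: (integrable_norm iF).
  - exact: integrable_prob_cst.
  - by move=> om _; exact: gibbs_avg_bound.
have wp s1 s2 : `|overlap_w spec w s1 s2 ^+ p| <= 1 by rewrite normrX exprn_ile1.
have fwp v s1 s2 : `|f v * overlap_w spec w s1 s2 ^+ p| <= M.
  by rewrite normrM -[leRHS]mulr1 ler_pM.
have n1 : n%:R^-1 <= (1 : R).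
  have [n0|n0] := posnP n; last by rewrite invf_le1 ?ltr0n// ler1n.
  by rewrite (_ : n%:R = 0 :> R) ?invr0 ?ler01// n0.
have n1' : 0 <= n%:R^-1 :> R by rewrite invr_ge0.
have -> : 3 * M = M + M + M by ring.
rewrite /gg_defect (le_trans (ler_normB _ _))// lerD//.
  rewrite (le_trans (ler_normB _ _))// lerD//; first exact: EM.
  rewrite normrM -[leRHS]mulr1 ler_pM//; last exact: EM.
  rewrite normrM ger0_norm//.
  rewrite -[leRHS]mul1r ler_pM//; exact: EM.
rewrite normrM ger0_norm//.
apply: (@le_trans _ _ (n%:R^-1 * (n%:R * M))); last first.
  have [->|n0] := eqVneq n 0%N; first by rewrite invr0 mul0r.
  by rewrite mulrA mulVf ?mul1r ?pnatr_eq0.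
rewrite ler_wpM2l ?invr_ge0// (le_trans (ler_norm_sum _ _ _))//.
apply: (@le_trans _ _ (\sum_(1 <= l < n) M)); first by apply: ler_sum => l _; exact: EM.
rewrite sumr_const_nat -[leLHS]mulr_natl ler_wpM2r// ler_nat leq_subr//.
Qed.

End gg_defect.

(** * Almost sure convergence of the perturbation *)

Section perturbation_series.
Context {R : realType} {S : finType} {N : nat}.
Variables (spec : 'I_N -> S) (J : set nat) (wof : nat -> S -> R).
Hypothesis HWsub : forall m, J m -> forall s, 0 <= wof m s <= 1.
Hypothesis N0 : (0 < N)%N.
Local Notation conf := {ffun 'I_N -> bool}.

Lemma measurable_H_SK {d} {T : measurableType d} (g : T -> 'I_N -> 'I_N -> R) (sg : conf) :
  (forall i j, measurable_fun setT (fun t => g t i j)) ->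
  measurable_fun setT (fun t => H_SK (g t) sg).
Proof.
move=> mg; apply: measurable_funM => //; apply: measurable_sum_seq => i _.
apply: measurable_sum_seq => j _; apply: measurable_funM => //.
exact: measurable_funM.
Qed.

Lemma measurable_h_wp {d} {T : measurableType d} (g : T -> seq 'I_N -> R)
    (m q : nat) (sg : conf) : (1 <= q)%N ->
  (forall t : seq 'I_N, (1 <= size t)%N -> measurable_fun setT (g ^~ t)) ->
  measurable_fun setT (fun t => h_wp spec (wof m) q (g t) sg).
Proof.
move=> q1 mg; under eq_fun do rewrite h_wpE.
apply: measurable_sum_seq => u _; apply: measurable_funM => //.
by apply: mg; rewrite size_tuple.
Qed.

Lemma measurable_pert_trunc {d} {T : measurableType d} (x : T -> nat * nat -> R)
    (g : T -> nat -> seq 'I_N -> R) (K : nat) (sg : conf) :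
  (forall m q, J m -> (1 <= q)%N -> measurable_fun setT (x ^~ (m, q))) ->
  (forall m (t : seq 'I_N), J m -> (1 <= size t)%N ->
    measurable_fun setT (fun u => g u m t)) ->
  measurable_fun setT (fun t => pert_trunc spec J wof K (x t) (g t) sg).
Proof.
move=> mx mg; apply: measurable_sum_seq => m _.
apply: measurable_sum_seq => q; rewrite mem_index_iota => /andP[q1 _].
case: asboolP => Jm //; apply: measurable_funM.
  by apply: measurable_funM => //; exact: mx.
by apply: measurable_h_wp => // t t1; exact: mg.
Qed.

Context {d} {Om : measurableType d} (P : probability Om R).
Variable gP : nat -> seq 'I_N -> Om -> R.
Hypothesis HgP : forall m (t : seq 'I_N), J m -> (1 <= size t)%N ->
  centered_gaussian P (gP m t) 1.
Local Notation G := (fun mt : nat * seq 'I_N => gP mt.1 mt.2).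
Local Notation D := [set mt : nat * seq 'I_N | J mt.1 /\ (1 <= size mt.2)%N].
Hypothesis indG : mutually_independent P D G.

(** Gaussian integration by parts with the constant function 1. *)
Lemma gaussian_mean0 m (t : seq 'I_N) : J m -> (1 <= size t)%N ->
  \int[P]_om gP m t om = 0.
Proof.
move=> Jm t1; have [mX [_ lawX]] := HgP Jm t1.
have {}lawX B : measurable B -> P (gP m t @^-1` B) = normal_prob 0 1 B.
  by move=> mB; rewrite lawX ?sqrtr1// oner_eq0.
have d1 (z : R) : is_derive z 1 (cst 1 : R -> R) 0 by exact: is_derive_cst.
have := @normal_parts R 1 ltr01 _ _ P _ mX lawX (cst 1) (cst 0) 1 d1.
move=> /(_ (fun z => cvg_cst _)) /= h.
have {h} : \int[P]_om (gP m t om * 1) = 1 ^+ 2 * \int[P]_om 0.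
  by apply: h => z; rewrite ?normr1 ?normr0.
by rewrite Rintegral_prob_cst mulr0 => <-; apply: eq_Rintegral => om _; rewrite mulr1.
Qed.

(** The field is centered, and [efron_stein] bounds its variance by the sum of squared amplitudes,
    which is a power of the self-overlap R_w, at most 1. *)
Lemma h_wp_abs_moment m q (sg : conf) : J m -> (1 <= q)%N ->
  (\int[P]_om `|h_wp spec (wof m) q (fun t => gP m t om) sg|%:E <= 1)%E.
Proof.
move=> Jm q1.
have mG k : D k -> measurable_fun setT (G k).
  by move=> [Jk k1]; have [] := HgP Jk k1.
pose s := [seq (m, val t) | t <- enum {: q.-tuple 'I_N}].
have sD k : k \in s -> D k.
  by move=> /mapP[t _ ->]; split => //=; rewrite size_tuple.
pose F (y : @coord_space R _ D) := \sum_(k <- s) amplitude spec wof k.1 k.2 sg * y k.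
have su : uniq s by rewrite map_inj_uniq ?enum_uniq// => t t' [tt']; exact: val_inj.
have hE om : h_wp spec (wof m) q (fun t => gP m t om) sg = F (sample D G om).
  by rewrite h_wpE /F big_map big_enum.
have [||||iF vF] := @efron_stein _ _ _ _ _ P G mG indG s
    (fun k => `|amplitude spec wof k.1 k.2 sg|) (fun=> 1) F sD.
- apply: measurable_sum_seq => k /sD Dk; apply: measurable_funM => //.
  exact: measurable_coord.
- by move=> y y' yy'; rewrite /F big_seq [RHS]big_seq; apply: eq_bigr => k /yy' ->.
- move=> k ks y z z'; rewrite /F -sumrB (bigD1_seq k)//= big1 ?addr0; last first.
    by move=> i ik; rewrite !upd_neq// subrr.
  by rewrite !updE -mulrBr normrM.
- move=> k /sD[Jk k1]; exact: centered_gaussian_second_moment ler01 (HgP Jk k1).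
have iGk k : k \in s -> P.-integrable setT (EFin \o (G k)).
  move=> ks; have mk := mG _ (sD _ ks); apply: integrable_of_sqr => //.
  apply: (integrable_sqr_ltoo mk (c := 1)); have [Jk k1] := sD _ ks.
  exact: centered_gaussian_second_moment ler01 (HgP Jk k1).
have F0 : \int[P]_om F (sample D G om) = 0.
  rewrite /F; under eq_Rintegral do rewrite big_seq.
  rewrite Rintegral_sum; last first.
    by move=> k ks; apply: integrableZ_EFin; exact: iGk.
  rewrite big1// => k ks; rewrite RintegralZl//; last exact: iGk.
  by have [Jk k1] := sD _ ks; rewrite gaussian_mean0 ?mulr0.
have var1 : \sum_(k <- s) `|amplitude spec wof k.1 k.2 sg| ^+ 2 * 1 <= 1.
  have := covar_block spec HWsub q sg sg N0 Jm.
  rewrite !big_map /= => h; under eq_bigr do rewrite mulr1 real_normK ?num_real// expr2.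
  rewrite h (le_trans (ler_norm _))// normrX exprn_ile1//.
  exact: (normr_overlap_w spec HWsub).
have mF : measurable_fun setT (fun om => F (sample D G om)).
  by apply/measurable_EFinP; exact: measurable_int iF.
have i2 : (\int[P]_om (F (sample D G om) ^+ 2)%:E <= (1 ^+ 2)%:E)%E.
  move: vF; under eq_integral do rewrite F0 subr0.
  by move=> /le_trans; apply; rewrite lee_fin expr1n.
under eq_integral do rewrite hE.
rewrite -EFin_Rintegral ?lee_fin; last exact: (integrable_norm iF).
exact: Rintegral_normr_le.
Qed.

(** The exceptional set must serve all parameters at once, so convergence is proved for the series
    of [2 ^- (m + q)] times absolute values of the fields. It does not contain [x], and twice it
    dominates every admissible series. *)
Lemma ae_pert_trunc_cvg : {ae P, forall om, forall (x : nat * nat -> R),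
  (forall m q, J m -> (1 <= q)%N -> `|x (m, q)| <= 2) -> forall sg : conf,
  cvgn (fun K => pert_trunc spec J wof K x (fun m t => gP m t om) sg)}.
Proof.
pose b sg om m q := if `[< J m >] && (1 <= q)%N
  then 2 ^- (m + q) * `|h_wp spec (wof m) q (fun t => gP m t om) sg| else 0.
have b0 sg om m q : 0 <= b sg om m q.
  by rewrite /b; case: ifP => // _; rewrite mulr_ge0 ?invr_ge0 ?exprn_ge0.
have mb sg m q : measurable_fun setT (fun om => b sg om m q).
  rewrite /b; case: (boolP (`[< J m >] && (1 <= q)%N)) => //= /andP[/asboolP Jm q1].
  apply: measurable_funM => //.
  apply: measurableT_comp => //.
  apply: (measurable_h_wp (g := fun om t => gP m t om)) => // t t1.
  by have [] := HgP Jm t1.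
have bc : {ae P, forall om, forall sg, cvgn (square_sum (b sg om))}.
  apply: filter_forall => sg.
  (* The bound 2 is the product of the bounds 2 and 1 on the geometric sums over [m] and [q]. *)
  apply: (@ae_cvg_nondecreasing _ _ _ P (fun K om => square_sum (b sg om) K) 2).
  - move=> K; apply: measurable_sum_seq => m _; apply: measurable_sum_seq => q _.
    exact: mb.
  - by move=> K om; apply: sumr_ge0 => m _; apply: sumr_ge0 => q _.
  - by move=> om; exact: square_sum_nondecreasing.
  move=> K; rewrite /square_sum.
  under eq_integral do rewrite -sumEFin.
  rewrite ge0_integral_sum//; last 2 first.
  - move=> m; apply/measurable_EFinP; apply: measurable_sum_seq => q _; exact: mb.
  - by move=> m om _; rewrite lee_fin; apply: sumr_ge0.
  apply: (@le_trans _ _ (\sum_(m < K) (2 ^- m)%:E)%E).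
    apply: lee_sum => m _; under eq_integral do rewrite -sumEFin.
    rewrite ge0_integral_sum//; last 2 first.
    - by move=> q; apply/measurable_EFinP; exact: mb.
    - by move=> q om _; rewrite lee_fin.
    apply: (@le_trans _ _ (\sum_(1 <= q < K) (2 ^- (m + q))%:E)%E).
      apply: lee_sum => q _; rewrite /b.
      case: (boolP (`[< J m >] && (1 <= q)%N)) => [/andP[/asboolP Jm q1]|_].
        under eq_integral do rewrite EFinM.
        have mh : measurable_fun setT (fun om =>
            `|h_wp spec (wof m) q (fun t => gP m t om) sg|%:E).
          apply/measurable_EFinP; apply: measurableT_comp => //.
          apply: (measurable_h_wp (g := fun om t => gP m t om)) => // t t1.
          by have [] := HgP Jm t1.
        rewrite ge0_integralZl//.
        rewrite -[leRHS]mule1 lee_wpmul2l ?lee_fin ?invr_ge0 ?exprn_ge0//.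
        exact: h_wp_abs_moment.
      by rewrite integral0 lee_fin invr_ge0 exprn_ge0.
    rewrite sumEFin lee_fin -[leRHS]mulr1.
    under eq_bigr do rewrite exprD invfM.
    by rewrite -mulr_sumr ler_wpM2l ?invr_ge0 ?exprn_ge0// sum_half_pow1.
  rewrite sumEFin lee_fin.
  by have := @sum_half_pow R K; rewrite -[in iota _ _](subn0 K) -/(index_iota 0 K) big_mkord.
apply: filterS bc => om cb x x2 sg.
pose a m q := if `[< J m >] && (1 <= q)%N
  then 2 ^- (m + q) * x (m, q) * h_wp spec (wof m) q (fun t => gP m t om) sg else 0.
have -> : (fun K => pert_trunc spec J wof K x (fun m t => gP m t om) sg) = square_sum a.
  apply/funext => K; apply: eq_bigr => m _; apply: eq_big_nat => q /andP[q1 _].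
  by rewrite /a q1 andbT.
apply: (is_cvg_square_sum _ (cb sg)) => m q; rewrite /a /b.
case: ifPn => [/andP[/asboolP Jm q1]|_]; last by rewrite normr0 mulr0.
set u : R := 2 ^- (m + q); set H := h_wp _ _ _ _ _.
have u0 : 0 <= u by rewrite invr_ge0 exprn_ge0.
rewrite 2!normrM (ger0_norm u0) (_ : 2 * (u * `|H|) = u * 2 * `|H|); last by ring.
by rewrite ler_wpM2r// ler_wpM2l// x2.
Qed.

End perturbation_series.

(** * Averaging over the perturbation parameters *)

Lemma measurable_resample_integral {R : realType} {I : choiceType} (D : set I)
    {d} {Om : measurableType d} (P : probability Om R) (G : I -> Om -> R)
    (mG : forall i, D i -> measurable_fun setT (G i)) (k : I) (Dk : D k)
    (F : @coord_space R I D -> \bar R) : measurable_fun setT F -> (forall t, 0 <= F t)%E ->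
  measurable_fun setT
    (fun om => \int[P]_om' F (upd (sample D G om) k (G k om')))%E.
Proof.
move=> mF F0.
have mFr : measurable_fun setT (F \o resampled D G k).
  exact: measurableT_comp mF (measurable_resampled mG Dk).
exact: (@measurable_fun_fubini_tonelli_F _ _ _ _ _ P _ mFr (fun z => F0 _)).
Qed.

Lemma uniform12_ge0_integral {R : realType} {d} {T : measurableType d}
    (P : probability T R) (X : T -> R) (f : R -> \bar R) : uniform12 P X ->
  measurable_fun setT f -> (forall z, 0 <= f z)%E ->
  (\int[P]_t f (X t) = \int[lebesgue_measure]_(z in `[1%R, 2%R]) f z)%E.
Proof.
move=> [mX lawX] mf f0.
have := @ge0_integral_pushforward _ _ _ (measurableTypeR R) _ _ mX P setT f measurableT mf (fun z _ => f0 z).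
rewrite preimage_setT => <-.
rewrite (eq_measure_integral (uniform_prob (@lt12 R))); last first.
  by move=> B mB _; exact: lawX.
rewrite integral_uniform//.
by rewrite (_ : 2 - 1 = 1 :> R) ?invr1 ?mul1e//; ring.
Qed.

Lemma uniform12_ae {R : realType} {d} {T : measurableType d}
    (P : probability T R) (X : T -> R) : uniform12 P X ->
  {ae P, forall t, 1 <= X t <= 2}.
Proof.
move=> [mX lawX].
have mA : measurable (X @^-1` `[1, 2]).
  by rewrite -[Y in measurable Y]setTI; exact: mX.
exists (~` (X @^-1` `[1, 2])); split; first exact: measurableC.
  have PA : P (X @^-1` `[1, 2]) = 1%E.
    by rewrite lawX// /uniform_prob integral_uniform_pdf1// lt12.
  by have := probability_setC P mA; rewrite PA subee.
by move=> t /=; apply: contra_not; rewrite in_itv/=.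
Qed.

Section averaged.
Context {R : realType} {S : finType} {N : nat}.
Variables (spec : 'I_N -> S) (J : set nat) (wof : nat -> S -> R) (gamma : R).
Variable Delta2 : S -> S -> R.
Hypothesis HD2pos : forall s t, 0 <= Delta2 s t.
Hypothesis HWsub : forall m, J m -> forall s, 0 <= wof m s <= 1.
Hypothesis N0 : (0 < N)%N.
Hypothesis gamma_range : 0 <= gamma <= 1 / 2.
Context {d} {Om : measurableType d} (P : probability Om R).
Variables (gSK : 'I_N -> 'I_N -> Om -> R) (gP : nat -> seq 'I_N -> Om -> R).
Local Notation conf := {ffun 'I_N -> bool}.
Hypothesis HgSK : forall i j, centered_gaussian P (gSK i j) (Delta2 (spec i) (spec j)).
Hypothesis HgP : forall m (t : seq 'I_N), J m -> (1 <= size t)%N ->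
  centered_gaussian P (gP m t) 1.
Hypothesis Hindep : mutually_independent P (@valid N J) (disorder gSK gP).
Context {dx} {Omx : measurableType dx} (Px : probability Omx R).
Variable X : nat -> nat -> Omx -> R.
Local Notation levels := [set mp : nat * nat | J mp.1 /\ (1 <= mp.2)%N].
Local Notation Xc := (fun mp : nat * nat => X mp.1 mp.2).
Hypothesis HX : forall m p, J m -> (1 <= p)%N -> uniform12 Px (X m p).
Hypothesis HXindep : mutually_independent Px levels Xc.
Variables (n : nat) (f : #|{: S * 'I_n * 'I_n}|.-tuple R -> R) (M : R).
Hypothesis n2 : (2 <= n)%N.
Hypothesis fM : forall v, `|f v| <= M.
Variables (m p : nat).
Hypotheses (Jm : J m) (p1 : (1 <= p)%N).

Local Notation Htr K x om :=
  (ham_trunc spec J wof gamma K x (fun i j => gSK i j om) (fun m t => gP m t om)).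
Local Notation c := (@strength R N gamma m p).
Local Notation V := (@fluct_bound R S N Delta2).

Definition gg_trunc (K : nat) (x : nat * nat -> R) : R :=
  gg_defect P spec (fun om => Htr K x om) f (wof m) p.

Let M0 : 0 <= M. Proof. exact: le_trans (normr_ge0 _) (fM [tuple of nseq _ 0]). Qed.

Lemma measurable_ham_trunc {d'} {T : measurableType d'} K (x : T -> nat * nat -> R)
    (om : T -> Om) (sg : conf) :
  (forall m q, J m -> (1 <= q)%N -> measurable_fun setT (x ^~ (m, q))) ->
  measurable_fun setT om ->
  measurable_fun setT (fun t => Htr K (x t) (om t) sg).
Proof.
move=> mx mom; apply: measurable_funD.
  apply: (measurable_H_SK (g := fun t i j => gSK i j (om t))) => i j.
  by apply: measurableT_comp => //; have [] := HgSK i j.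
apply: measurable_funM => //.
apply: (measurable_pert_trunc spec wof (x := x) (g := fun t m u => gP m u (om t))) => // m' t Jm' t1.
by apply: measurableT_comp => //; have [] := HgP Jm' t1.
Qed.

Lemma measurable_gg_trunc {d'} {T : measurableType d'} K (x : T -> nat * nat -> R) :
  (forall m q, J m -> (1 <= q)%N -> measurable_fun setT (x ^~ (m, q))) ->
  measurable_fun setT (fun t => gg_trunc K (x t)).
Proof.
move=> mx; apply: (measurable_gg_defect spec P f (wof m) p (H := fun z : T * Om => Htr K (x z.1) z.2)).
move=> sg; apply: (@measurable_ham_trunc _ _ K (fun z : T * Om => x z.1) snd) => //.
by move=> m' q Jm' q1; exact: measurableT_comp (mx _ _ Jm' q1) _.
Qed.

Lemma gg_trunc_ge0 K x : 0 <= gg_trunc K x.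
Proof. exact: normr_ge0. Qed.

(** The last term is [2 * h * B] with [B = 6 h c^2], the bound of [mean_fe_at_diff] for [z <= 3]. *)
Definition gg_bound (h : R) : R :=
  M / (n%:R * h * c ^+ 2) * (2 + 4 * V + 12 * h ^+ 2 * c ^+ 2).

Lemma gg_trunc_integral_le K h (x : nat * nat -> R) : (m < K)%N -> (p < K)%N ->
  (forall m' p', J m' -> (1 <= p')%N -> 1 <= x (m', p') <= 2) -> 0 < h < 1 ->
  (\int[lebesgue_measure]_(z in `[1%R, 2%R]) (gg_trunc K (upd x (m, p) z))%:E
    <= (gg_bound h)%:E)%E.
Proof.
move=> mK pK x12 /andP[h0 h1].
have pK' : (1 <= p < K)%N by rewrite p1.
pose th := mean_fe_at spec J wof gamma P gSK gP K m p x.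
have cth : continuous th by exact: (mean_fe_at_continuous HD2pos N0 HgSK HgP Hindep mK Jm pK').
pose C : R := M / (n%:R * h * c ^+ 2).
have c0 : 0 < c by exact: strength_gt0.
have n0 : 0 < n%:R :> R by rewrite ltr0n (leq_trans _ n2).
have C0 : 0 <= C by rewrite divr_ge0// !mulr_ge0 ?sqr_ge0// ltW.
rewrite /gg_bound -/C.
have -> : 12 * h ^+ 2 * c ^+ 2 = 2 * h * (6 * h * c ^+ 2) by ring.
apply: (@second_difference_average _ th) => //; first exact/andP.
- move=> z /andP[z1 z3].
  have hz : 0 <= h <= z by rewrite (ltW h0) (le_trans (ltW h1)).
  apply: (le_trans (mean_fe_at_diff gamma HD2pos HWsub N0 HgSK HgP Hindep mK Jm pK' x hz)).
  have -> : 6 = 2 * 3 :> R by ring.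
  by rewrite !ler_wpM2r ?sqr_ge0 ?(ltW h0)// ler_wpM2l.
- apply: (@measurable_gg_trunc _ (measurableTypeR R) K (fun z => upd x (m, p) z)).
  by move=> m' q _ _; rewrite /upd; case: eqP => _ //; exact: measurable_id.
- by move=> z; exact: gg_trunc_ge0.
- move=> z z12; apply: (gg_defect_le HD2pos HWsub N0 gamma_range HgSK HgP Hindep
    mK Jm pK' x12 n2 fM z12); exact/andP.
Qed.

Lemma ae_uniform : {ae Px, forall om, forall m q, J m -> (1 <= q)%N -> 1 <= X m q om <= 2}.
Proof.
apply: ae_foralln => m'; apply: ae_foralln => q.
have [[Jm' q1]|nJ] := pselect (J m' /\ (1 <= q)%N).
  by apply: filterS (uniform12_ae (HX Jm' q1)) => om h _ _.
by apply: aeW => om Jm' q1; exfalso; apply: nJ.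
Qed.

Let mX m' q : J m' -> (1 <= q)%N -> measurable_fun setT (X m' q).
Proof. by move=> Jm' q1; have [] := HX Jm' q1. Qed.

(** The parameter at [(m, p)] is resampled; given the others, the inner expectation is the Lebesgue
    integral of [gg_trunc_integral_le]. That bound asks for parameters in [1, 2], which holds almost
    surely. *)
Lemma mean_gg_trunc_le K h : (m < K)%N -> (p < K)%N -> 0 < h < 1 ->
  \int[Px]_om gg_trunc K (fun mq => X mq.1 mq.2 om) <= gg_bound h.
Proof.
move=> mK pK h01.
have Dm : levels (m, p) by [].
have mXc k : levels k -> measurable_fun setT (Xc k) by case=> Jk k1; exact: mX.
pose F (y : @coord_space R _ levels) := (gg_trunc K y)%:E.
have mF : measurable_fun setT F.
  apply/measurable_EFinP; apply: (@measurable_gg_trunc _ (@coord_space R _ levels) K (fun y => y)).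
  by move=> m' q Jm' q1; exact: measurable_coord.
have F0 y : (0 <= F y)%E by rewrite lee_fin gg_trunc_ge0.
have B0 : 0 <= gg_bound h.
  have [h0 _] := andP h01.
  by rewrite mulr_ge0 ?divr_ge0// ?addr_ge0 ?mulr_ge0 ?sqr_ge0 ?sqrtr_ge0 ?(ltW h0).
have H := resample_ge0 mXc HXindep Dm mF F0.
have mR : measurable_fun setT (fun om => \int[Px]_om' F (upd (sample levels Xc om) (m, p) (X m p om')))%E.
  exact: (measurable_resample_integral Px mXc Dm mF F0).
have le1 : (\int[Px]_om F (sample levels Xc om) <= (gg_bound h)%:E)%E.
  rewrite H -[leRHS](_ : (\int[Px]_om (gg_bound h)%:E = _)%E); last first.
    by rewrite integral_cst//= probability_setT mule1.
  apply: ae_ge0_le_integral => //.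
  - by move=> om _; exact: integral_ge0.
  apply: filterS ae_uniform => om x12 _.
  have mFz : measurable_fun setT (fun z => F (upd (sample levels Xc om) (m, p) z)).
    apply: measurableT_comp mF _.
    exact: (measurable_upd2 _ (measurable_cst _) (@measurable_id _ (measurableTypeR R) _)).
  rewrite (uniform12_ge0_integral (HX Jm p1) mFz)//.
  exact: gg_trunc_integral_le.
rewrite -lee_fin (le_trans _ le1)// /Rintegral fineK//.
rewrite ge0_fin_numE; last by apply: integral_ge0 => om _; rewrite lee_fin gg_trunc_ge0.
exact: le_lt_trans le1 (ltry _).
Qed.

Local Notation Hinf x om :=
  (H_pert spec J wof gamma x (fun i j => gSK i j om) (fun m t => gP m t om)).

Definition gg_limit (x : nat -> nat -> R) : R :=
  gg_defect P spec (fun om => Hinf x om) f (wof m) p.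

Lemma measurable_H_pert {d'} {T : measurableType d'} (x : T -> nat -> nat -> R)
    (om : T -> Om) (sg : conf) :
  (forall m q, J m -> (1 <= q)%N -> measurable_fun setT (fun t => x t m q)) ->
  measurable_fun setT om ->
  measurable_fun setT (fun t => Hinf (x t) (om t) sg).
Proof.
move=> mx mom; apply: measurable_funD.
  apply: (measurable_H_SK (g := fun t i j => gSK i j (om t))) => i j.
  by apply: measurableT_comp => //; have [] := HgSK i j.
apply: measurable_funM => //; rewrite /h_N.
apply: measurable_limn => K.
apply: (measurable_pert_trunc spec wof (x := fun t mq => x t mq.1 mq.2)
  (g := fun t m u => gP m u (om t))) => // m' t Jm' t1.
by apply: measurableT_comp => //; have [] := HgP Jm' t1.
Qed.

(** The indices are embedded by [inr], and the [inl] side is given the whole line. *)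
Lemma indep_gP : mutually_independent P
  [set mt : nat * seq 'I_N | J mt.1 /\ (1 <= size mt.2)%N]
  (fun mt => gP mt.1 mt.2).
Proof.
move=> F FD B mB.
pose F' : {fset ('I_N * 'I_N) + (nat * seq 'I_N)} := (inr @` F)%fset.
pose B' (k : ('I_N * 'I_N) + (nat * seq 'I_N)) := if k is inr mt then B mt else setT.
have := @Hindep F' _ B' _.
rewrite big_imfset/=; last by move=> k k' _ _ [].
have -> : \bigcap_(i in [set` F']) (disorder gSK gP i @^-1` B' i) =
    \bigcap_(i in [set` F]) ((fun mt : nat * seq 'I_N => gP mt.1 mt.2) i @^-1` B i).
  apply/seteqP; split=> om H k /= kF.
    by apply: (H (inr k)); rewrite /= /F'; apply/imfsetP; exists k.
  by move: kF => /imfsetP[k' /= k'F ->]; exact: H.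
apply.
- by move=> k /imfsetP[k' /= /FD Dk' ->].
- by case=> [ij|mt] /=; [exact: measurableT|exact: mB].
Qed.

Lemma gg_trunc_cvg (x : nat -> nat -> R) :
  (forall m q, J m -> (1 <= q)%N -> 1 <= x m q <= 2) ->
  (fun K => gg_trunc K (fun mq => x mq.1 mq.2)) @ \oo --> gg_limit x.
Proof.
move=> x12; apply: gg_defect_cvg.
- move=> K sg; exact: (@measurable_ham_trunc _ Om K (fun _ mq => x mq.1 mq.2) (fun om => om)).
- move=> sg; exact: (@measurable_H_pert _ Om (fun _ => x) (fun om => om)).
apply: filterS (ae_pert_trunc_cvg spec HWsub N0 HgP indep_gP) => om cH sg.
apply: cvgD; first exact: cvg_cst.
apply: cvgM; first exact: cvg_cst.
apply: (cH (fun mq => x mq.1 mq.2)) => m' q Jm' q1.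
by have /andP[x1 x2] := x12 _ _ Jm' q1; rewrite ger0_norm// (le_trans ler01).
Qed.

Lemma mean_gg_limit_le h : 0 < h < 1 ->
  0 <= \int[Px]_om gg_limit (fun m q => X m q om) <= gg_bound h.
Proof.
move=> h01; apply/andP; split.
  by apply: Rintegral_ge0 => om _; exact: normr_ge0.
have w1 s1 s2 : `|overlap_w spec (wof m) s1 s2| <= 1.
  exact: (normr_overlap_w spec HWsub).
have cv : (fun K => \int[Px]_om gg_trunc K (fun mq => X mq.1 mq.2 om)) @ \oo -->
    \int[Px]_om gg_limit (fun m q => X m q om).
  apply: (@cvg_Rintegral_bounded _ _ _ _ _ _ (3 * M)).
  - by move=> K; apply: (@measurable_gg_trunc _ Omx K (fun om mq => X mq.1 mq.2 om)) => m' q; exact: mX.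
  - apply: (measurable_gg_defect spec P f (wof m) p
      (H := fun z : Omx * Om => Hinf (fun m q => X m q z.1) z.2)) => sg.
    apply: (@measurable_H_pert _ (Omx * Om)%type (fun z m q => X m q z.1) snd) => //.
    by move=> m' q Jm' q1; exact: measurableT_comp (mX Jm' q1) _.
  - move=> K om; rewrite ger0_norm ?gg_trunc_ge0//; apply: gg_defect_bound => // sg.
    exact: (@measurable_ham_trunc _ Om K (fun _ mq => X mq.1 mq.2 om) (fun om => om)).
  by apply: filterS ae_uniform => om x12; exact: gg_trunc_cvg.
apply: (ler_cvg_to cv (cvg_cst (gg_bound h))).
near=> K; apply: mean_gg_trunc_le => //.
- by near: K; exact: nbhs_infty_gt.
- by near: K; exact: nbhs_infty_gt.
Unshelve. all: by end_near. Qed.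

End averaged.

(** * Choice of the step and conclusion *)

(** Here [t] is [N^(2 gamma - 1/2)], [s] is [sqrt N] and [q] is [4^-(m + p)], so that [c^2 = t s q]
    and [V = C s]. Each of the two error terms gets [e / 2]: one from the choice of [h], the other
    once [t] is large. *)
Lemma rate_le {R : realFieldType} (M n h t s q C e : R) :
  0 <= M -> 1 <= n -> 0 < h -> 0 < t -> 1 <= s -> 0 < q -> 0 <= C -> 0 <= e ->
  24 * M * h <= e -> 2 * M * (2 + 4 * C) <= h * q * e * t ->
  M / (n * h * (t * s * q)) * (2 + 4 * (C * s) + 12 * h ^+ 2 * (t * s * q)) <= e.
Proof.
move=> M0 n1 h0 t0 s1 q0 C0 e0 Mh MC.
have s0 : 0 < s by exact: lt_le_trans ltr01 s1.
have n0 : 0 < n by exact: lt_le_trans ltr01 n1.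
have htsq : 0 < h * (t * s * q) by rewrite !mulr_gt0.
have E : M / (n * h * (t * s * q)) * (2 + 4 * (C * s) + 12 * h ^+ 2 * (t * s * q)) =
    (M * (2 + 4 * (C * s)) / (h * (t * s * q)) + 12 * M * h) / n.
  by field; rewrite !gt_eqF.
rewrite E ler_pdivrMr//.
apply: (@le_trans _ _ e); last by rewrite ler_peMr.
have h1 : M * (2 + 4 * (C * s)) / (h * (t * s * q)) <= e / 2.
  rewrite ler_pdivrMr//.
  apply: (@le_trans _ _ (M * (2 + 4 * C) * s)).
    rewrite -mulrA ler_wpM2l//.
    have -> : (2 + 4 * C) * s = 2 * s + 4 * (C * s) by ring.
    lra.
  have -> : e / 2 * (h * (t * s * q)) = (h * q * e * t) / 2 * s by field.
  rewrite ler_wpM2r ?(ltW s0)//; lra.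
have h2 : 12 * M * h <= e / 2 by lra.
lra.
Qed.

Theorem theorem2
  (R : realType) (S : finType)
  (* species partition of {1..N}: site i is in I_s iff spec N i = s *)
  (spec : forall N : nat, 'I_N -> S) (lam : S -> R)
  (Hlam : forall s, 0 < lam s < 1 /\
     (fun N : nat => (Nsp (spec N) s)%:R / N%:R) @ \oo --> lam s)
  (* variance matrix Delta^2 *)
  (Delta2 : S -> S -> R)
  (HD2sym : forall s t, Delta2 s t = Delta2 t s)
  (HD2pos : forall s t, 0 <= Delta2 s t)
  (* the countable dense set W of [0,1]^S and the injection j : W -> nat,
     encoded by J = j(W) and wof = j^{-1} on J *)
  (J : set nat) (wof : nat -> S -> R)
  (HWsub : forall m, J m -> forall s, 0 <= wof m s <= 1)
  (HWinj : forall m1 m2, J m1 -> J m2 -> wof m1 = wof m2 -> m1 = m2)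
  (HWdense : forall v : S -> R, (forall s, 0 <= v s <= 1) ->
     forall e : R, 0 < e -> exists m, J m /\ forall s, `|wof m s - v s| < e)
  (* the exponent gamma of s_N = N^gamma *)
  (gamma : R) (Hgamma : 1 / 4 < gamma < 1 / 2)
  (* Gaussian disorder *)
  (dO : measure_display) (Omega : measurableType dO) (P : probability Omega R)
  (gSK : forall N, 'I_N -> 'I_N -> Omega -> R)
  (gP : forall N, nat -> seq 'I_N -> Omega -> R)
  (HgSK : forall N (i j : 'I_N),
     centered_gaussian P (gSK N i j) (Delta2 (spec N i) (spec N j)))
  (HgP : forall N m (t : seq 'I_N), J m -> (1 <= size t)%N ->
     centered_gaussian P (gP N m t) 1)
  (Hindep : forall N,
     mutually_independent P
       [set k : (('I_N * 'I_N) + (nat * seq 'I_N))%type |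
          match k with inl _ => True | inr mt => J mt.1 /\ (1 <= size mt.2)%N end]
       (fun k => match k with inl ij => gSK N ij.1 ij.2
                            | inr mt => gP N mt.1 mt.2 end))
  (* the perturbation parameters x_{w,p}, i.i.d. uniform on [1,2] *)
  (dx : measure_display) (Omegax : measurableType dx) (Px : probability Omegax R)
  (X : nat -> nat -> Omegax -> R)
  (HX : forall m p, J m -> (1 <= p)%N -> uniform12 Px (X m p))
  (HXindep : mutually_independent Px
       [set mp : (nat * nat)%type | J mp.1 /\ (1 <= mp.2)%N]
       (fun mp => X mp.1 mp.2)) :
  forall (n : nat), (2 <= n)%N ->
  forall f : #|{: S * 'I_n * 'I_n}|.-tuple R -> R,
    measurable_fun setT f ->
    (exists M : R, forall v, `|f v| <= M) ->
  forall (p : nat), (1 <= p)%N ->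
  forall m0, J m0 ->
    (fun N : nat =>
       Rintegral Px setT
         (fun om => Delta P spec J wof gamma gSK gP N f (wof m0) p
                      (fun m q => X m q om)))
      @ \oo --> 0.

Proof.
move=> n n2 f _ [M fM] p p1 m0 Jm0.
have M0 : 0 <= M by exact: le_trans (normr_ge0 _) (fM [tuple of nseq _ 0]).
have [g14 g12] := andP Hgamma.
have g_range : 0 <= gamma <= 1 / 2 by apply/andP; split; lra.
have bound N h : (0 < N)%N -> 0 < h < 1 ->
    0 <= Rintegral Px setT (fun om => Delta P spec J wof gamma gSK gP N f (wof m0) p
      (fun m q => X m q om)) <=
    gg_bound (N := N) gamma Delta2 n M m0 p h.
  move=> N0 h01.
  (* [Delta] and [gg_limit] unfold to the same expression. *)
  exact: (mean_gg_limit_le HD2pos HWsub N0 g_range (HgSK N) (HgP N) (Hindep N)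
    HX HXindep n2 fM Jm0 p1 h01).
apply/cvgrPdist_le => e e0.
(* Chosen so that [24 M h <= e]; [M + 1] avoids a division by zero, and [1 / 2] keeps [h < 1]. *)
pose h : R := Num.min (1 / 2) (e / (24 * (M + 1))).
have h0 : 0 < h by rewrite lt_min divr_gt0//= divr_gt0// mulr_gt0// ltr_wpDl.
have h1 : h < 1 by rewrite gt_min; apply/orP; left; lra.
have Mh : 24 * M * h <= e.
  apply: (@le_trans _ _ (24 * (M + 1) * h)).
    by rewrite ler_wpM2r ?(ltW h0)// ler_wpM2l// lerDl.
  rewrite mulrC -ler_pdivlMr; last by rewrite mulr_gt0// ltr_wpDl.
  by rewrite ge_min lexx orbT.
pose q : R := (2 ^- (m0 + p)) ^+ 2.
have q0 : 0 < q by rewrite exprn_gt0// invr_gt0 exprn_gt0.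
pose C : R := Num.sqrt (total_variance Delta2 + 18).
pose A : R := 2 * M * (2 + 4 * C) / (h * q * e).
have C0 : 0 <= C by exact: sqrtr_ge0.
have A0 : 0 <= A by rewrite divr_ge0 ?mulr_ge0 ?addr_ge0 ?mulr_ge0 ?(ltW h0) ?(ltW q0) ?(ltW e0).
(* The exponent left in [c^2 / sqrt N], positive because [gamma > 1 / 4]; [A] is the threshold that
   [N^del] has to pass. *)
pose del : R := 2 * gamma - 1 / 2.
have del0 : 0 < del by rewrite /del; lra.
near=> N.
have N0 : (0 < N)%N by near: N; exact: nbhs_infty_gt.
have NA : A `^ del^-1 <= N%:R by near: N; exact: nbhs_infty_ger.
have /andP[b0 b1] := bound N h N0 (introT andP (conj h0 h1)).
rewrite sub0r normrN ger0_norm//; apply: (le_trans b1).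
have NR0 : 0 < N%:R :> R by rewrite ltr0n.
have tA : A <= N%:R `^ del.
  have -> : A = (A `^ del^-1) `^ del by rewrite -powRrM mulVf ?gt_eqF// powRr1.
  by apply: ge0_ler_powR; rewrite ?nnegrE ?powR_ge0// ltW.
have ce : (@strength R N gamma m0 p) ^+ 2 = N%:R `^ del * Num.sqrt N%:R * q.
  rewrite /strength exprMn -/q; congr (_ * _).
  rewrite -powR12_sqrt ?(ltW NR0)// expr2 -!powRD ?(gt_eqF NR0) ?implybT//.
  by congr (_ `^ _); rewrite /del; field.
rewrite /gg_bound /fluct_bound sqrtrM; last first.
  by rewrite addr_ge0//; apply: sumr_ge0 => s _; exact: sumr_ge0.
rewrite ce -/C; apply: rate_le => //.
- by rewrite ler1n (leq_trans _ n2).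
- exact: powR_gt0.
- by rewrite -[leLHS]sqrtr1 ler_wsqrtr// ler1n.
- exact: ltW.
- by rewrite [leRHS]mulrC -ler_pdivrMr ?mulr_gt0.
Unshelve. all: by end_near. Qed.
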